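(* Let $R$ be a connective $\mathbf{E}_1$-ring and $M$ a connective, homologically even $R$-module. Then there are canonical isomorphisms 1. $\mathrm{H}^{0,0}_{ev}(R,M)\simeq\pi_0M$, 2. $\mathrm{H}^{0,1}_{ev}(R,M)\simeq\mathrm{coker}(\pi_1R\otimes_{\mathbb{Z}}\pi_1M\to\pi_2M)$, 3. $\mathrm{H}^{1,1}_{ev}(R,M)\simeq\pi_1M$, 4. $\mathrm{H}^{2,2}_{ev}(R,M)\simeq\mathrm{im}(\pi_1R\otimes_{\mathbb{Z}}\pi_1M\to\pi_2M)$, where $\pi_1R\otimes_{\mathbb{Z}}\pi_1M\to\pi_2M$ is the multiplication map given by the $R$-module structure of $M$.
   Context: An $\mathbf{E}_1$-ring is an $\mathbf{E}_1$-algebra in spectra; $R$-modules are left $R$-module spectra. An $R$-module is perfect even if it lies in the smallest full subcategory $\mathrm{Perf}(R)_{ev}\subseteq\mathrm{Mod}_R$ containing $\Sigma^{2k}R$ for all $k\in\mathbb{Z}$ and closed under extensions and retracts. A map in $\mathrm{Perf}(R)_{ev}$ is an even epimorphism if its fibre in $\mathrm{Mod}_R$ is perfect even; $\mathrm{Perf}(R)_{ev}$ carries the Grothendieck topology whose covering families are single even epimorphisms. For an $R$-module $M$ and $q\in\frac12\mathbb{Z}$, the even sheaf $\mathcal{F}_M(q)$ is the sheafification of the presheaf of abelian groups $A\mapsto\pi_{2q}\mathrm{map}_{\mathrm{Mod}_R}(A,M)$ on $\mathrm{Perf}(R)_{ev}$; it is an additive sheaf. $M$ is homologically even if $\mathcal{F}_M(q)=0$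 for all $q\in\frac12+\mathbb{Z}$. Even cohomology is $\mathrm{H}^{p,q}_{ev}(R,M):=\mathrm{H}^p_{\mathrm{Perf}(R)_{ev}}(R,\mathcal{F}_M(q))$, the right derived functors of sections over $R$ on the category of additive sheaves of abelian groups on $\mathrm{Perf}(R)_{ev}$. *)

(* Defs.v *)
From HB Require Import structures.
From mathcomp Require Import all_boot all_algebra.
From mathcomp Require Import boolp.

Set Implicit Arguments.
Unset Strict Implicit.
Unset Printing Implicit Defensive.

Import GRing.Theory.

Local Open Scope ring_scope.
Local Open Scope quotient_scope.

(* E_1-rings are modelled by symmetric ring spectra in simplicial sets (strictly
   associative, not necessarily commutative), and left modules over an E_1-ring
   by left modules over such a ring.  Everything is taken stably fibrant:
   levelwise Kan, with adjoint structure maps X(B) -> Loops X(1 + B) weak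
   equivalences.  Between such spectra the stable equivalences are the levelwise
   weak equivalences, so the homotopy category of Mod_R is the localisation of
   the category of these R-modules at the levelwise weak equivalences.

   Symmetric sequences are indexed by finite sets and bijections instead of by
   natural numbers and symmetric groups. *)

Section Subgroup.
Variables (V : zmodType) (S : zmodClosed V).

Record subgroup := Subgroup { sgval : V; sgvalP : sgval \in S }.

HB.instance Definition _ := [isSub for sgval].
HB.instance Definition _ := [Choice of subgroup by <:].
HB.instance Definition _ := [SubChoice_isSubZmodule of subgroup by <:].

End Subgroup.

(* The vertices of the n-simplex.  Neither ordinals nor finite functions are
   used here: they would tie the universe of simplicial sets to that of the
   MathComp algebraic structures. *)
Definition vert (n : nat) : Set := {i : nat | (i <= n)%N}.

Record Delta (m n : nat) : Set := DeltaMap {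
  dfun :> vert m -> vert n;
  dfun_mono : forall i j, (sval i <= sval j)%N ->
    (sval (dfun i) <= sval (dfun j))%N }.

Lemma Delta_ext m n (f g : Delta m n) : f =1 g -> f = g.
Proof.
case: f g => [f fm] [g gm] /= /funext e; case: _ / e gm => gm.
by congr DeltaMap; apply: Prop_irrelevance.
Qed.

Definition Delta_id n : Delta n n := @DeltaMap n n id (fun _ _ => id).

Definition Delta_comp m n p (g : Delta n p) (f : Delta m n) : Delta m p :=
  @DeltaMap m p (fun i => g (f i)) (fun i j ij => dfun_mono g (dfun_mono f ij)).

Lemma Delta_compA m n p q (h : Delta p q) (g : Delta n p) (f : Delta m n) :
  Delta_comp h (Delta_comp g f) = Delta_comp (Delta_comp h g) f.
Proof. exact: Delta_ext. Qed.

Lemma Delta_comp1 m n (f : Delta m n) : Delta_comp f (Delta_id m) = f.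
Proof. exact: Delta_ext. Qed.

Record sSet := SSet {
  simp :> nat -> Type;
  sact : forall m n, Delta m n -> simp n -> simp m;
  sact_id : forall n (x : simp n), sact (Delta_id n) x = x;
  sact_comp : forall m n p (g : Delta n p) (f : Delta m n) (x : simp p),
    sact f (sact g x) = sact (Delta_comp g f) x }.

Record smap (X Y : sSet) := SMap {
  sfun :> forall n, X n -> Y n;
  sfun_nat : forall m n (a : Delta m n) (x : X n),
    sfun (sact a x) = sact a (sfun x) }.

Lemma smap_ext (X Y : sSet) (f g : smap X Y) :
  (forall n x, f n x = g n x) -> f = g.
Proof.
case: f g => [f fn] [g gn] /= fg.
have e : f = g by apply: functional_extensionality_dep => n; apply: funext.
by case: _ / e gn => gn; congr SMap; apply: Prop_irrelevance.
Qed.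

Definition smap_id (X : sSet) : smap X X :=
  @SMap X X (fun n x => x) (fun _ _ _ _ => erefl).

Fact smap_comp_subproof (X Y Z : sSet) (g : smap Y Z) (f : smap X Y) m n
  (a : Delta m n) (x : X n) : g m (f m (sact a x)) = sact a (g n (f n x)).
Proof. by rewrite !sfun_nat. Qed.

Definition smap_comp (X Y Z : sSet) (g : smap Y Z) (f : smap X Y) : smap X Z :=
  SMap (smap_comp_subproof g f).

Definition simplex n : sSet :=
  @SSet (fun m => Delta m n) (fun _ _ a x => Delta_comp x a)
    (fun _ x => Delta_comp1 x) (fun _ _ _ g f x => esym (Delta_compA x g f)).

Definition Delta_map m n (a : Delta m n) : smap (simplex m) (simplex n) :=
  @SMap (simplex m) (simplex n) (fun _ x => Delta_comp a x)
    (fun _ _ b x => Delta_compA a x b).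

Definition sprod (X Y : sSet) : sSet.
Proof.
refine (@SSet (fun n => (X n * Y n)%type)
  (fun _ _ a x => (sact a x.1, sact a x.2)) _ _).
- by move=> n [x y]; rewrite /= !sact_id.
- by move=> m n p g f [x y]; rewrite /= !sact_comp.
Defined.

Definition in_horn n (k : vert n.+1) m (x : Delta m n.+1) : Prop :=
  exists2 i, i <> k & forall j, x j <> i.

Fact horn_subproof n (k : vert n.+1) m p (a : Delta m p) (x : Delta p n.+1) :
  in_horn k x -> in_horn k (Delta_comp x a).
Proof. by case=> i ik h; exists i => // j; apply: h. Qed.

Definition horn n (k : vert n.+1) : sSet.
Proof.
refine (@SSet (fun m => {x : Delta m n.+1 | in_horn k x})
  (fun _ _ a x => exist (@in_horn n k _) _
     (horn_subproof a (proj2_sig x))) _ _).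
- by move=> m [x hx]; apply: eq_exist; apply: Delta_comp1.
- by move=> m p q g f [x hx]; apply: eq_exist; rewrite /= Delta_compA.
Defined.

Definition kan_fibration (E B : sSet) (p : smap E B) : Prop :=
  forall n (k : vert n.+1) (u : smap (horn k) E) (v : smap (simplex n.+1) B),
    (forall m (x : horn k m), p m (u m x) = v m (sval x)) ->
    exists w : smap (simplex n.+1) E,
      (forall m (x : horn k m), w m (sval x) = u m x) /\
      (forall m (x : simplex n.+1 m), p m (w m x) = v m x).

Definition kan (X : sSet) : Prop :=
  forall n (k : vert n.+1) (u : smap (horn k) X),
    exists w : smap (simplex n.+1) X,
      forall m (x : horn k m), w m (sval x) = u m x.

Definition Delta_const m n (i : vert n) : Delta m n :=
  @DeltaMap m n (fun=> i) (fun _ _ _ => leqnn (sval i)).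

Definition vert0 : vert 1 := exist _ 0%N (leq0n 1).
Definition vert1 : vert 1 := exist _ 1%N (leqnn 1).

Definition homotopic (X Y : sSet) (f g : smap X Y) : Prop :=
  exists h : smap (sprod (simplex 1) X) Y,
    forall n (x : X n), h n (Delta_const n vert0, x) = f n x /\
                        h n (Delta_const n vert1, x) = g n x.

(* Only used between Kan complexes, where weak equivalences are homotopy
   equivalences and one-step homotopy is an equivalence relation. *)
Definition weak_equiv (X Y : sSet) (f : smap X Y) : Prop :=
  exists g : smap Y X, homotopic (smap_comp g f) (smap_id X) /\
                       homotopic (smap_comp f g) (smap_id Y).

Record psSet := PSSet {
  pspace :> sSet;
  pt : forall n, pspace n;
  pt_nat : forall m n (a : Delta m n), sact a (pt n) = pt m }.

Definition smap_pt (X : sSet) (Y : psSet) : smap X Y :=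
  @SMap X Y (fun n _ => pt Y n) (fun _ _ a _ => esym (pt_nat Y a)).

Definition boundary n (s : Delta n 1) : Prop := exists i, s = Delta_const n i.

Lemma boundary_comp m n (s : Delta n 1) (a : Delta m n) :
  boundary s -> boundary (Delta_comp s a).
Proof.
by case=> i ->; exists i; apply: Delta_ext.
Qed.

(* The simplicial set of pointed maps from the circle (the 1-simplex modulo its
   boundary) to X. *)
Definition is_loop (X : psSet) n (f : smap (sprod (simplex 1) (simplex n)) X) :=
  forall m (s : Delta m 1) (a : Delta m n), boundary s -> f m (s, a) = pt X m.

Definition loop_sact (X : psSet) m n (a : Delta m n)
  (f : smap (sprod (simplex 1) (simplex n)) X) :
  smap (sprod (simplex 1) (simplex m)) X.
Proof.
refine (@SMap (sprod (simplex 1) (simplex m)) X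
  (fun p x => f p (x.1, Delta_comp a x.2)) _).
by move=> p q b [s x]; rewrite /= -sfun_nat /= Delta_compA.
Defined.

Fact loop_sact_subproof (X : psSet) m n (a : Delta m n) f :
  is_loop (X := X) f -> is_loop (X := X) (loop_sact a f).
Proof. by move=> h p s b sb /=; apply: h. Qed.

Definition loops (X : psSet) : sSet.
Proof.
refine (@SSet (fun n => {f : smap (sprod (simplex 1) (simplex n)) X | is_loop f})
  (fun _ _ a x => exist (@is_loop X _) _
     (loop_sact_subproof a (proj2_sig x))) _ _).
- move=> n [f fl]; apply: eq_exist; apply: smap_ext => m [s b] /=.
  by congr (f m (_, _)); apply: Delta_ext.
- move=> m n p g f [x xl]; apply: eq_exist; apply: smap_ext => q [s b] /=.
  by rewrite Delta_compA.
Defined.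

Section Bijections.
Variables A B C A' B' : Type.

Definition sum_assoc (x : (A + B) + C) : A + (B + C) :=
  match x with
  | inl (inl a) => inl a
  | inl (inr b) => inr (inl b)
  | inr c => inr (inr c)
  end.

Lemma sum_assoc_bij : bijective sum_assoc.
Proof.
exists (fun x => match x with
  | inl a => inl (inl a)
  | inr (inl b) => inl (inr b)
  | inr (inr c) => inr c
  end); by [case=> [[]|] | case=> [|[]]].
Qed.

Definition sum_swap (x : A + B) : B + A :=
  match x with inl a => inr a | inr b => inl b end.

Lemma sum_swap_bij : bijective sum_swap.
Proof.
by exists (fun x => match x with inl b => inr b | inr a => inl a end); case.
Qed.

Definition sum_void (x : Empty_set + A) : A :=
  match x with inl v => match v with end | inr a => a end.

Lemma sum_void_bij : bijective sum_void.
Proof. by exists inr => // -[[]|]. Qed.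

Definition sum_map (f : A -> A') (g : B -> B') (x : A + B) : A' + B' :=
  match x with inl a => inl (f a) | inr b => inr (g b) end.

Lemma sum_map_bij f g : bijective f -> bijective g -> bijective (sum_map f g).
Proof.
case=> f' ff' f'f [g' gg' g'g].
exists (fun x => match x with inl a => inl (f' a) | inr b => inr (g' b) end).
- by case=> x /=; rewrite ?ff' ?gg'.
- by case=> x /=; rewrite ?f'f ?g'g.
Qed.

Definition sum_case (f : A -> C) (g : B -> C) (x : A + B) : C :=
  match x with inl a => f a | inr b => g b end.

End Bijections.

(* Finite sets in Set, again to keep universes apart. *)
Definition finite (A : Set) : Prop :=
  exists n (f : A -> nat), injective f /\ forall x, (f x < n)%N.

Record finset := FinSet { fcar :> Set; fcarP : finite fcar }.

Fact fvoid_subproof : finite Empty_set.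
Proof. by exists 0%N, (fun=> 0%N); split; case. Qed.

Fact funit_subproof : finite unit.
Proof. by exists 1%N, (fun=> 0%N); split=> // -[] []. Qed.

Fact fsum_subproof (A B : finset) : finite (A + B).
Proof.
case: A B => [A [m [f [fi fm]]]] [B [n [g [gi gn]]]] /=.
exists (m + n)%N, (fun x => match x with inl a => f a | inr b => m + g b end)%N.
split=> [[a|b] [a'|b']|[a|b]].
- by move/fi->.
- by move=> e; have := fm a; rewrite e ltnNge leq_addr.
- by move=> e; have := fm a'; rewrite -e ltnNge leq_addr.
- by move/addnI/gi->.
- by rewrite (leq_trans (fm a)) // leq_addr.
- by rewrite ltn_add2l.
Qed.

Definition fvoid : finset := FinSet fvoid_subproof.
Definition funit : finset := FinSet funit_subproof.
Definition fsum (A B : finset) : finset := FinSet (fsum_subproof A B).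

Definition fassoc (A B C : finset) : fsum (fsum A B) C -> fsum A (fsum B C) :=
  @sum_assoc A B C.
Definition fswap (A B : finset) : fsum A B -> fsum B A := @sum_swap A B.
Definition flunit (A : finset) : fsum fvoid A -> A := @sum_void A.
Definition fmap (A A' B B' : finset) (f : A -> A') (g : B -> B') :
  fsum A B -> fsum A' B' := sum_map f g.

Definition fassoc_bij A B C : bijective (@fassoc A B C) := sum_assoc_bij A B C.
Definition fswap_bij A B : bijective (@fswap A B) := sum_swap_bij A B.
Definition flunit_bij A : bijective (@flunit A) := sum_void_bij A.
Definition fmap_bij (A A' B B' : finset) (f : A -> A') (g : B -> B') :
  bijective f -> bijective g -> bijective (fmap f g) := @sum_map_bij A B A' B' f g.

Record symseq := SymSeq {
  lev :> finset -> psSet;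
  bact : forall (A B : finset) (f : A -> B), bijective f -> smap (lev A) (lev B);
  bact_pt : forall (A B : finset) (f : A -> B) (e : bijective f) n,
    bact e n (pt (lev A) n) = pt (lev B) n;
  bact_id : forall (A : finset) (e : bijective (@id A)) n x, bact e n x = x;
  bact_comp : forall (A B C : finset) (f : A -> B) (g : B -> C) (ef : bijective f)
    (eg : bijective g) (egf : bijective (g \o f)) n x,
    bact eg n (bact ef n x) = bact egf n x }.

(* [susp B n s x] is the image of (s, x) under the structure map
   S^1 /\ X(B) -> X(1 + B), the simplices of S^1 being represented by those of
   the 1-simplex. *)
Definition fibrant (X : symseq)
  (susp : forall (B : finset) n, Delta n 1 -> X B n -> X (fsum funit B) n) :=
  (forall A, kan (X A)) /\
  forall B, exists t : smap (X B) (loops (X (fsum funit B))),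
    weak_equiv t /\
    forall n (x : X B n) m (s : Delta m 1) (a : Delta m n),
      sval (t n x) m (s, a) = susp B m s (sact a x).

(* A pairing X(A) /\ Y(B) -> Z(A + B). *)
Record pairing (X Y Z : symseq) := Pairing {
  pprod :> forall A B n, X A n -> Y B n -> Z (fsum A B) n;
  pprod_nat : forall A B m n (a : Delta m n) (x : X A n) (y : Y B n),
    pprod (sact a x) (sact a y) = sact a (pprod x y);
  pprod_ptl : forall A B n (y : Y B n), pprod (pt (X A) n) y = pt (Z (fsum A B)) n;
  pprod_ptr : forall A B n (x : X A n), pprod x (pt (Y B) n) = pt (Z (fsum A B)) n;
  pprod_bact : forall (A A' B B' : finset) (f : A -> A') (g : B -> B')
    (ef : bijective f) (eg : bijective g) n (x : X A n) (y : Y B n),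
    pprod (bact X ef n x) (bact Y eg n y) =
      bact Z (fmap_bij ef eg) n (pprod x y) }.

(* [runit] is the unit S^A -> R(A), where the sphere S^A is the cube on A modulo
   its boundary: an n-simplex of the cube is a family A -> Delta n 1. *)
Record E1ring := E1Ring {
  rlev :> symseq;
  rmul : pairing rlev rlev rlev;
  runit : forall (A : finset) n, (A -> Delta n 1) -> rlev A n;
  runit_nat : forall (A : finset) m n (a : Delta m n) (s : A -> Delta n 1),
    runit (fun i => Delta_comp (s i) a) = sact a (runit s);
  runit_pt : forall (A : finset) n (s : A -> Delta n 1),
    (exists i, boundary (s i)) -> runit s = pt (rlev A) n;
  runit_bact : forall (A B : finset) (f : A -> B) (ef : bijective f) n
    (s : B -> Delta n 1), bact rlev ef n (runit (s \o f)) = runit s;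
  runitM : forall (A B : finset) n (s : A -> Delta n 1) (t : B -> Delta n 1),
    runit (sum_case s t : fsum A B -> Delta n 1) = rmul A B n (runit s) (runit t);
  rmulA : forall (A B C : finset) n (x : rlev A n) (y : rlev B n) (z : rlev C n),
    bact rlev (fassoc_bij A B C) n
      (rmul (fsum A B) C n (rmul A B n x y) z) =
    rmul A (fsum B C) n x (rmul B C n y z);
  rmul1 : forall (A : finset) n (s : fvoid -> Delta n 1) (x : rlev A n),
    bact rlev (flunit_bij A) n (rmul fvoid A n (runit s) x) = x;
  runit_central : forall (A B : finset) n (s : A -> Delta n 1) (x : rlev B n),
    bact rlev (fswap_bij A B) n (rmul A B n (runit s) x) =
    rmul B A n x (runit s);
  rfibrant : fibrant (fun B n s x => rmul funit B n (runit (fun=> s)) x) }.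

Record module (R : E1ring) := Module {
  mlev :> symseq;
  mact : pairing R mlev mlev;
  mactA : forall (A B C : finset) n (x : R A n) (y : R B n) (z : mlev C n),
    bact mlev (fassoc_bij A B C) n
      (mact (fsum A B) C n (rmul R A B n x y) z) =
    mact A (fsum B C) n x (mact B C n y z);
  mact1 : forall (A : finset) n (s : fvoid -> Delta n 1) (x : mlev A n),
    bact mlev (flunit_bij A) n (mact fvoid A n (runit R s) x) = x;
  mfibrant : fibrant (fun B n s x => mact funit B n (runit R (fun=> s)) x) }.

Definition regular (R : E1ring) : module R :=
  Module (@rmulA R) (@rmul1 R) (@rfibrant R).

Record mmap (R : E1ring) (M N : module R) := MMap {
  mfun :> forall A, smap (M A) (N A);
  mfun_pt : forall A n, mfun A n (pt (M A) n) = pt (N A) n;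
  mfun_bact : forall (A B : finset) (f : A -> B) (ef : bijective f) n (x : M A n),
    mfun B n (bact M ef n x) = bact N ef n (mfun A n x);
  mfun_act : forall (A B : finset) n (r : R A n) (x : M B n),
    mfun (fsum A B) n (mact M A B n r x) = mact N A B n r (mfun B n x) }.

Section ModuleMaps.
Variable R : E1ring.
Implicit Types M N P : module R.

Definition mmap_id M : mmap M M :=
  @MMap R M M (fun A => smap_id (M A)) (fun _ _ => erefl)
    (fun _ _ _ _ _ _ => erefl) (fun _ _ _ _ _ => erefl).

Definition mmap_comp M N P (g : mmap N P) (f : mmap M N) : mmap M P.
Proof.
refine (@MMap R M P (fun A => smap_comp (g A) (f A)) _ _ _).
- by move=> A n /=; rewrite !mfun_pt.
- by move=> A B h eh n x /=; rewrite !mfun_bact.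
- by move=> A B n r x /=; rewrite !mfun_act.
Defined.

Definition level_equiv M N (f : mmap M N) := forall A, weak_equiv (f A).

(* F is the levelwise fibre of a levelwise Kan fibration p. *)
Definition strict_fibre_seq F M N (i : mmap F M) (p : mmap M N) : Prop :=
  [/\ forall A, kan_fibration (p A),
      forall A n, injective (i A n) &
      forall A n (x : M A n), p A n x = pt (N A) n <-> exists y, i A n y = x].

Definition contractible M :=
  forall A, homotopic (smap_id (M A)) (smap_pt (M A) (M A)).

Record path_fibration N := PathFibration {
  pfF : module R;
  pfP : module R;
  pfi : mmap pfF pfP;
  pfp : mmap pfP N;
  pf_strict : strict_fibre_seq pfi pfp;
  pf_contr : contractible pfP }.

End ModuleMaps.

Record category := Category {
  cob : Type;
  chom : cob -> cob -> Type;
  cid : forall X, chom X X;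
  ccomp : forall X Y Z, chom Y Z -> chom X Y -> chom X Z;
  ccompA : forall X Y Z W (h : chom Z W) (g : chom Y Z) (f : chom X Y),
    ccomp h (ccomp g f) = ccomp (ccomp h g) f;
  ccomp1l : forall X Y (f : chom X Y), ccomp (cid Y) f = f;
  ccomp1r : forall X Y (f : chom X Y), ccomp f (cid X) = f }.

Definition cinvertible (C : category) (X Y : cob C) (f : chom X Y) :=
  exists g : chom Y X, ccomp g f = cid X /\ ccomp f g = cid Y.

Record mfunctor (R : E1ring) (C : category) := MFunctor {
  fob : module R -> cob C;
  fmor : forall M N, mmap M N -> chom (fob M) (fob N);
  fmor_id : forall M, fmor (mmap_id M) = cid (fob M);
  fmor_comp : forall M N P (g : mmap N P) (f : mmap M N),
    fmor (mmap_comp g f) = ccomp (fmor g) (fmor f) }.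

(* The localisation of the category of R-modules at the level equivalences,
   characterised by its universal property (it has the same objects), together
   with its additive structure: as finite products exist there, the latter is
   uniquely determined. *)
Record hocat (R : E1ring) := HoCat {
  hhom : module R -> module R -> zmodType;
  hid : forall M, hhom M M;
  hcomp : forall M N P, hhom N P -> hhom M N -> hhom M P;
  hcompA : forall M N P Q (h : hhom P Q) (g : hhom N P) (f : hhom M N),
    hcomp h (hcomp g f) = hcomp (hcomp h g) f;
  hcomp1l : forall M N (f : hhom M N), hcomp (hid N) f = f;
  hcomp1r : forall M N (f : hhom M N), hcomp f (hid M) = f;
  hcompDl : forall M N P (g g' : hhom N P) (f : hhom M N),
    hcomp (g + g') f = hcomp g f + hcomp g' f;
  hcompDr : forall M N P (g : hhom N P) (f f' : hhom M N),
    hcomp g (f + f') = hcomp g f + hcomp g f';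
  hloc : forall M N, mmap M N -> hhom M N;
  hloc_id : forall M, hloc (mmap_id M) = hid M;
  hloc_comp : forall M N P (g : mmap N P) (f : mmap M N),
    hloc (mmap_comp g f) = hcomp (hloc g) (hloc f);
  hloc_equiv : forall M N (f : mmap M N), level_equiv f ->
    exists g : hhom N M, hcomp g (hloc f) = hid M /\ hcomp (hloc f) g = hid N;
  hloc_univ : forall (C : category) (G : mfunctor R C),
    (forall M N (f : mmap M N), level_equiv f -> cinvertible (fmor G f)) ->
    exists! Phi : forall M N, hhom M N -> chom (fob G M) (fob G N),
      [/\ forall M, Phi M M (hid M) = cid (fob G M),
          forall M N P (g : hhom N P) (f : hhom M N),
            Phi M P (hcomp g f) = ccomp (Phi N P g) (Phi M N f) &
          forall M N (f : mmap M N), Phi M N (hloc f) = fmor G f] }.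

Section HomotopyCategory.
Variables (R : E1ring) (H : hocat R).
Implicit Types M N P X Y Z : module R.

Definition invertible M N (f : hhom H M N) :=
  exists g : hhom H N M, hcomp g f = hid H M /\ hcomp f g = hid H N.

Definition isomorphic M N := exists f : hhom H M N, invertible f.

Definition retract_of X Y :=
  exists (i : hhom H X Y) (r : hhom H Y X), hcomp r i = hid H X.

Definition fibre_seq X Y Z (i : hhom H X Y) (p : hhom H Y Z) : Prop :=
  exists (F E B : module R) (i0 : mmap F E) (p0 : mmap E B)
    (a : hhom H X F) (b : hhom H Y E) (c : hhom H Z B),
    [/\ strict_fibre_seq i0 p0,
        [/\ invertible a, invertible b & invertible c],
        hcomp b i = hcomp (hloc H i0) a &
        hcomp c p = hcomp (hloc H p0) b].

(* The loop functor (desuspension): its value at N is the fibre of any path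
   fibration over N, naturally.  This determines it up to unique natural
   isomorphism. *)
Record loop_functor := LoopFunctor {
  lob : module R -> module R;
  lmor : forall M N, hhom H M N -> hhom H (lob M) (lob N);
  lmor_id : forall M, lmor (hid H M) = hid H (lob M);
  lmor_comp : forall M N P (g : hhom H N P) (f : hhom H M N),
    lmor (hcomp g f) = hcomp (lmor g) (lmor f);
  lfib : forall N (s : path_fibration N), hhom H (pfF s) (lob N);
  lfib_inv : forall N (s : path_fibration N), invertible (lfib s);
  lfib_nat : forall N N' (s : path_fibration N) (s' : path_fibration N')
    (g : mmap N N') (gP : mmap (pfP s) (pfP s')) (gF : mmap (pfF s) (pfF s')),
    (forall A n x, g A n (pfp s A n x) = pfp s' A n (gP A n x)) ->
    (forall A n x, gP A n (pfi s A n x) = pfi s' A n (gF A n x)) ->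
    hcomp (lmor (hloc H g)) (lfib s) = hcomp (lfib s') (hloc H gF) }.

Variable W : loop_functor.

Definition lobn k M : module R := iter k (lob W) M.

Fixpoint lmorn k M N (f : hhom H M N) : hhom H (lobn k M) (lobn k N) :=
  match k with 0 => f | j.+1 => lmor W (lmorn j f) end.

Lemma lmorn_id k M : lmorn k (hid H M) = hid H (lobn k M).
Proof. by elim: k => //= k ->; rewrite lmor_id. Qed.

Lemma lmorn_comp k M N P (g : hhom H N P) (f : hhom H M N) :
  lmorn k (hcomp g f) = hcomp (lmorn k g) (lmorn k f).
Proof. by elim: k => //= k ->; rewrite lmor_comp. Qed.

(* pi_n map(A, M); since the loop functor is an equivalence, this is
   [A, Loops^n M] for n >= 0 and [Loops^(-n) A, M] for n < 0.  Recall that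
   Negz k = - (k + 1). *)
Definition pi_map (n : int) A M : zmodType :=
  match n with
  | Posz k => hhom H A (lobn k M)
  | Negz k => hhom H (lobn k.+1 A) M
  end.

Definition pi_map_pre (n : int) A B M (f : hhom H A B) :
  pi_map n B M -> pi_map n A M :=
  match n with
  | Posz k => fun x => hcomp x f
  | Negz k => fun x => hcomp x (lmorn k.+1 f)
  end.

Definition pi_map_post (n : int) A M N (f : hhom H M N) :
  pi_map n A M -> pi_map n A N :=
  match n with
  | Posz k => fun x => hcomp (lmorn k f) x
  | Negz k => fun x => hcomp f x
  end.

(* pi_n M = pi_n map(R, M). *)
Definition hgroup (n : int) M : zmodType := pi_map n (regular R) M.

Definition connective M := forall k : nat, forall x : hgroup (Negz k) M, x = 0.

(* Under pi_0 map(R, M) = pi_0 M a map R -> M is right multiplication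
   r |-> r y by an element y, so x followed by y represents the product x y;
   here x and y have degree one, and the second factor is looped. *)
Definition pi1_mul M (x : hgroup (Posz 1) (regular R))
  (y : hgroup (Posz 1) M) : hgroup (Posz 2) M :=
  hcomp (lmor W (y : hhom H (regular R) (lob W M)))
        (x : hhom H (regular R) (lob W (regular R))).

(* The image of the map from the tensor product: every tensor is a finite sum
   of pure tensors. *)
Definition in_mul_im M : {pred hgroup (Posz 2) M} := fun z =>
  `[< exists s : seq (hgroup (Posz 1) (regular R) * hgroup (Posz 1) M),
        z = \sum_(t <- s) pi1_mul t.1 t.2 >].

Inductive perfect_even : module R -> Prop :=
| pe_desusp k X : isomorphic X (lobn k.*2 (regular R)) -> perfect_even X
| pe_susp k X : isomorphic (lobn k.*2 X) (regular R) -> perfect_even X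
| pe_ext X Y Z (i : hhom H X Y) (p : hhom H Y Z) :
    fibre_seq i p -> perfect_even X -> perfect_even Z -> perfect_even Y
| pe_retract X Y : retract_of X Y -> perfect_even Y -> perfect_even X.

Record perf := Perf { pob :> module R; perfP : perfect_even pob }.

Definition even_epi (B A : perf) (p : hhom H B A) : Prop :=
  exists (F : perf) (i : hhom H F B), fibre_seq i p.

(* Sheaves of groups on the oo-category of perfect even modules are sheaves on
   its homotopy category, covering sieves being the same.  The fibre product
   B x_A B in Mod_R is only a weak pullback there, so descent along p : B -> A
   is stated with all pairs of maps g, h : C -> B such that p g = p h. *)
Record presheaf := Presheaf {
  psec :> perf -> zmodType;
  pres : forall A B : perf, hhom H A B -> {additive psec B -> psec A};
  pres_id : forall (A : perf) (x : psec A), pres (hid H A : hhom H A A) x = x;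
  pres_comp : forall (A B C : perf) (g : hhom H B C) (f : hhom H A B) x,
    pres (hcomp g f) x = pres f (pres g x) }.

Record pshmap (F G : presheaf) := PshMap {
  pfun :> forall A, {additive F A -> G A};
  pfun_nat : forall (A B : perf) (f : hhom H A B) x,
    pfun A (pres F f x) = pres G f (pfun B x) }.

Definition is_sheaf (F : presheaf) : Prop :=
  forall (B A : perf) (p : hhom H B A), even_epi p ->
  forall b : F B,
    (forall (C : perf) (g h : hhom H C B),
       hcomp p g = hcomp p h -> pres F g b = pres F h b) ->
    exists! a : F A, pres F p a = b.

Definition is_additive (F : presheaf) : Prop :=
  forall (A B : perf) (f g : hhom H A B) x,
    pres F (f + g) x = pres F f x + pres F g x.

Definition additive_sheaf F := is_sheaf F /\ is_additive F.

Definition is_sheafification (F G : presheaf) (eta : pshmap F G) : Prop :=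
  is_sheaf G /\
  forall (S : presheaf) (u : pshmap F S), is_sheaf S ->
    (exists v : pshmap G S, forall A x, v A (eta A x) = u A x) /\
    (forall v v' : pshmap G S, (forall A x, v A (eta A x) = v' A (eta A x)) ->
       forall A y, v A y = v' A y).

Definition injective_sheaf (I : presheaf) : Prop :=
  additive_sheaf I /\
  forall (S T : presheaf) (j : pshmap S T) (u : pshmap S I),
    additive_sheaf S -> additive_sheaf T -> (forall A, injective (j A)) ->
    exists v : pshmap T I, forall A x, v A (j A x) = u A x.

(* Exactness of F -> G -> K at G as sheaves. *)
Definition exact_at (F G K : presheaf) (u : pshmap F G) (v : pshmap G K) : Prop :=
  (forall A x, v A (u A x) = 0) /\
  forall A (y : G A), v A y = 0 ->
    exists (B : perf) (p : hhom H B A),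
      even_epi p /\ exists x : F B, u B x = pres G p y.

Fact pi_map_pre_additive n (A B : perf) M (f : hhom H A B) :
  zmod_morphism (@pi_map_pre n A B M f).
Proof.
case: n => n x y /=.
- apply/eqP; rewrite eq_sym subr_eq -hcompDl.
  by rewrite addrNK.
- apply/eqP; rewrite eq_sym subr_eq -hcompDl.
  by rewrite addrNK.
Qed.

HB.instance Definition _ n (A B : perf) M (f : hhom H A B) :=
  GRing.isZmodMorphism.Build _ _ (@pi_map_pre n A B M f)
    (pi_map_pre_additive f).

Definition pi_presheaf (n : int) M : presheaf.
Proof.
refine (@Presheaf (fun A => pi_map n A M)
  (fun A B f => @pi_map_pre n A B M f) _ _).
- by case: n => n A x; rewrite /= ?(lmorn_id n.+1) ?lmor_id ?lmorn_id ?lmor_id hcomp1r.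
- by case: n => n A B C g f x; rewrite /= ?lmorn_comp ?lmor_comp hcompA.
Defined.

(* F_M(n / 2); n = 2 q is the integer degree of homotopy groups. *)
Record even_sheaf (n : int) M := EvenSheaf {
  esheaf :> presheaf;
  eunit : pshmap (pi_presheaf n M) esheaf;
  eunitP : is_sheafification eunit }.

Definition homologically_even M : Prop :=
  forall (k : int) (F : even_sheaf (k * 2 + 1) M) A (x : F A), x = 0.

Record injective_resolution (F : presheaf) := InjectiveResolution {
  iterm :> nat -> presheaf;
  iaug : pshmap F (iterm 0);
  idiff : forall p, pshmap (iterm p) (iterm p.+1);
  iterm_inj : forall p, injective_sheaf (iterm p);
  iaug_inj : forall A, injective (iaug A);
  iaug_exact : exact_at iaug (idiff 0);
  idiff_exact : forall p, exact_at (idiff p) (idiff p.+1) }.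

Definition Rperf : perf.
Proof.
exists (regular R); apply: (@pe_desusp 0); exists (hid H (regular R)).
by exists (hid H (regular R)); rewrite /= hcomp1l.
Defined.

(* Right derived functors of sections over R: cohomology of the complex of
   sections over R of an injective resolution. *)
Section Cohomology.
Variables (F : presheaf) (I : injective_resolution F) (p : nat).

Definition cocycle : {pred I p Rperf} := fun x => idiff I p Rperf x == 0.

Fact cocycle_closed : zmod_closed cocycle.
Proof.
split=> [|x y]; rewrite /cocycle !unfold_in ?raddf0 //.
by move=> /eqP x0 /eqP y0; rewrite raddfB x0 y0 subrr.
Qed.

HB.instance Definition _ := GRing.isZmodClosed.Build _ cocycle cocycle_closed.

Definition coboundary_of q : I q Rperf -> Prop :=
  match q with
  | 0 => fun x => x = 0
  | r.+1 => fun x => exists y, idiff I r Rperf y = x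
  end.

Fact coboundary_of0 q : @coboundary_of q 0.
Proof. by case: q => //= q; exists 0; rewrite raddf0. Qed.

Fact coboundary_ofB q (x y : I q Rperf) :
  coboundary_of x -> coboundary_of y -> coboundary_of (x - y).
Proof.
case: q x y => [|q] /= x y; first by move=> -> ->; rewrite subrr.
by move=> [u <-] [v <-]; exists (u - v); rewrite raddfB.
Qed.

Definition coboundary : {pred subgroup cocycle} :=
  fun x => `[< coboundary_of (val x) >].

Fact coboundary_closed : zmod_closed coboundary.
Proof.
split=> [|x y]; rewrite !unfold_in /coboundary.
  by apply/asboolP; rewrite raddf0; apply: coboundary_of0.
move=> /asboolP hx /asboolP hy; apply/asboolP.
by rewrite raddfB; apply: coboundary_ofB.
Qed.

HB.instance Definition _ :=
  GRing.isZmodClosed.Build _ coboundary coboundary_closed.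

Definition cohomology : zmodType := Quotient.quot coboundary.

Definition represents (x : I p Rperf) (c : cohomology) : Prop :=
  exists z : subgroup cocycle, val z = x /\ \pi_cohomology z = c.

End Cohomology.

(* H^{p, n / 2}_ev(R, M), computed by I. *)
Definition even_cohomology (p : nat) (n : int) M (F : even_sheaf n M)
  (I : injective_resolution F) : zmodType := cohomology I p.

Fact in_mul_im_closed M : zmod_closed (@in_mul_im M).
Proof.
have oppE (x : hgroup (Posz 1) (regular R)) (y : hgroup (Posz 1) M) :
    pi1_mul (- x) y = - pi1_mul x y.
  apply/eqP; rewrite -addr_eq0 /pi1_mul -hcompDr addNr.
  apply/eqP; apply: (addIr (pi1_mul 0 y)).
  by rewrite /pi1_mul -hcompDr !add0r.
split=> [|x y]; rewrite !unfold_in /in_mul_im.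
  by apply/asboolP; exists [::]; rewrite big_nil.
move=> /asboolP[s ->] /asboolP[t ->]; apply/asboolP.
exists (s ++ [seq (- u.1, u.2) | u <- t]).
rewrite big_cat big_map /= -sumrN; congr (_ + _).
by apply: eq_bigr => u _; rewrite oppE.
Qed.

HB.instance Definition _ M :=
  GRing.isZmodClosed.Build _ (@in_mul_im M) (@in_mul_im_closed M).

Definition mul_im M : zmodType := subgroup (@in_mul_im M).

Definition mul_coker M : zmodType := Quotient.quot (@in_mul_im M).

Record connective_heven := ConnectiveHEven {
  cmod :> module R;
  cmodP : connective cmod;
  cmod_heven : homologically_even cmod }.

(* Lifts to injective resolutions of the map of even sheaves induced by f. *)
Record resolution_map n M N (f : hhom H M N) (F : even_sheaf n M)
    (G : even_sheaf n N) (I : injective_resolution F)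
    (J : injective_resolution G) := ResolutionMap {
  rmap :> forall p, pshmap (I p) (J p);
  rmap_diff : forall p A x,
    rmap p.+1 A (idiff I p A x) = idiff J p A (rmap p A x);
  rmap_aug : forall (A : perf) (x : pi_map n A M),
    rmap 0 A (iaug I A (eunit F A x)) =
    iaug J A (eunit G A (pi_map_post f x)) }.

End HomotopyCategory.

(* Main.v *)
Require Import Defs.
From HB Require Import structures.
From mathcomp Require Import all_boot all_algebra.
From mathcomp Require Import boolp zify.
From mathcomp Require classical_sets.

Set Implicit Arguments.
Unset Strict Implicit.
Unset Printing Implicit Defensive.

(* Maps in the homotopy category are fractions of strict maps, two strict maps
   being identified when they become homotopic, and homotopy fibres of strict
   maps provide its triangles.

   Call j-cell a module built by extensions from the Loops^(2i) R with i >= j.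
   As R is connective, every perfect even module is a retract of a module G with
   a map from a j-cell along which maps out of Loops^m R lift uniquely for m >= 2j;
   hence every even epimorphism onto a j-cell is refined by one whose fibre is a
   (j+1)-cell.  As M is connective, there are no maps from such a fibre to
   Loops^n M for n < 2j + 2, and it follows that the unit from maps A -> Loops^n M
   to sections of the even sheaf over a j-cell A is injective for n <= 2j and
   surjective for n <= 2j + 2.  On the 0-cell R this computes H^0.

   By homological evenness a map y from A to an odd loop object Loops^(n-1) M is
   killed by an even epimorphism B -> A; if K is its fibre, the loops of y factor
   as Loops A -> K -> Loops^n M, and the image of the second map under the
   connecting map H^0(K) -> H^1(A) is the class of y.  Doing this twice takes
   locally zero maps A -> Loops^(n-2) M to H^2(A).  The same bounds on cells show
   that both maps are bijective on R for n = 2 and n = 4.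

   Finally, the locally zero elements of pi_2 M are the sums of products of
   elements of degree one: a map from a 1-cell to Loops^3 M is a sum of maps that
   factor through Loops^2 R, and conversely any map from R to Loops R is locally
   zero, its fibre being an extension of R by Loops^2 R. *)

(** * Extending partial maps of simplicial sets *)

(** The homotopy category is given only by a universal property and weak equivalences only as
    simplicial homotopy equivalences, so a calculus has to be extracted from each. For the first,
    the universal property is applied to a functor of classes of spans, which detects equality of
    localised maps, and to the subcategory of fractions, which the uniqueness clause shows to be
    everything. For the second, horns are traded for pushout-products with an interval, against
    which homotopy pullbacks are easily tested. Levelwise fillers are not linear, so homotopies of
    module maps are handled through homotopy pullbacks of modules alone.

    That the loop functor is an equivalence comes from the shift of a module, whose loops are the
    module again; no suspension functor is constructed.

    The bounds on n have one source: a map from Loops^a R to Loops^b M vanishes for b < a, and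
    passing to the fibre of a refined cover raises cells by two degrees. On the 0-cell R the value n
    = 2 for the first connecting map and n = 4 for the second are the largest that the bounds for
    injectivity allow. *)

Lemma val_vert n (i j : vert n) : sval i = sval j -> i = j.
Proof. by case: i j => [i hi] [j hj] /= e; apply: eq_exist. Qed.

Lemma vert_le n (i : vert n) : (sval i <= n)%N.
Proof. by case: i. Qed.

Definition mkv n i (h : (i <= n)%N) : vert n := exist _ i h.

Definition misses m n (a : Delta m n) (i : vert n) : Prop := forall j, a j <> i.

Definition bdry m n (a : Delta m n) : Prop := exists i, misses a i.

Definition ontoD m n (a : Delta m n) : Prop := forall i, exists j, a j = i.

Lemma bdryVonto m n (a : Delta m n) : bdry a \/ ontoD a.
Proof.
have [h|h] := pselect (bdry a); [by left | right=> i].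
by apply: contrapT => hi; apply: h; exists i => j ji; apply: hi; exists j.
Qed.

Lemma bdry_comp m n p (a : Delta n p) (b : Delta m n) :
  bdry a -> bdry (Delta_comp a b).
Proof. by case=> i hi; exists i => j; apply: hi. Qed.

Lemma onto_step m n (a : Delta m n) (i j : vert m) :
  ontoD a -> sval j = (sval i).+1 -> (sval (a j) <= (sval (a i)).+1)%N.
Proof.
move=> h ji; rewrite leqNgt; apply/negP => lt.
have hn : ((sval (a i)).+1 <= n)%N by have := vert_le (a j); lia.
have [k ak] := h (mkv hn).
have {}ak : sval (a k) = (sval (a i)).+1 by rewrite ak.
have [ki|ki] := leqP (sval k) (sval i).
  by have := dfun_mono a ki; lia.
have jk : (sval j <= sval k)%N by lia.
by have := dfun_mono a jk; lia.
Qed.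

(** A monotone surjection starts at 0, ends at n and advances by at most one at each step: counting
    from the bottom bounds it above by the identity, counting from the top bounds it below. *)
Lemma onto_id n (a : Delta n n) : ontoD a -> a = Delta_id n.
Proof.
move=> h; apply: Delta_ext => i; apply: val_vert => /=.
have up k (hk : (k <= n)%N) : (sval (a (mkv hk)) <= k)%N.
  elim: k hk => [|k IH] hk.
    have [j aj] := h (mkv (leq0n n)).
    have le0 : (sval (mkv hk) <= sval j)%N by [].
    by have := dfun_mono a le0; rewrite aj.
  have hk' : (k <= n)%N by lia.
  have := @onto_step _ _ a (mkv hk') (mkv hk) h erefl.
  by have := IH hk'; lia.
have dn k (hk : (n - k <= n)%N) : (k <= n)%N ->
    (n - k <= sval (a (mkv hk)))%N.
  elim: k hk => [|k IH] hk kn.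
    have [j aj] := h (mkv (leqnn n)).
    have le0 : (sval j <= sval (mkv hk))%N.
      by have := vert_le j => /=; lia.
    by have := dfun_mono a le0; rewrite aj /=; lia.
  have hk' : (n - k <= n)%N by lia.
  have := @onto_step _ _ a (mkv hk) (mkv hk') h.
  have /= := IH hk' (ltnW kn).
  by move=> le1 /(_ ltac:(lia)); lia.
case: i => i hi /=; rewrite -/(mkv hi); apply/eqP; rewrite eqn_leq up /=.
have hk : (n - (n - i) <= n)%N by lia.
have e : mkv hk = mkv hi by apply: val_vert => /=; lia.
have := dn (n - i)%N hk ltac:(lia); rewrite e; apply: leq_trans.
by lia.
Qed.

Lemma choice_dep (I : Type) (T : I -> Type) (Q : forall i, T i -> Prop) :
  (forall i, exists t, Q i t) -> exists f : forall i, T i, forall i, Q i (f i).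
Proof. by move=> h; exists (fun i => sval (cid (h i))) => i; case: cid. Qed.

Fact face_mono n (i : vert n.+1) (j k : vert n) : (sval j <= sval k)%N ->
  (bump (sval i) (sval j) <= bump (sval i) (sval k))%N.
Proof. by rewrite /bump; lia. Qed.

Fact face_le n (i : vert n.+1) (j : vert n) : (bump (sval i) (sval j) <= n.+1)%N.
Proof. by have := vert_le j; rewrite /bump; lia. Qed.

Definition face n (i : vert n.+1) : Delta n n.+1 :=
  @DeltaMap n n.+1 (fun j => mkv (face_le i j)) (@face_mono n i).

(** The missed vertex i gives a factorisation through the i-th face: [bump] includes it and [unbump]
    inverts this away from i. The drop in dimension drives the induction in [extend_section]. *)
Lemma bdry_face m n (a : Delta m n) : bdry a ->
  exists p (d : Delta p n) (b : Delta m p), (p < n)%N /\ a = Delta_comp d b.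
Proof.
case: n a => [|n] a [i hi].
  case: (hi (mkv (leq0n m))); apply: val_vert.
  by have := vert_le i; have := vert_le (a (mkv (leq0n m))); lia.
have hle (j : vert m) : (unbump (sval i) (sval (a j)) <= n)%N.
  have := vert_le (a j); have := vert_le i; rewrite /unbump.
  have : sval (a j) <> sval i by move=> e; apply: (hi j); apply: val_vert.
  by lia.
have hmono (j k : vert m) : (sval j <= sval k)%N ->
    (unbump (sval i) (sval (a j)) <= unbump (sval i) (sval (a k)))%N.
  by move/(dfun_mono a); rewrite /unbump; lia.
exists n, (face i), (@DeltaMap m n (fun j => mkv (hle j)) hmono).
split=> //; apply: Delta_ext => j; apply: val_vert => /=.
have : sval (a j) <> sval i by move=> e; apply: (hi j); apply: val_vert.
by rewrite /bump /unbump; lia.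
Qed.

(** Every choice of preimages under a monotone surjection is monotone, so one value can be
    prescribed freely. As in the Eilenberg-Zilber lemma, a surjection is determined by its
    sections. *)
Lemma onto_section m n (a : Delta m n) (i : vert m) : ontoD a ->
  exists s : Delta n m, Delta_comp a s = Delta_id n /\ s (a i) = i.
Proof.
move=> h; have [f fP] := choice h.
pose g j := if pselect (j = a i) then i else f j.
have gP j : a (g j) = j by rewrite /g; case: pselect => [e|ne] /=; rewrite ?e ?fP.
have gm j k : (sval j <= sval k)%N -> (sval (g j) <= sval (g k))%N.
  move=> jk; rewrite leqNgt; apply/negP => lt.
  have := dfun_mono a (ltnW lt); rewrite !gP => kj.
  have ejk : j = k by apply: val_vert; lia.
  by rewrite ejk ltnn in lt.
exists (DeltaMap gm); split; first exact: Delta_ext.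
by rewrite /= /g; case: pselect.
Qed.

Definition closed (L : sSet) (K : forall n, L n -> Prop) :=
  forall m n (a : Delta m n) (x : L n), K n x -> K m (sact a x).

Definition nat_on (L X : sSet) (K : forall n, L n -> Prop)
    (u : forall n, L n -> X n) :=
  forall m n (a : Delta m n) (x : L n), K n x -> u m (sact a x) = sact a (u n x).

(* The role of [Phi] is to encode lifting problems: it cuts out the simplices of
   P lying over the prescribed ones. *)
Section Extension.
Variables (L P : sSet) (inh : forall n, P n) (Phi : forall n, L n -> P n -> Prop).
Hypothesis Phi_nat : forall m n (a : Delta m n) (x : L n) z,
  Phi x z -> Phi (sact a x) (sact a z).
Hypothesis fill : forall n (x : L n) (u : forall m, Delta m n -> P m),
  @nat_on (simplex n) P (fun m a => bdry a) u ->
  (forall m (a : Delta m n), bdry a -> Phi (sact a x) (u m a)) ->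
  exists z, Phi x z /\ forall m (a : Delta m n), bdry a -> sact a z = u m a.
Variables (K : forall n, L n -> Prop) (u : forall n, L n -> P n).
Hypotheses (K_closed : closed K) (u_nat : nat_on K u).
Hypothesis u_Phi : forall n (x : L n), K x -> Phi x (u x).

Let T := {n : nat & (L n * P n)%type}.
Let gr (G : T -> Prop) n (x : L n) (z : P n) := G (existT _ n (x, z)).

(** Agreement with [u] is demanded only where the graph is defined, so that the empty graph
    qualifies for Zorn's lemma; maximality then brings K into the domain. *)
Let good (G : T -> Prop) : Prop :=
  [/\ forall n (x : L n) z z', gr G x z -> gr G x z' -> z = z',
      forall m n (a : Delta m n) (x : L n) z, gr G x z -> gr G (sact a x) (sact a z),
      forall n (x : L n) z, gr G x z -> Phi x z &
      forall n (x : L n) z, gr G x z -> K x -> z = u x].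

Let good_max : exists G, good G /\
  forall G' : T -> Prop, (forall t, G t -> G' t) -> good G' -> forall t, G' t -> G t.
Proof.
have [F Fgood Ftot|G [gG maxG]] := @classical_sets.Zorn_bigcup T good.
  split.
  - move=> n x z z' [G FG Gz] [G' FG' Gz'].
    have [GG|GG] := Ftot _ _ FG FG'.
      by have [fu _ _ _] := Fgood _ FG'; apply: (fu _ x) => //; apply: GG.
    by have [fu _ _ _] := Fgood _ FG; apply: (fu _ x) => //; apply: GG.
  - move=> m n a x z [G FG Gz]; exists G => //.
    by have [_ cl _ _] := Fgood _ FG; apply: cl.
  - by move=> n x z [G FG Gz]; have [_ _ h _] := Fgood _ FG; apply: h.
  - by move=> n x z [G FG Gz]; have [_ _ _ h] := Fgood _ FG; apply: h.
exists G; split=> // G' GG' gG' t G't; apply: contrapT => nGt.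
apply: (maxG G') => //; split=> [|s]; first exact: GG'.
by apply: nGt; apply: s.
Qed.

Lemma extend_section : exists w : smap L P,
  (forall n (x : L n), Phi x (w n x)) /\ (forall n (x : L n), K x -> w n x = u x).
Proof.
have [G [gG maxG]] := good_max; have [fu cl ph ku] := gG.
have domK n (x : L n) : K x -> gr G x (u x).
  move=> Kx; pose G' (t : T) := G t \/ K (projT2 t).1 /\ (projT2 t).2 = u (projT2 t).1.
  apply: (maxG G'); [by left| |by right].
  split.
  - move=> p y z z' [Gz|/= [Ky ->]] [Gz'|/= [Ky' ->]] //.
    + exact: fu Gz Gz'.
    + by rewrite (ku _ _ _ Gz).
    + by rewrite (ku _ _ _ Gz').
  - move=> m p a y z [Gz|/= [Ky ->]]; [by left; apply: cl|right=> /=].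
    by split; [apply: K_closed | rewrite u_nat].
  - by move=> p y z [Gz|/= [Ky ->]]; [apply: ph Gz|apply: u_Phi].
  - by move=> p y z [Gz|/= [Ky ->]] //; apply: ku.
(* A simplex x outside the domain with all its proper faces inside could be adjoined together with a
   filler z, by sending every sact a x to sact a z; this contradicts maximality. *)
have dom n : forall x : L n, exists z, gr G x z.
  elim/ltn_ind: n => n IH x; apply: contrapT => nx; have nx0 := nx.
  have dom_bdry m (a : Delta m n) : bdry a -> exists z, gr G (sact a x) z.
    case/bdry_face => p [d [b [pn ->]]].
    have [z Gz] := IH _ pn (sact d x).
    by exists (sact b z); rewrite -sact_comp; apply: cl.
  have [v vP] : exists v : forall m, Delta m n -> P m,
      forall m (a : Delta m n), bdry a -> gr G (sact a x) (v m a).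
    have h m : exists v : Delta m n -> P m, forall a, bdry a -> gr G (sact a x) (v a).
      refine (@choice_dep _ (fun=> P m) (fun (a : Delta m n) z => bdry a -> gr G (sact a x) z) _) => a.
      have [ba|nba] := pselect (bdry a).
        by have [z Gz] := dom_bdry _ a ba; exists z.
      by exists (inh m).
    by have [v vP] := choice_dep h; exists v.
  have v_nat : @nat_on (simplex n) P (fun m a => bdry a) v.
    move=> m p a b bb /=; apply: fu (vP _ _ _) _; first exact: bdry_comp.
    by rewrite -sact_comp; apply: cl; apply: vP.
  have [z [zP zv]] := fill v_nat (fun m a ba => ph _ _ _ (vP m a ba)).
  have in_dom m (a : Delta m n) : bdry a -> gr G (sact a x) (sact a z).
    by move=> ba; rewrite zv //; apply: vP.
  have id_of_not_dom (c : Delta n n) : sact c x = x -> c = Delta_id n.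
    move=> cx; case: (bdryVonto c) => [bc|]; last exact: onto_id.
    by have := in_dom _ _ bc; rewrite cx => Gx; case: nx; eexists; apply: Gx.
  (* Being outside the domain while its faces are inside, x is non-degenerate; hence a surjective
     operator is determined by its effect on x, and the values sact a z are well defined. *)
  have inj m (a b : Delta m n) : sact a x = sact b x -> ~ bdry a -> a = b.
    move=> ab nba; have [//|oa] := bdryVonto a.
    have sec (s : Delta n m) : Delta_comp a s = Delta_id n ->
        Delta_comp b s = Delta_id n.
      by move=> as1; apply: id_of_not_dom; rewrite -sact_comp -ab sact_comp as1 sact_id.
    apply: Delta_ext => i; have [s [as1 si]] := onto_section i oa.
    have := congr1 (fun c : Delta n n => c (a i)) (sec _ as1).
    by rewrite /= si.
  pose G' (t : T) := G t \/
    exists a : Delta (projT1 t) n, (projT2 t).1 = sact a x /\ (projT2 t).2 = sact a z.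
  case: nx; exists z; apply: (maxG G'); [by left| |]; last first.
    by right; exists (Delta_id n); rewrite /= !sact_id.
  have old m (a : Delta m n) z' : gr G (sact a x) z' -> z' = sact a z.
    move=> Gz'; have [ba|oa] := bdryVonto a; first exact: fu Gz' (in_dom _ _ ba).
    have [s [as1 _]] := onto_section (mkv (leq0n m)) oa.
    have := cl _ _ s _ _ Gz'; rewrite sact_comp as1 sact_id => Gx.
    by case: nx0; eexists; apply: Gx.
  split.
  - move=> m y y1 y2 [G1|/= [a [-> ->]]] [G2|/= [b [eb ->]]].
    + exact: fu G1 G2.
    + by apply: old; rewrite -eb.
    + by symmetry; apply: old.
    + have [ba|nba] := pselect (bdry a).
        by apply: old; rewrite -eb; apply: in_dom.
      by rewrite (inj _ _ _ eb nba).
  - move=> m p c y y1 [G1|/= [a [-> ->]]]; first by left; apply: cl.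
    by right; exists (Delta_comp a c); rewrite !sact_comp.
  - by move=> m y y1 [/ph //|/= [a [-> ->]]]; apply: Phi_nat.
  - move=> m y y1 [/ku //|/= [a [ey ->]]] Ky.
    by symmetry; apply: old; rewrite -ey; apply: domK.
have [w wP] : exists w : forall n, L n -> P n, forall n x, gr G x (w n x).
  by exists (fun n x => sval (cid (dom n x))) => n x; case: cid.
have wn m n (a : Delta m n) (x : L n) : w m (sact a x) = sact a (w n x).
  exact: fu (wP _ _) (cl _ _ _ _ _ (wP _ _)).
exists (SMap wn); split=> n x; first exact: ph (wP n x).
exact: ku (wP n x).
Qed.

End Extension.

(** * Kan fibrations and homotopy lifting *)

Lemma vert1P (e : vert 1) : e = vert0 \/ e = vert1.
Proof.
by case: e => [[|[|i]] hi] //; [left|right]; apply: val_vert.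
Qed.

Lemma Delta_const_comp m n p (i : vert p) (a : Delta m n) :
  Delta_comp (Delta_const n i) a = Delta_const m i.
Proof. exact: Delta_ext. Qed.

Lemma pairD m p q (s s' : Delta m p) (a a' : Delta m q) j :
  (s, a) = (s', a') -> sval (s j) = sval (s' j) /\ sval (a j) = sval (a' j).
Proof. by move=> e; have /= -> := congr1 fst e; have /= -> := congr1 snd e. Qed.

Notation cyl := (sprod (simplex 1)).

Definition region (L : sSet) (K : forall n, L n -> Prop) (e : vert 1) n
  (y : cyl L n) : Prop := K n y.2 \/ y.1 = Delta_const n e.

(* Lifts against the pushout-products of all inclusions with an endpoint of the
   interval; for simplicial sets over B this is equivalent to being a Kan
   fibration, but it applies to arbitrary pairs without triangulating them. *)
Definition hfibration (E B : sSet) (p : smap E B) : Prop :=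
  forall (L : sSet) (K : forall n, L n -> Prop) (e : vert 1)
    (u : forall n, cyl L n -> E n) (v : smap (cyl L) B),
  closed K -> nat_on (region K e) u ->
  (forall n y, region K e y -> p n (u n y) = v n y) ->
  exists w : smap (cyl L) E, (forall n y, p n (w n y) = v n y) /\
    forall n y, region K e y -> w n y = u n y.

Lemma region_closed (L : sSet) (K : forall n, L n -> Prop) e : closed K -> closed (@region L K e).
Proof.
move=> cK m n a [s x] /= [/= Kx|/= ->]; [by left; apply: cK|right=> /=].
exact: Delta_const_comp.
Qed.

(** One horn filling. The simplices sact b x are pairwise distinct and those in S form a horn, so
    adding x to S is a pushout along that horn inclusion. *)
Lemma attach (E B : sSet) (p : smap E B) (L : sSet) (S : forall n, L n -> Prop)
    (u : forall n, L n -> E n) (v : smap L B) N (x : L N.+1) (k : vert N.+1) :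
  kan_fibration p -> closed S -> nat_on S u ->
  (forall n y, S n y -> p n (u n y) = v n y) ->
  (forall m (b : Delta m N.+1), S m (sact b x) <-> in_horn k b) ->
  (forall m (b c : Delta m N.+1), sact b x = sact c x -> b = c) ->
  exists u' : forall n, L n -> E n,
  [/\ nat_on (fun n y => S n y \/ exists b, y = sact b x) u',
      forall n y, S n y \/ (exists b, y = sact b x) -> p n (u' n y) = v n y &
      forall n y, S n y -> u' n y = u n y].
Proof.
move=> pK cS un pu hS inj.
have hn m q (a : Delta m q) (b : horn k q) :
    u m (sact (sval (sact a b)) x) = sact a (u q (sact (sval b) x)).
  by rewrite /= -sact_comp un //; apply/hS; case: b.
pose h := @SMap (horn k) E (fun m b => u m (sact (sval b) x)) hn.
have vn m q (a : Delta m q) (b : simplex N.+1 q) :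
    v m (sact (sact a b) x) = sact a (v q (sact b x)).
  by rewrite /= -sact_comp sfun_nat.
have [|w [wu wv]] := pK N k h (@SMap (simplex N.+1) B _ vn).
  by move=> m [b hb] /=; apply/pu/hS.
pose isx m y (b : Delta m N.+1) := y = sact b x.
pose u' m (y : L m) : E m := if pselect (S m y) then u m y else
  if pselect (exists b, isx m y b) is left h then w m (sval (cid h)) else u m y.
have uS m y : S m y -> u' m y = u m y by rewrite /u'; case: pselect.
have ux m (b : Delta m N.+1) : u' m (sact b x) = w m b.
  rewrite /u'; case: pselect => /= [/hS hb|nS].
    by have /= -> := wu _ (exist _ b hb).
  case: pselect => [e|[]]; last by exists b.
  by case: cid => c /= /inj ->.
exists u'; split=> //.
- move=> m n a y [Sy|[b ->]]; first by rewrite !uS ?un //; apply: cS.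
  by rewrite sact_comp !ux -sfun_nat.
- by move=> n y [Sy|[b ->]]; [rewrite uS // pu | rewrite ux wv].
Qed.

(** * Triangulation of the prism *)

Section Prism.
Variable n : nat.

Fact prism_s_subproof (i : nat) (q : vert n.+1) : ((i < sval q) <= 1)%N.
Proof. by case: (i < _)%N. Qed.
Fact prism_s_mono (i : nat) (q r : vert n.+1) : (sval q <= sval r)%N ->
  (sval (mkv (prism_s_subproof i q)) <= sval (mkv (prism_s_subproof i r)))%N.
Proof. by move=> /=; lia. Qed.
Definition prism_s i : Delta n.+1 1 := DeltaMap (@prism_s_mono i).

Fact prism_a_subproof (i : nat) (hi : (i <= n)%N) (q : vert n.+1) :
  (sval q - (i < sval q) <= n)%N.
Proof. by have := vert_le q; lia. Qed.
Fact prism_a_mono (i : nat) (hi : (i <= n)%N) (q r : vert n.+1) :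
  (sval q <= sval r)%N ->
  (sval (mkv (prism_a_subproof hi q)) <= sval (mkv (prism_a_subproof hi r)))%N.
Proof. by move=> /=; lia. Qed.
Definition prism_a i (hi : (i <= n)%N) : Delta n.+1 n := DeltaMap (@prism_a_mono i hi).

(** The shuffle (0, 0), ..., (0, i), (1, i), ..., (1, n): the i-th maximal simplex of the prism. *)
Definition prism_x i (hi : (i <= n)%N) : cyl (simplex n) n.+1 :=
  (prism_s i, prism_a hi).

Lemma prism_inj i (hi : (i <= n)%N) m (b c : Delta m n.+1) :
  sact b (prism_x hi) = sact c (prism_x hi) -> b = c.
Proof.
move=> e; apply: Delta_ext => j; apply: val_vert.
by have /= := pairD j e; lia.
Qed.

Lemma prism_cover m (y : cyl (simplex n) m) :
  exists i (hi : (i <= n)%N) (b : Delta m n.+1), y = sact b (prism_x hi).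
Proof.
case: y => s a.
(* The index i is the least upper bound of the second coordinate on the vertices over 0; inside the
   i-th maximal simplex a vertex sits at the sum of its two coordinates. *)
pose Q i := `[< forall j, sval (s j) = 0%N -> (sval (a j) <= i)%N >].
have exQ : exists i, Q i by exists n; apply/asboolP => j _; apply: vert_le.
have [i /asboolP Qi mini] := ex_minnP exQ.
have hi : (i <= n)%N by apply: mini; apply/asboolP => j _; apply: vert_le.
have s01 j : sval (s j) = 0%N \/ sval (s j) = 1%N by have := vert_le (s j); lia.
have lo j : sval (s j) = 1%N -> (i <= sval (a j))%N.
  move=> sj; apply: mini; apply/asboolP => k sk.
  have [kj|jk] := leqP (sval k) (sval j); first exact: dfun_mono.
  by have := dfun_mono s (ltnW jk); lia.
have hb j : (sval (a j) + sval (s j) <= n.+1)%N.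
  by have := vert_le (a j); have := vert_le (s j); lia.
have mb j k : (sval j <= sval k)%N -> (sval (mkv (hb j)) <= sval (mkv (hb k)))%N.
  by move=> jk /=; have := dfun_mono s jk; have := dfun_mono a jk; lia.
exists i, hi, (DeltaMap mb); congr pair; apply: Delta_ext => j; apply: val_vert => /=.
- by have := Qi j; have := lo j; have := s01 j; lia.
- by have := Qi j; have := lo j; have := s01 j; lia.
Qed.

(** The order of attachment. It starts with the maximal simplex that has a facet in the end [e]:
    index 0 for the end 1 and index n for the end 0. *)
Definition prism_idx (e : vert 1) r := if sval e == 1%N then r else (n - r)%N.

Lemma prism_idx_le e r : (r <= n)%N -> (prism_idx e r <= n)%N.
Proof. by rewrite /prism_idx; case: ifP; lia. Qed.

Definition prism_S (e : vert 1) r m (y : cyl (simplex n) m) : Prop :=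
  region (L := simplex n) (fun m a => bdry a) e y \/
  exists r' (hr : (r' <= n)%N) (b : Delta m n.+1),
    (r' < r)%N /\ y = sact b (prism_x (prism_idx_le e hr)).

Lemma prism_S_closed e r : closed (@prism_S e r).
Proof.
move=> m p a y [h|[r' [hr [b [lt ->]]]]].
  by left; apply: (@region_closed (simplex n)) h => q t c d; apply: bdry_comp.
by right; exists r', hr, (Delta_comp b a); rewrite sact_comp.
Qed.

Fact prism_k_subproof e r : (r <= n)%N -> (prism_idx e r + sval e <= n.+1)%N.
Proof. by move/(prism_idx_le e); have := vert_le e; lia. Qed.

(** For the maximal simplex with index i, all facets lie over the boundary of the base except those
    opposite the vertices i and i + 1. One of these two is shared with the simplex attached before,
    or lies in the end [e] when r = 0; only the other, opposite i + [e], is still missing. *)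
Lemma prism_horn e r (hr : (r <= n)%N) m (b : Delta m n.+1) :
  prism_S e r (sact b (prism_x (prism_idx_le e hr))) <->
  in_horn (mkv (prism_k_subproof e hr)) b.
Proof.
have hi := prism_idx_le e hr.
have e01 : sval e = 0%N \/ sval e = 1%N by have := vert_le e; lia.
have hc : ((prism_idx e r).+1 - sval e <= n.+1)%N by lia.
have missc : (forall j, sval (b j) <> (prism_idx e r).+1 - sval e)%N ->
    in_horn (mkv (prism_k_subproof e hr)) b.
  move=> h; exists (mkv hc); first by move/(congr1 sval) => /=; lia.
  by move=> j /(congr1 sval) /=; apply: h.
split.
  case=> [[/= [q hq]|/= es]|[r' [hr' [b' [lt e2]]]]].
  - have [qi|nqi] := eqVneq (sval q) (prism_idx e r).
      by apply: missc => j bj; apply: (hq j); apply: val_vert => /=; lia.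
    have hq' : (sval q + (prism_idx e r < sval q) <= n.+1)%N.
      by have := vert_le q; lia.
    exists (mkv hq'); first by move/(congr1 sval) => /=; lia.
    move=> j /(congr1 sval) /= bj; apply: (hq j); apply: val_vert => /=; lia.
  - apply: missc => j bj.
    by have /= := congr1 (fun d : Delta m 1 => sval (d j)) es; lia.
  - apply: missc => j bj.
    by have /= := pairD j e2; move: bj; rewrite /prism_idx; case: ifP; lia.
case=> q qk hq.
have {}hq j : sval (b j) <> sval q by move/val_vert; apply: hq.
have {}qk : sval q <> (prism_idx e r + sval e)%N.
  by move=> h; apply: qk; apply: val_vert.
have [qc|nqc] := eqVneq (sval q) ((prism_idx e r).+1 - sval e)%N; last first.
  left; left=> /=.
  have hq' : (sval q - (prism_idx e r < sval q) <= n)%N.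
    by have := vert_le q; lia.
  exists (mkv hq') => j /(congr1 sval) /= bj; apply: (hq j).
  by lia.
case: r hr hi hc missc qk hq qc => [|r] hr hi hc _ qk hq qc.
  left; right; apply: Delta_ext => j; apply: val_vert => /=.
  have := hq j; have := vert_le (b j); move: qc; rewrite /prism_idx.
  by case: e01 => ->; rewrite ?eqxx /=; lia.
right; exists r, (ltnW hr), b; split=> //.
congr pair; apply: Delta_ext => j; apply: val_vert => /=.
- have := hq j; have := vert_le (b j); move: qc; rewrite /prism_idx.
  by case: e01 => ->; rewrite ?eqxx /=; lia.
- have := hq j; have := vert_le (b j); move: qc; rewrite /prism_idx.
  by case: e01 => ->; rewrite ?eqxx /=; lia.
Qed.

Lemma prism_lift (E B : sSet) (p : smap E B) (e : vert 1)
    (u : forall m, cyl (simplex n) m -> E m) (v : smap (cyl (simplex n)) B) :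
  kan_fibration p ->
  nat_on (region (L := simplex n) (fun m a => bdry a) e) u ->
  (forall m y, region (L := simplex n) (fun m a => bdry a) e y -> p m (u m y) = v m y) ->
  exists w : smap (cyl (simplex n)) E, (forall m y, p m (w m y) = v m y) /\
    forall m y, region (L := simplex n) (fun m a => bdry a) e y -> w m y = u m y.
Proof.
move=> pK un pu.
have step r : (r <= n.+1)%N -> exists w : forall m, cyl (simplex n) m -> E m,
    [/\ nat_on (@prism_S e r) w, forall m y, prism_S e r y -> p m (w m y) = v m y &
      forall m y, region (L := simplex n) (fun m a => bdry a) e y -> w m y = u m y].
  elim: r => [|r IH] hr.
    have S0 m y : @prism_S e 0 m y -> region (L := simplex n) (fun m a => bdry a) e y.
      by case=> // -[r' [hr' [b []]]].
    exists u; split=> // [m q a y /S0|m y /S0]; [exact: un | exact: pu].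
  have [w [wn pw wu]] := IH (ltnW hr).
  have hr' : (r <= n)%N by lia.
  have [w' [w'n pw' w'w]] := attach pK (@prism_S_closed e r) wn pw
    (prism_horn e hr') (@prism_inj _ (prism_idx_le e hr')).
  have SS m y : @prism_S e r.+1 m y ->
      @prism_S e r m y \/ exists b, y = sact b (prism_x (prism_idx_le e hr')).
    case=> [h|[r1 [hr1 [b [lt eb]]]]]; first by left; left.
    have [r1r|r1r] := ltnP r1 r; first by left; right; exists r1, hr1, b.
    right; have er : r1 = r by lia.
    subst r1; exists b; rewrite eb; congr (sact b (prism_x _)).
    exact: bool_irrelevance.
  exists w'; split.
  - by move=> m q a y /SS; apply: w'n.
  - by move=> m y /SS; apply: pw'.
  - by move=> m y h; rewrite w'w ?wu //; left.
have [w [wn pw wu]] := step n.+1 (leqnn _).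
have all m y : @prism_S e n.+1 m y.
  have [i [hi [b ->]]] := prism_cover y.
  have hr : (prism_idx e i <= n)%N by apply: prism_idx_le.
  right; exists (prism_idx e i), hr, b; split; first by lia.
  have ei : prism_idx e (prism_idx e i) = i.
    by rewrite /prism_idx; case: (sval e == 1%N) => //; apply: subKn.
  move: (prism_idx_le e hr); rewrite ei => hi'.
  by congr (sact b (prism_x _)); apply: bool_irrelevance.
have wN m q (a : Delta m q) y : w m (sact a y) = sact a (w q y) by apply: wn.
exists (SMap wN); split=> m y; first by rewrite /= pw.
exact: wu.
Qed.

End Prism.

Section PathSpace.
Variable X : sSet.

Definition path_sact m n (a : Delta m n) (f : smap (cyl (simplex n)) X) :
  smap (cyl (simplex m)) X.
Proof.
refine (@SMap (cyl (simplex m)) X (fun p x => f p (x.1, Delta_comp a x.2)) _).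
by move=> p q b [s x]; rewrite /= -sfun_nat /= Delta_compA.
Defined.

Definition path_space : sSet.
Proof.
refine (@SSet (fun n => smap (cyl (simplex n)) X) path_sact _ _).
- move=> n f; apply: smap_ext => m [s b] /=.
  by congr (f m (_, _)); apply: Delta_ext.
- by move=> m n p g f x; apply: smap_ext => q [s b] /=; rewrite Delta_compA.
Defined.

End PathSpace.

Fact uncurry_subproof (L X : sSet) (w : smap L (path_space X)) m n (a : Delta m n)
  (y : cyl L n) : w m (sact a y).2 m ((sact a y).1, Delta_id m) =
                  sact a (w n y.2 n (y.1, Delta_id n)).
Proof.
case: y => s x /=; rewrite sfun_nat /= -sfun_nat /=.
by congr (w n x m (_, _)); apply: Delta_ext.
Qed.

Definition uncurry (L X : sSet) (w : smap L (path_space X)) : smap (cyl L) X :=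
  SMap (uncurry_subproof w).

(** By adjunction a lift over the cylinder is a map from L to the path space, and [extend_section]
    reduces its existence to one simplex relative to its boundary, which is [prism_lift]. The
    constant path [pinh] is the default value that [extend_section] asks for. *)
Lemma kan_hfibration (E : psSet) (B : sSet) (p : smap E B) :
  kan_fibration p -> hfibration p.
Proof.
move=> pK L K e u v cK un pu.
pose Phi n (x : L n) (z : path_space E n) :=
  (forall m s (a : Delta m n), p m (z m (s, a)) = v m (s, sact a x)) /\
  (forall m (a : Delta m n), z m (Delta_const m e, a) = u m (Delta_const m e, sact a x)).
have Phin m n (a : Delta m n) (x : L n) z : Phi n x z -> Phi m (sact a x) (sact a z).
  by case=> h1 h2; split=> [q s b|q b]; rewrite /= ?h1 ?h2 sact_comp.
pose pinh n : path_space E n := smap_pt (cyl (simplex n)) E.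
pose u0 n (x : L n) : path_space E n :=
  if pselect (K n x) is left h then
    @SMap (cyl (simplex n)) E (fun m y => u m (y.1, sact y.2 x))
      (fun m q a y => etrans (congr1 (fun t => u m (Delta_comp y.1 a, t))
         (esym (sact_comp y.2 a x)))
       (un m q a (y.1, sact y.2 x) (or_introl (cK _ _ y.2 x h))))
  else pinh n.
have u0E n (x : L n) m s (a : Delta m n) : K n x ->
    u0 n x m (s, a) = u m (s, sact a x).
  by rewrite /u0; case: pselect.
have fillP n (x : L n) (ub : forall m, Delta m n -> path_space E m) :
    @nat_on (simplex n) (path_space E) (fun m a => bdry a) ub ->
    (forall m (a : Delta m n), bdry a -> Phi m (sact a x) (ub m a)) ->
    exists z, Phi n x z /\ forall m (a : Delta m n), bdry a -> sact a z = ub m a.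
  move=> ubn ubP.
  pose u1 m (y : cyl (simplex n) m) : E m :=
    if pselect (bdry y.2) then ub m y.2 m (y.1, Delta_id m)
    else u m (y.1, sact y.2 x).
  have u1b m s (a : Delta m n) : bdry a -> u1 m (s, a) = ub m a m (s, Delta_id m).
    by rewrite /u1; case: pselect.
  have u1c m (a : Delta m n) : u1 m (Delta_const m e, a) = u m (Delta_const m e, sact a x).
    rewrite /u1 /=; case: pselect => //= ba; have [_ ->] := ubP _ _ ba.
    by rewrite sact_id.
  have [|m [s a]|w [pw wu1]] := @prism_lift n E B p e u1
     (smap_comp v (@SMap (cyl (simplex n)) (cyl L) (fun m y => (y.1, sact y.2 x))
        (fun m q a y => congr1 (pair _) (esym (sact_comp y.2 a x))))) pK.
  + move=> m q a [s b] [/= bb|/= ->].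
      rewrite !u1b //; last exact: bdry_comp.
      rewrite (ubn _ _ a b bb) /= -sfun_nat /=.
      by congr (ub q b m (_, _)); apply: Delta_ext.
    rewrite Delta_const_comp !u1c -sact_comp.
    by have /= := un m q a (Delta_const q e, sact b x) (or_intror erefl); rewrite Delta_const_comp.
  + case=> /= [ba|->]; last by rewrite u1c pu //; right.
    by rewrite u1b //; have [-> _] := ubP _ _ ba; rewrite sact_id.
  exists w; split; first split=> [m s a|m a]; first by rewrite pw.
    by rewrite wu1 ?u1c //; right.
  move=> m a ba; apply: smap_ext => q [s b] /=.
  rewrite wu1 ?u1b; [|exact: bdry_comp|by left; apply: bdry_comp].
  by rewrite (ubn _ _ b a ba) /= ; congr (ub m a q (_, _)); apply: Delta_ext.
have [||w [wP wu]] := extend_section pinh Phin fillP cK (u := u0).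
- move=> m n a x Kx; apply: smap_ext => q [s b].
  by rewrite [RHS]/= !u0E ?sact_comp //; apply/cK.
- move=> n x Kx; split=> [m s a|m a]; rewrite u0E // pu //.
  by left; apply/cK.
exists (uncurry w); split=> [n [s x]|n [s x]] /=.
  by have [-> _] := wP n x; rewrite sact_id.
case=> /= [Kx|->]; first by rewrite wu // u0E // sact_id.
by have [_ ->] := wP n x; rewrite sact_id.
Qed.

(** The horn inclusion is a retract of its pushout-product with an endpoint: the end [e] of the
    cylinder is folded into the horn, the other end is left alone. *)
Lemma hfibration_kan (E B : sSet) (p : smap E B) :
  (forall n, E n) -> hfibration p -> kan_fibration p.
Proof.
move=> inh hp n k u v uv.
have [e [hk1 hk2]] : exists e : vert 1,
    (sval e = 0%N -> sval k < n.+1)%N /\ (sval e = 1%N -> 0 < sval k)%N.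
  have [h|h] := ltnP (sval k) n.+1; first by exists vert0.
  by exists vert1; split=> [//|_]; apply: leq_trans h.
(* At the end 0 the fold is the minimum with k, which misses the last vertex; at the end 1 it is the
   maximum with k, which misses the vertex 0. The choice of [e] makes k differ from the vertex to be
   missed. *)
pose r0 (t x : nat) := if t == sval e then
  (if sval e == 0%N then minn x (sval k) else maxn x (sval k)) else x.
have e01 : sval e = 0%N \/ sval e = 1%N by have := vert_le e; lia.
have rle m (y : cyl (simplex n.+1) m) j : (r0 (sval (y.1 j)) (sval (y.2 j)) <= n.+1)%N.
  by have := vert_le (y.2 j); have := vert_le k; rewrite /r0; do 2?case: ifP; lia.
have rmono m (y : cyl (simplex n.+1) m) i j : (sval i <= sval j)%N ->
    (sval (mkv (rle m y i)) <= sval (mkv (rle m y j)))%N.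
  move=> ij /=; have := dfun_mono y.1 ij; have := dfun_mono y.2 ij.
  have := vert_le (y.1 j); rewrite /r0.
  by case: e01 => -> /=; do 2?case: ifP; lia.
pose r m (y : cyl (simplex n.+1) m) : Delta m n.+1 := DeltaMap (@rmono m y).
have rn m q (a : Delta m q) y : r m (sact a y) = Delta_comp (r q y) a.
  by apply: Delta_ext => j; apply: val_vert.
pose rr := @SMap (cyl (simplex n.+1)) (simplex n.+1) r rn.
have rhorn m (y : cyl (simplex n.+1) m) :
    region (L := simplex n.+1) (fun m a => in_horn k a) e y -> in_horn k (r m y).
  case: y => s a [/= [i ik hi]|/= ->].
    exists i => // j /(congr1 sval) /= rj.
    have : sval (a j) <> sval i by move/val_vert; apply: hi.
    have : sval i <> sval k by move/val_vert.
    by move: rj; rewrite /r0; do 2?case: ifP; lia.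
  case: e01 => e01.
    exists (mkv (leqnn n.+1)); first by move/(congr1 sval) => /=; have := hk1 e01; lia.
    by move=> j /(congr1 sval) /=; rewrite /r0 eqxx e01 /=; have := hk1 e01; lia.
  exists (mkv (leq0n n.+1)); first by move/(congr1 sval) => /=; have := hk2 e01; lia.
  by move=> j /(congr1 sval) /=; rewrite /r0 eqxx e01 /=; have := hk2 e01; lia.
pose u' m (y : cyl (simplex n.+1) m) : E m :=
  if pselect (in_horn k (r m y)) is left h then u m (exist _ _ h) else inh m.
have u'E m y (h : in_horn k (r m y)) : u' m y = u m (exist _ _ h).
  by rewrite /u'; case: pselect => // h'; congr (u m _); apply: eq_exist.
have [||m y /rhorn h|w [pw wu]] := hp (simplex n.+1) (fun m a => in_horn k a) e u'
    (smap_comp v rr).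
- by move=> m q a x; apply: horn_subproof.
- move=> m q a y /rhorn h.
  have h' : in_horn k (r m (sact a y)) by rewrite rn; apply: horn_subproof.
  rewrite !u'E -sfun_nat; congr (u m _); apply: eq_exist; exact: rn.
- by rewrite u'E uv.
have [e' ee'] : exists e' : vert 1, sval e' <> sval e.
  by case: e01 => ->; [exists vert1 | exists vert0].
have rid m (a : Delta m n.+1) : r m (Delta_const m e', a) = a.
  by apply: Delta_ext => j; apply: val_vert => /=; rewrite /r0; case: ifP => // /eqP.
have wn m q (a : Delta m q) (x : simplex n.+1 q) :
    w m (Delta_const m e', sact a x) = sact a (w q (Delta_const q e', x)).
  by rewrite -sfun_nat.
exists (@SMap (simplex n.+1) E _ wn); split=> [m [a ha]|m a] /=.
  rewrite wu; last by left.
  have h : in_horn k (r m (Delta_const m e', a)) by rewrite rid.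
  by rewrite u'E; congr (u m _); apply: eq_exist; apply: rid.
by rewrite pw /= rid.
Qed.

(** * Homotopies and weak equivalences *)

Definition sone : sSet :=
  @SSet (fun=> unit) (fun _ _ _ _ => tt) (fun _ x => match x with tt => erefl end)
    (fun _ _ _ _ _ _ => erefl).

Definition to_sone (X : sSet) : smap X sone :=
  @SMap X sone (fun _ _ => tt) (fun _ _ _ _ => erefl).

Definition hkan (X : sSet) : Prop :=
  forall (L : sSet) (K : forall n, L n -> Prop) (e : vert 1)
    (u : forall n, cyl L n -> X n),
  closed K -> nat_on (region K e) u ->
  exists w : smap (cyl L) X, forall n y, region K e y -> w n y = u n y.

Lemma hkanE (X : sSet) : hkan X <-> hfibration (to_sone X).
Proof.
split=> h L K e u => [v|] cK un; first move=> _.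
  by have [w wu] := h L K e u cK un; exists w; split=> // n y; case: (v n y).
by have [//|w [_ wu]] := h L K e u (to_sone _) cK un; exists w.
Qed.

Lemma kan_hkan (X : psSet) : kan X -> hkan X.
Proof.
move=> kX; apply/hkanE; apply: kan_hfibration => n k u v _.
by have [w wu] := kX n k u; exists w; split=> // m x; case: (v m x).
Qed.

Lemma hkan_kan (X : sSet) : (forall n, X n) -> hkan X -> kan X.
Proof.
move=> inh /hkanE/(hfibration_kan inh) h n k u.
by have [//|w [wu _]] := h n k u (to_sone _); exists w.
Qed.

Definition v0 m : vert m := mkv (leq0n m).

Section Box.
Variables (Y L : sSet) (K : forall n, L n -> Prop) (e : vert 1).
Variables (a : smap (cyl L) Y) (b : vert 1 -> smap (cyl L) Y).
Variable k : forall n, Delta n 1 -> Delta n 1 -> L n -> Y n.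

(** An open box: the data at one end of the first interval, at both ends of the second and over K
    live on a pushout-product with an endpoint, so one use of [hkan] fills it. Symmetry and
    transitivity of homotopy and the lifting of paths in homotopy pullbacks are all instances. *)
Lemma hkan_box : hkan Y -> closed K ->
  (forall m n (c : Delta m n) s' s (x : L n), K x ->
     k (Delta_comp s' c) (Delta_comp s c) (sact c x) = sact c (k s' s x)) ->
  (forall i n (x : L n), a n (Delta_const n i, x) = b i n (Delta_const n e, x)) ->
  (forall n s (x : L n), K x -> k (Delta_const n e) s x = a n (s, x)) ->
  (forall i n s' (x : L n), K x -> k s' (Delta_const n i) x = b i n (s', x)) ->
  exists w : smap (cyl (cyl L)) Y,
  [/\ forall n s (x : L n), w n (Delta_const n e, (s, x)) = a n (s, x),
      forall i n s' (x : L n), w n (s', (Delta_const n i, x)) = b i n (s', x) &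
      forall n s' s (x : L n), K x -> w n (s', (s, x)) = k s' s x].
Proof.
move=> kY cK kn ab ka kb.
pose u n (y : cyl (cyl L) n) : Y n := if pselect (K y.2.2) then k y.1 y.2.1 y.2.2
  else if pselect (boundary y.2.1) then b (y.2.1 (v0 n)) n (y.1, y.2.2) else a n y.2.
have uK n s' s (x : L n) : K x -> u n (s', (s, x)) = k s' s x.
  by rewrite /u; case: pselect.
have ub i n s' (x : L n) : u n (s', (Delta_const n i, x)) = b i n (s', x).
  rewrite /u /=; case: pselect => [Kx|_] /=; first exact: kb.
  by case: pselect => //= -[]; exists i.
have ua n s (x : L n) : u n (Delta_const n e, (s, x)) = a n (s, x).
  rewrite /u /=; case: pselect => [Kx|_] /=; first exact: ka.
  by case: pselect => //= -[i ->]; rewrite ab.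
have [||w wu] := kY (cyl L) (fun n y => K y.2 \/ boundary y.1) e u.
- by move=> m n c [s x] /= [Kx|bs]; [left; apply: cK | right; apply: boundary_comp].
- move=> m n c [s' [s x]] [/= [Kx|[i ->]]|/= ->].
  + by rewrite !uK ?kn //; apply: cK.
  + by rewrite Delta_const_comp !ub -sfun_nat.
  + by rewrite Delta_const_comp !ua -sfun_nat.
exists w; split=> [n s x|i n s' x|n s' s x Kx]; rewrite wu ?ua ?ub ?uK //.
- by right.
- by left; right; exists i.
- by left; left.
Qed.

End Box.

Lemma homotopic_refl (X Y : sSet) (f : smap X Y) : homotopic f f.
Proof.
exists (@SMap (cyl X) Y (fun n y => f n y.2) (fun m n a y => sfun_nat f a y.2)).
by [].
Qed.

Lemma homotopic_compr (X Y Z : sSet) (f g : smap Y Z) (h : smap X Y) :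
  homotopic f g -> homotopic (smap_comp f h) (smap_comp g h).
Proof.
case=> w wP; exists (@SMap (cyl X) Z (fun n y => w n (y.1, h n y.2))
  (fun m n a y => etrans (congr1 (fun t => w m (Delta_comp y.1 a, t)) (sfun_nat h a y.2))
     (sfun_nat w a (y.1, h n y.2)))).
by move=> n x /=; apply: wP.
Qed.

Lemma homotopic_compl (X Y Z : sSet) (f g : smap X Y) (h : smap Y Z) :
  homotopic f g -> homotopic (smap_comp h f) (smap_comp h g).
Proof.
by case=> w wP; exists (smap_comp h w) => n x /=; have [-> ->] := wP n x.
Qed.

Definition cyl_fst (L X : sSet) (f : smap L X) : smap (cyl L) X :=
  @SMap (cyl L) X (fun n y => f n y.2) (fun m n a y => sfun_nat f a y.2).

Fact cyl_end_subproof (L X : sSet) (w : smap (cyl L) X) (i : vert 1) m n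
  (a : Delta m n) (x : L n) :
  w m (Delta_const m i, sact a x) = sact a (w n (Delta_const n i, x)).
Proof. by rewrite -sfun_nat. Qed.

Definition cyl_end (L X : sSet) (w : smap (cyl L) X) (i : vert 1) : smap L X :=
  SMap (cyl_end_subproof w i).

Lemma homotopic_sym (X Y : sSet) (f g : smap X Y) :
  hkan Y -> homotopic f g -> homotopic g f.
Proof.
move=> kY [h hP].
have [|||||w [wa wb _]] := @hkan_box Y X (fun _ _ => False) vert0 (cyl_fst f)
  (fun i => if sval i == 0%N then h else cyl_fst f) (fun n _ _ x => f n x) kY => //.
  by move=> i n x; have [-> /=|-> /=] := vert1P i; rewrite ?(hP n x).1.
exists (cyl_end w vert1) => n x /=; rewrite !wb /=.
by have [_ ->] := hP n x.
Qed.

Lemma homotopic_trans (X Y : sSet) (f g h : smap X Y) :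
  hkan Y -> homotopic f g -> homotopic g h -> homotopic f h.
Proof.
move=> kY [h1 h1P] [h2 h2P].
have [|||||w [wa wb _]] := @hkan_box Y X (fun _ _ => False) vert0 h1
  (fun i => if sval i == 0%N then cyl_fst f else h2) (fun n _ _ x => f n x) kY => //.
  move=> i n x; have [-> /=|-> /=] := vert1P i; first by have [] := h1P n x.
  by have [_ ->] := h1P n x; have [-> _] := h2P n x.
exists (cyl_end w vert1) => n x /=; rewrite !wb /=.
by have [_ ->] := h2P n x.
Qed.

Lemma weak_equiv_comp (X Y Z : sSet) (f : smap X Y) (g : smap Y Z) :
  hkan X -> hkan Z -> weak_equiv f -> weak_equiv g -> weak_equiv (smap_comp g f).
Proof.
move=> kX kZ [f' [f1 f2]] [g' [g1 g2]]; exists (smap_comp f' g'); split.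
  by apply: homotopic_trans f1 => //; apply: (homotopic_compl f' (homotopic_compr f g1)).
by apply: homotopic_trans g2 => //; apply: (homotopic_compl g (homotopic_compr g' f2)).
Qed.

Lemma weak_equiv_iso (X Y : sSet) (f : smap X Y) (g : smap Y X) :
  (forall n x, g n (f n x) = x) -> (forall n y, f n (g n y) = y) -> weak_equiv f.
Proof.
move=> gf fg; exists g; split.
- by have -> : smap_comp g f = smap_id X by [apply: smap_ext]; apply: homotopic_refl.
- by have -> : smap_comp f g = smap_id Y by [apply: smap_ext]; apply: homotopic_refl.
Qed.

Lemma weak_equiv_section (X Y : sSet) (r : smap X Y) (j : smap Y X) :
  hkan X -> (forall n y, r n (j n y) = y) -> weak_equiv r -> weak_equiv j.
Proof.
move=> kX rj [g [g1 g2]].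
have e : smap_comp r j = smap_id Y by apply: smap_ext.
exists r; split; first by rewrite e; apply: homotopic_refl.
apply: (homotopic_trans kX _ g1).
have := homotopic_sym kX (homotopic_compr (smap_comp j r) g1).
have -> : smap_comp (smap_id X) (smap_comp j r) = smap_comp j r by apply: smap_ext.
suff -> : smap_comp (smap_comp g r) (smap_comp j r) = smap_comp g r.
by [].
by apply: smap_ext => n x /=; rewrite rj.
Qed.

(* The relative form of surjectivity on all homotopy groups and injectivity on
   the base; between Kan complexes it characterises weak equivalences. *)
Definition rel_equiv (X Y : sSet) (f : smap X Y) : Prop :=
  forall (L : sSet) (K : forall n, L n -> Prop) (u : forall n, L n -> X n)
    (v : smap L Y) (k : forall n, cyl L n -> Y n),
  closed K -> nat_on K u -> nat_on (fun n (y : cyl L n) => K n y.2) k ->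
  (forall n x, K n x -> k n (Delta_const n vert0, x) = f n (u n x)) ->
  (forall n x, K n x -> k n (Delta_const n vert1, x) = v n x) ->
  exists (u' : smap L X) (k' : smap (cyl L) Y),
  [/\ forall n x, K n x -> u' n x = u n x,
      forall n x, k' n (Delta_const n vert0, x) = f n (u' n x),
      forall n x, k' n (Delta_const n vert1, x) = v n x &
      forall n s x, K n x -> k' n (s, x) = k n (s, x)].

(** Over Y with empty subcomplex the identity lifts up to homotopy, which gives a right inverse g.
    Over the cylinder of X relative to its ends, sent to g f and the identity, the same property
    gives the homotopy between them. *)
Lemma rel_equiv_weak (X Y : sSet) (f : smap X Y) :
  smap Y X -> rel_equiv f -> weak_equiv f.
Proof.
move=> j h.
have [|||||g [k [_ k0 k1 _]]] := h Y (fun _ _ => False) j (smap_id Y)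
  (fun n y => y.2) => //.
pose u n (y : cyl X n) : X n := if sval (y.1 (v0 n)) == 0%N then g n (f n y.2) else y.2.
pose kk n (y : cyl (cyl X) n) : Y n :=
  if sval (y.2.1 (v0 n)) == 0%N then k n (y.1, f n y.2.2) else f n y.2.2.
have [|||||H [k' [Hu _ _ _]]] := h (cyl X) (fun n y => boundary y.1) u (cyl_fst f) kk.
- by move=> m n a [s x]; apply: boundary_comp.
- move=> m n a [s x] [/= i ->]; rewrite /u /=; case: ifP => _ //.
  by rewrite !sfun_nat.
- move=> m n a [s' [s x]] [/= i ->]; rewrite /kk /=; case: ifP => _; last by rewrite sfun_nat.
  by rewrite -sfun_nat /= sfun_nat.
- by move=> n [s x] _; rewrite /kk /u /=; case: ifP => _ //; rewrite k0.
- by move=> n [s x] _; rewrite /kk /u /=; case: ifP => _ //; rewrite k1.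
exists g; split; last by exists k => n x; rewrite k0 k1.
by exists H => n x; rewrite !Hu /u //=; [exists vert1 | exists vert0].
Qed.

(** * Homotopy pullbacks *)

Lemma glue_ends (L Y : sSet) (K : forall n, L n -> Prop)
    (k : forall n, cyl L n -> Y n) (b : vert 1 -> smap L Y) :
  closed K -> nat_on (fun n (y : cyl L n) => K n y.2) k ->
  (forall i n x, K n x -> k n (Delta_const n i, x) = b i n x) ->
  exists u : forall n, cyl L n -> Y n,
  [/\ nat_on (fun n (y : cyl L n) => K n y.2 \/ boundary y.1) u,
      forall n s x, K n x -> u n (s, x) = k n (s, x) &
      forall i n x, u n (Delta_const n i, x) = b i n x].
Proof.
move=> cK kn kb; pose u n (y : cyl L n) : Y n :=
  if pselect (K n y.2) then k n y else b (y.1 (v0 n)) n y.2.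
have uk n s x : K n x -> u n (s, x) = k n (s, x) by rewrite /u; case: pselect.
have ub i n x : u n (Delta_const n i, x) = b i n x.
  by rewrite /u /=; case: pselect => //=; apply: kb.
exists u; split=> // m n a [s x] /= [Kx|[i ->]]; last first.
  by rewrite Delta_const_comp !ub sfun_nat.
have Kax : K m (sact a x) by apply: cK.
by rewrite !uk //; have /= <- := kn m n a (s, x) Kx.
Qed.

Definition cyl_swap (L : sSet) : smap (cyl (cyl L)) (cyl (cyl L)) :=
  @SMap (cyl (cyl L)) (cyl (cyl L)) (fun n y => (y.2.1, (y.1, y.2.2)))
    (fun _ _ _ _ => erefl).

Section Hpb.
Variables (X Y Z : sSet) (f : smap X Y) (g : smap Z Y).

Record hpb_simp n := Hpb {
  hpx : X n;
  hpath : path_space Y n;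
  hpz : Z n;
  hpath0 : forall m (a : Delta m n),
    hpath m (Delta_const m vert0, a) = sact a (f n hpx);
  hpath1 : forall m (a : Delta m n),
    hpath m (Delta_const m vert1, a) = sact a (g n hpz) }.

Lemma hpb_ext n (s t : hpb_simp n) : hpx s = hpx t -> hpz s = hpz t ->
  (forall m c a, hpath s m (c, a) = hpath t m (c, a)) -> s = t.
Proof.
case: s t => [x p z p0 p1] [x' p' z' p0' p1'] /= ex ez ep.
have {}ep : p = p' by apply: smap_ext => m [c a]; apply: ep.
by subst; congr Hpb; apply: Prop_irrelevance.
Qed.

Definition hpb_sact m n (a : Delta m n) (t : hpb_simp n) : hpb_simp m.
Proof.
refine (@Hpb m (sact a (hpx t)) (sact a (hpath t)) (sact a (hpz t)) _ _).
- by move=> q b /=; rewrite hpath0 sfun_nat sact_comp.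
- by move=> q b /=; rewrite hpath1 sfun_nat sact_comp.
Defined.

Definition hpb_sset : sSet.
Proof.
refine (@SSet hpb_simp hpb_sact _ _).
- move=> n t; apply: hpb_ext; rewrite /= ?sact_id // => m c a.
  by rewrite /=; congr (hpath t m (_, _)); apply: Delta_ext.
- by move=> m n p b a t; apply: hpb_ext; rewrite /= ?sact_comp.
Defined.

Definition hpb1 : smap hpb_sset X := @SMap hpb_sset X hpx (fun _ _ _ _ => erefl).
Definition hpb2 : smap hpb_sset Z := @SMap hpb_sset Z hpz (fun _ _ _ _ => erefl).

Fact hev_subproof m n (a : Delta m n) (y : cyl hpb_sset n) :
  hpath (sact a y).2 m ((sact a y).1, Delta_id m) =
  sact a (hpath y.2 n (y.1, Delta_id n)).
Proof.
case: y => s t /=; rewrite -sfun_nat /=.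
by congr (hpath t m (_, _)); apply: Delta_ext.
Qed.

(** The tautological homotopy between the two composites to Y. Maps into the homotopy pullback are
    built and compared through this adjoint form rather than through [hpath]: see [hpb_mk],
    [hpb_mkE] and [hpb_eq]. *)
Definition hev : smap (cyl hpb_sset) Y :=
  @SMap (cyl hpb_sset) Y (fun n y => hpath y.2 n (y.1, Delta_id n)) hev_subproof.

Lemma hev0 n (t : hpb_sset n) : hev n (Delta_const n vert0, t) = f n (hpx t).
Proof. by rewrite /= hpath0 sact_id. Qed.

Lemma hev1 n (t : hpb_sset n) : hev n (Delta_const n vert1, t) = g n (hpz t).
Proof. by rewrite /= hpath1 sact_id. Qed.

Lemma hpathE n (t : hpb_sset n) m s (a : Delta m n) :
  hpath t m (s, a) = hev m (s, sact a t).
Proof. by rewrite /=; congr (hpath t m (_, _)); apply: Delta_ext. Qed.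

Section Mk.
Variables (L : sSet) (ux : smap L X) (up : smap (cyl L) Y) (uz : smap L Z).
Hypothesis up0 : forall n x, up n (Delta_const n vert0, x) = f n (ux n x).
Hypothesis up1 : forall n x, up n (Delta_const n vert1, x) = g n (uz n x).

Definition hpb_mk_path n (x : L n) : path_space Y n :=
  @SMap (cyl (simplex n)) Y (fun m y => up m (y.1, sact y.2 x))
    (fun m q a y => etrans (congr1 (fun t => up m (Delta_comp y.1 a, t))
       (esym (sact_comp y.2 a x))) (sfun_nat up a (y.1, sact y.2 x))).

Definition hpb_mk_simp n (x : L n) : hpb_simp n.
Proof.
refine (@Hpb n (ux n x) (hpb_mk_path x) (uz n x) _ _).
- by move=> m a /=; rewrite up0 !sfun_nat.
- by move=> m a /=; rewrite up1 !sfun_nat.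
Defined.

Definition hpb_mk : smap L hpb_sset.
Proof.
refine (@SMap L hpb_sset hpb_mk_simp _).
move=> m n a x; apply: hpb_ext; rewrite /= ?sfun_nat // => q c b.
by rewrite sact_comp.
Defined.

Lemma hpb_mkE n (s : Delta n 1) (x : L n) : hev n (s, hpb_mk n x) = up n (s, x).
Proof. by rewrite /= sact_id. Qed.

End Mk.

Lemma hpb_eq_on (L : sSet) (S : forall n, L n -> Prop) (u : smap L hpb_sset)
    (u' : forall n, L n -> hpb_sset n) :
  closed S -> nat_on S u' ->
  (forall n x, S n x -> hpx (u n x) = hpx (u' n x)) ->
  (forall n x, S n x -> hpz (u n x) = hpz (u' n x)) ->
  (forall n s x, S n x -> hev n (s, u n x) = hev n (s, u' n x)) ->
  forall n x, S n x -> u n x = u' n x.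
Proof.
move=> cS un ex ez ep n x Sx; apply: hpb_ext; [exact: ex|exact: ez|].
by move=> m c a; rewrite !hpathE -sfun_nat -un // ep //; apply: cS.
Qed.

Lemma hpb_eq (L : sSet) (u u' : smap L hpb_sset) :
  (forall n x, hpx (u n x) = hpx (u' n x)) ->
  (forall n x, hpz (u n x) = hpz (u' n x)) ->
  (forall n s x, hev n (s, u n x) = hev n (s, u' n x)) ->
  forall n x, u n x = u' n x.
Proof.
move=> ex ez ep n x; apply: (@hpb_eq_on L (fun _ _ => True)) => //.
by move=> m q a y _; rewrite sfun_nat.
Qed.

(** The X-component is extended by [hkan], after which the path is an open box in Y with sides f wx
    and g v. In the box time precedes the path parameter, hence [cyl_swap]. *)
Lemma hpb2_hfibration : hkan X -> hkan Y -> hfibration hpb2.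
Proof.
move=> kX kY L K e u v cK un uv.
have [|wx wxu] := kX L K e (fun n y => hpx (u n y)) cK.
  by move=> m n a y /un ->.
have an m n (a : Delta m n) (y : cyl L n) :
    hev m (Delta_comp y.1 a, u m (Delta_const m e, sact a y.2)) =
    sact a (hev n (y.1, u n (Delta_const n e, y.2))).
  have /= -> := un m n a (Delta_const n e, y.2) (or_intror erefl).
  by rewrite -[RHS]sfun_nat.
pose a := @SMap (cyl L) Y _ an.
have [||||w [wa wb wk]] := @hkan_box Y L K e a
   (fun i => if sval i == 0%N then smap_comp f wx else smap_comp g v)
   (fun n s' s x => hev n (s, u n (s', x))) kY cK.
- move=> m n c s' s x Kx.
  have /= -> := un m n c (s', x) (or_introl Kx).
  by rewrite -[RHS]sfun_nat.
- move=> i n x; rewrite [LHS]/= hpathE sact_id.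
  have r : region K e (Delta_const n e, x) by right.
  by have [->|->] := vert1P i; rewrite ?hev0 ?hev1 /= ?wxu // -uv.
- by [].
- move=> i n s' x Kx.
  have r : region K e (s', x) by left.
  by have [->|->] := vert1P i; rewrite ?hev0 ?hev1 /= ?wxu // -uv.
have wp i n (x : cyl L n) : cyl_end (smap_comp w (cyl_swap L)) i n x =
    (if sval i == 0%N then f n (wx n x) else g n (v n x)).
  by case: x => s x /=; rewrite wb; case: ifP.
exists (@hpb_mk (cyl L) wx (smap_comp w (cyl_swap L)) v (wp vert0) (wp vert1)).
split=> // n y; move: n y.
apply: hpb_eq_on => //.
- exact: region_closed.
- by move=> n y ry; rewrite /= -uv.
move=> n s [s' x] ry; rewrite hpb_mkE /=.
by case: ry => [/= Kx|/= ->]; [rewrite wk | rewrite wa].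
Qed.

Lemma hpb_hkan : hkan X -> hkan Y -> hkan Z -> hkan hpb_sset.
Proof.
move=> kX kY kZ L K e u cK un.
have [|wz wzu] := kZ L K e (fun n y => hpz (u n y)) cK.
  by move=> m n a y /un ->.
have [//|w [_ wu]] := hpb2_hfibration kX kY cK un (v := wz).
  by move=> n y ry; rewrite /= wzu.
by exists w.
Qed.

End Hpb.

Section HpbMap.
Variables (X Y Z X' Y' Z' : sSet) (f : smap X Y) (g : smap Z Y).
Variables (f' : smap X' Y') (g' : smap Z' Y').
Variables (al : smap X X') (be : smap Y Y') (ga : smap Z Z').
Hypothesis bf : forall n x, be n (f n x) = f' n (al n x).
Hypothesis bg : forall n x, be n (g n x) = g' n (ga n x).

Fact hpb_map_subproof0 n (x : hpb_sset f g n) :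
  smap_comp be (hev f g) n (Delta_const n vert0, x) =
  f' n (smap_comp al (hpb1 f g) n x).
Proof. by rewrite [LHS]/= hpath0 sact_id bf. Qed.

Fact hpb_map_subproof1 n (x : hpb_sset f g n) :
  smap_comp be (hev f g) n (Delta_const n vert1, x) =
  g' n (smap_comp ga (hpb2 f g) n x).
Proof. by rewrite [LHS]/= hpath1 sact_id bg. Qed.

Definition hpb_map : smap (hpb_sset f g) (hpb_sset f' g') :=
  hpb_mk hpb_map_subproof0 hpb_map_subproof1.

(** The extension problems for [al] and [ga] come first. Their solutions prescribe the ends of the
    path, and the problem for [be] is then solved over the cylinder of L relative to K and to both
    ends. *)
Lemma rel_equiv_hpb : rel_equiv al -> rel_equiv be -> rel_equiv ga ->
  (forall n, Y n) -> rel_equiv hpb_map.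
Proof.
move=> hal hbe hga inh L K u v k cK un kn k0 k1.
pose kx n (y : cyl L n) := hpx (k n y); pose kz n (y : cyl L n) := hpz (k n y).
have [||||ux [kx' [uxu kx0 kx1 kxk]]] := hal L K (fun n x => hpx (u n x))
    (smap_comp (hpb1 f' g') v) kx cK.
- by move=> m n a x /un ->.
- by move=> m n a y /kn; rewrite /kx => ->.
- by move=> n x Kx; rewrite /kx k0.
- by move=> n x Kx; rewrite /kx k1.
have [||||uz [kz' [uzu kz0 kz1 kzk]]] := hga L K (fun n x => hpz (u n x))
    (smap_comp (hpb2 f' g') v) kz cK.
- by move=> m n a x /un ->.
- by move=> m n a y /kn; rewrite /kz => ->.
- by move=> n x Kx; rewrite /kz k0.
- by move=> n x Kx; rewrite /kz k1.
have cK1 : @closed (cyl L) (fun n y => K n y.2) by move=> m n a y; apply: cK.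
have [||u1 [u1n u1k u1b]] := @glue_ends L Y K (fun n y => hev f g n (y.1, u n y.2))
    (fun i => if sval i == 0%N then smap_comp f ux else smap_comp g uz) cK.
- by move=> m n a y /un /= ->; rewrite -[RHS]sfun_nat.
- by move=> i n x Kx; have [->|->] := vert1P i; rewrite ?hev0 ?hev1 /= ?uxu ?uzu.
have [||k1' [k1n k1k k1b]] := @glue_ends (cyl L) Y' (fun n y => K n y.2)
    (fun n y => hev f' g' n (y.1, k n y.2))
    (fun i => if sval i == 0%N then smap_comp f' kx' else smap_comp g' kz') cK1.
- by move=> m n a y /kn /= ->; rewrite -[RHS]sfun_nat.
- move=> i n [s x] Kx.
  by have [->|->] := vert1P i; rewrite ?hev0 ?hev1 /= ?kxk ?kzk.
have vn m n (a : Delta m n) (y : cyl L n) :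
    hev f' g' m ((sact a y).1, v m (sact a y).2) = sact a (hev f' g' n (y.1, v n y.2)).
  by rewrite [(sact a y).2]/= sfun_nat -[RHS]sfun_nat.
have [|||||up [kp [upu kp0 kp1 kpk]]] := hbe (cyl L) (fun n y => K n y.2 \/ boundary y.1)
    u1 (@SMap (cyl L) Y' _ vn) (fun n y => k1' n (y.2.1, (y.1, y.2.2))).
- by move=> m n a [s x] /= [Kx|bs]; [left; apply: cK | right; apply: boundary_comp].
- exact: u1n.
- move=> m n a [s' [s x]] h.
  by have := k1n m n a (s, (s', x)) h.
- move=> n [s x] [/= Kx|/= [i ->]].
    by rewrite k1k // u1k // k0.
  by rewrite k1b u1b; have [->|->] := vert1P i; rewrite /= ?kx0 ?kz0 ?bf ?bg.
- move=> n [s x] [/= Kx|/= [i ->]].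
    by rewrite k1k // k1.
  by rewrite k1b; have [->|->] := vert1P i; rewrite ?hpath0 ?hpath1 sact_id /= ?kx1 ?kz1.
have up_e i n (x : L n) : up n (Delta_const n i, x) =
    (if sval i == 0%N then f n (ux n x) else g n (uz n x)).
  by rewrite upu ?u1b; [case: ifP | right; exists i].
have kp_e i n (x : cyl L n) : smap_comp kp (cyl_swap L) n (Delta_const n i, x) =
    (if sval i == 0%N then f' n (kx' n x) else g' n (kz' n x)).
  by case: x => s x; rewrite /= kpk ?k1b; [case: ifP | right; exists i].
set U := hpb_mk (up_e vert0) (up_e vert1).
set V := hpb_mk (kp_e vert0) (kp_e vert1).
exists U, V; split.
- apply: hpb_eq_on => // n s x Kx.
  by rewrite hpb_mkE upu ?u1k //; left.
- suff h : forall n x, cyl_end V vert0 n x = smap_comp hpb_map U n x by [].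
  apply: hpb_eq => n.
  + by move=> x; rewrite /= kx0.
  + by move=> x; rewrite /= kz0.
  + move=> s x; rewrite [LHS]hpb_mkE [RHS]hpb_mkE /=.
    by have /= -> := kp0 n (s, x); rewrite sact_id.
- suff h : forall n x, cyl_end V vert1 n x = v n x by [].
  apply: hpb_eq => n.
  + by move=> x; rewrite /= kx1.
  + by move=> x; rewrite /= kz1.
  + by move=> s x; rewrite [LHS]hpb_mkE /=; have /= -> := kp1 n (s, x).
- move=> n s x Kx.
  apply: (@hpb_eq_on _ _ _ _ _ (cyl L) (fun n y => K n y.2)) => //.
  + by move=> m [t y] /= Ky; rewrite kxk.
  + by move=> m [t y] /= Ky; rewrite kzk.
  + by move=> m t [t' y] Ky; rewrite [LHS]hpb_mkE /= kpk ?k1k //; left.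
Qed.

End HpbMap.

(** * Connections on the interval and mapping path spaces *)

Fact dmin_le n (s t : Delta n 1) (j : vert n) : (minn (sval (s j)) (sval (t j)) <= 1)%N.
Proof. by have := vert_le (s j); lia. Qed.
Fact dmin_mono n (s t : Delta n 1) (i j : vert n) : (sval i <= sval j)%N ->
  (sval (mkv (dmin_le s t i)) <= sval (mkv (dmin_le s t j)))%N.
Proof. by move=> ij /=; have := dfun_mono s ij; have := dfun_mono t ij; lia. Qed.
(** The minimum and the maximum are the two connections of the interval. Reparametrising a path by
    them contracts it onto its start, respectively its end. *)
Definition dmin n (s t : Delta n 1) : Delta n 1 := DeltaMap (@dmin_mono n s t).

Fact dmax_le n (s t : Delta n 1) (j : vert n) : (maxn (sval (s j)) (sval (t j)) <= 1)%N.
Proof. by have := vert_le (s j); have := vert_le (t j); lia. Qed.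
Fact dmax_mono n (s t : Delta n 1) (i j : vert n) : (sval i <= sval j)%N ->
  (sval (mkv (dmax_le s t i)) <= sval (mkv (dmax_le s t j)))%N.
Proof. by move=> ij /=; have := dfun_mono s ij; have := dfun_mono t ij; lia. Qed.
Definition dmax n (s t : Delta n 1) : Delta n 1 := DeltaMap (@dmax_mono n s t).

Lemma dmin_comp m n (s t : Delta n 1) (a : Delta m n) :
  dmin (Delta_comp s a) (Delta_comp t a) = Delta_comp (dmin s t) a.
Proof. by apply: Delta_ext => j; apply: val_vert. Qed.

Lemma dmax_comp m n (s t : Delta n 1) (a : Delta m n) :
  dmax (Delta_comp s a) (Delta_comp t a) = Delta_comp (dmax s t) a.
Proof. by apply: Delta_ext => j; apply: val_vert. Qed.

Lemma dmin0 n (t : Delta n 1) : dmin (Delta_const n vert0) t = Delta_const n vert0.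
Proof. by apply: Delta_ext => j; apply: val_vert => /=; lia. Qed.

Lemma dmin1 n (t : Delta n 1) : dmin (Delta_const n vert1) t = t.
Proof. by apply: Delta_ext => j; apply: val_vert => /=; have := vert_le (t j); lia. Qed.

Lemma dmax0 n (t : Delta n 1) : dmax (Delta_const n vert0) t = t.
Proof. by apply: Delta_ext => j; apply: val_vert => /=; have := vert_le (t j); lia. Qed.

Lemma dmax1 n (t : Delta n 1) : dmax (Delta_const n vert1) t = Delta_const n vert1.
Proof. by apply: Delta_ext => j; apply: val_vert => /=; have := vert_le (t j); lia. Qed.

Lemma dminC n (s t : Delta n 1) : dmin s t = dmin t s.
Proof. by apply: Delta_ext => j; apply: val_vert => /=; lia. Qed.

Lemma dmaxC n (s t : Delta n 1) : dmax s t = dmax t s.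
Proof. by apply: Delta_ext => j; apply: val_vert => /=; lia. Qed.

Definition cyl_min (L : sSet) : smap (cyl (cyl L)) (cyl L) :=
  @SMap (cyl (cyl L)) (cyl L) (fun n y => (dmin y.1 y.2.1, y.2.2))
    (fun m n a y => congr1 (fun s => (s, sact a y.2.2)) (dmin_comp y.1 y.2.1 a)).

Definition cyl_max (L : sSet) : smap (cyl (cyl L)) (cyl L) :=
  @SMap (cyl (cyl L)) (cyl L) (fun n y => (dmax y.1 y.2.1, y.2.2))
    (fun m n a y => congr1 (fun s => (s, sact a y.2.2)) (dmax_comp y.1 y.2.1 a)).

Section PathFactorisation.
Variables (X Y : sSet) (f : smap X Y).

Definition cocyl_const : smap X (hpb_sset f (smap_id Y)) :=
  @hpb_mk _ _ _ f (smap_id Y) X (smap_id X) (cyl_fst f) f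
    (fun _ _ => erefl) (fun _ _ => erefl).

Lemma cocyl_retract : homotopic (smap_comp cocyl_const (hpb1 f (smap_id Y)))
                                (smap_id (hpb_sset f (smap_id Y))).
Proof.
set E := hpb_sset _ _.
have e0 n (x : cyl E n) : smap_comp (hev f (smap_id Y)) (cyl_min E) n
    (Delta_const n vert0, x) = f n (cyl_fst (hpb1 f (smap_id Y)) n x).
  by rewrite [LHS]/= dmin0 hpath0 sact_id.
have e1 n (x : cyl E n) : smap_comp (hev f (smap_id Y)) (cyl_min E) n
    (Delta_const n vert1, x) = smap_id Y n (hev f (smap_id Y) n x).
  by rewrite [LHS]/= dmin1.
exists (hpb_mk e0 e1) => n x.
have h0 : forall n x, cyl_end (hpb_mk e0 e1) vert0 n x =
    smap_comp cocyl_const (hpb1 f (smap_id Y)) n x.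
  apply: hpb_eq => {n x} n => [//|x|s x].
    by rewrite [RHS]/= -(hev0 x).
  by rewrite [LHS]hpb_mkE [RHS]hpb_mkE [LHS]/= dminC dmin0 hpath0 sact_id.
have h1 : forall n x, cyl_end (hpb_mk e0 e1) vert1 n x = smap_id E n x.
  apply: hpb_eq => {n x} n => [//|x|s x].
    by rewrite [LHS]/= hpath1 sact_id.
  by rewrite [LHS]hpb_mkE [LHS]/= dminC dmin1.
by split; [apply: h0 | apply: h1].
Qed.

Lemma hpb1_id_weak : weak_equiv (hpb1 f (smap_id Y)).
Proof.
exists cocyl_const; split; first exact: cocyl_retract.
suff -> : smap_comp (hpb1 f (smap_id Y)) cocyl_const = smap_id X by apply: homotopic_refl.
exact: smap_ext.
Qed.

End PathFactorisation.

Section PathFactorisation2.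
Variables (Z Y : sSet) (g : smap Z Y).

Definition cocyl_const2 : smap Z (hpb_sset (smap_id Y) g) :=
  @hpb_mk _ _ _ (smap_id Y) g Z g (cyl_fst g) (smap_id Z)
    (fun _ _ => erefl) (fun _ _ => erefl).

Lemma hpb2_id_weak : hkan Y -> hkan Z -> weak_equiv (hpb2 (smap_id Y) g).
Proof.
move=> kY kZ; set E := hpb_sset (smap_id Y) g.
have kE : hkan E by apply: hpb_hkan.
have e0 n (x : cyl E n) : smap_comp (hev (smap_id Y) g) (cyl_max E) n
    (Delta_const n vert0, x) = smap_id Y n (hev (smap_id Y) g n x).
  by rewrite [LHS]/= dmax0.
have e1 n (x : cyl E n) : smap_comp (hev (smap_id Y) g) (cyl_max E) n
    (Delta_const n vert1, x) = g n (cyl_fst (hpb2 (smap_id Y) g) n x).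
  by rewrite [LHS]/= dmax1 hpath1 sact_id.
exists cocyl_const2; split; last first.
  suff -> : smap_comp (hpb2 (smap_id Y) g) cocyl_const2 = smap_id Z.
    exact: homotopic_refl.
  exact: smap_ext.
apply: homotopic_sym => //; exists (hpb_mk e0 e1) => n x.
have h0 : forall n x, cyl_end (hpb_mk e0 e1) vert0 n x = smap_id E n x.
  apply: hpb_eq => {n x} n => [x|//|s x].
    by rewrite [LHS]/= hpath0 sact_id.
  by rewrite [LHS]hpb_mkE [LHS]/= dmaxC dmax0.
have h1 : forall n x, cyl_end (hpb_mk e0 e1) vert1 n x =
    smap_comp cocyl_const2 (hpb2 (smap_id Y) g) n x.
  apply: hpb_eq => {n x} n => [x|//|s x].
    by rewrite [RHS]/= -(hev1 x).
  by rewrite [LHS]hpb_mkE [RHS]hpb_mkE [LHS]/= dmaxC dmax1 hpath1 sact_id.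
by split; [apply: h0 | apply: h1].
Qed.

End PathFactorisation2.

Lemma hpb_mk_on (X Y Z : sSet) (f : smap X Y) (g : smap Z Y) (L : sSet)
    (K : forall n, L n -> Prop) (ux : forall n, L n -> X n)
    (up : forall n, cyl L n -> Y n) (uz : forall n, L n -> Z n)
    (junk : forall n, L n -> hpb_sset f g n) :
  closed K -> nat_on K ux -> nat_on (fun n (y : cyl L n) => K n y.2) up -> nat_on K uz ->
  (forall n x, K n x -> up n (Delta_const n vert0, x) = f n (ux n x)) ->
  (forall n x, K n x -> up n (Delta_const n vert1, x) = g n (uz n x)) ->
  exists u : forall n, L n -> hpb_sset f g n,
  [/\ nat_on K u, forall n x, K n x -> hpx (u n x) = ux n x,
      forall n x, K n x -> hpz (u n x) = uz n x &
      forall n s x, K n x -> hev f g n (s, u n x) = up n (s, x)].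
Proof.
move=> cK xn pn zn p0 p1.
pose pth n (x : L n) (h : K n x) : path_space Y n :=
  @SMap (cyl (simplex n)) Y (fun m y => up m (y.1, sact y.2 x))
    (fun m q a y => etrans (congr1 (fun t => up m (Delta_comp y.1 a, t))
       (esym (sact_comp y.2 a x))) (pn m q a (y.1, sact y.2 x) (cK _ _ y.2 x h))).
have q0 n x h m (a : Delta m n) : @pth n x h m (Delta_const m vert0, a) =
    sact a (f n (ux n x)).
  by rewrite /= p0 ?xn ?sfun_nat //; apply/cK.
have q1 n x h m (a : Delta m n) : @pth n x h m (Delta_const m vert1, a) =
    sact a (g n (uz n x)).
  by rewrite /= p1 ?zn ?sfun_nat //; apply/cK.
pose u n (x : L n) : hpb_sset f g n := if pselect (K n x) is left h then
  Hpb (q0 n x h) (q1 n x h) else junk n x.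
have uP n x : K n x -> [/\ hpx (u n x) = ux n x, hpz (u n x) = uz n x &
    forall m s (a : Delta m n), hpath (u n x) m (s, a) = up m (s, sact a x)].
  by rewrite /u; case: pselect.
exists u; split=> [m n a x Kx|n x /uP[]|n x /uP[]|n s x /uP[_ _ /= ->]] //; last first.
  by rewrite sact_id.
have [ex ez ep] := uP _ _ Kx; have [ex' ez' ep'] := uP _ _ (cK _ _ a x Kx).
apply: hpb_ext; rewrite /= ?ex ?ex' ?ez ?ez' ?xn ?zn // => q s b.
by rewrite ep' ep /= sact_comp.
Qed.

(** Dold's argument. The map f is replaced by the fibration p from its mapping path space E. A
    homotopy inverse of f yields a section s of p with s p homotopic to the identity, and this
    homotopy can be made vertical over Y; it then connects s v with any partial lift of v, and
    homotopy lifting extends the lift. *)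
Lemma weak_rel_equiv (X Y : sSet) (f : smap X Y) :
  hkan X -> hkan Y -> weak_equiv f -> rel_equiv f.
Proof.
move=> kX kY [g [[H HP] [Q QP]]].
set E := hpb_sset f (smap_id Y); set p := hpb2 f (smap_id Y) : smap E Y.
have kE : hkan E by apply: hpb_hkan.
have pfib : hfibration p by apply: hpb2_hfibration.
pose s : smap Y E := @hpb_mk _ _ _ f (smap_id Y) Y g Q (smap_id Y)
  (fun n x => (QP n x).1) (fun n x => (QP n x).2).
have d1 := cocyl_retract f; set c := cocyl_const f in d1.
set r := hpb1 f (smap_id Y) in d1.
have gf1 : homotopic (smap_comp g f) (smap_id X) by exists H.
have sf_c : homotopic (smap_comp s f) c.
  apply: (homotopic_trans kE _ (homotopic_compl c gf1)).
  exact: (homotopic_sym kE (homotopic_compr (smap_comp s f) d1)).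
have [D DP] : homotopic (smap_comp s p) (smap_id E).
  apply: (homotopic_trans kE (homotopic_sym kE (homotopic_compl (smap_comp s p) d1))).
  by apply: (homotopic_trans kE (homotopic_compr r sf_c)).
(* The homotopy D is corrected into one over Y by lifting a null homotopy. *)
have [V [V0 V1 pV]] : exists V : smap (cyl E) E,
    [/\ forall n x, V n (Delta_const n vert0, x) = s n (p n x),
        forall n x, V n (Delta_const n vert1, x) = x &
        forall n t x, p n (V n (t, x)) = p n x].
  have [|||u [un uk ub]] := @glue_ends (cyl E) E
      (fun n (y : cyl E n) => y.1 = Delta_const n vert0)
      (fun n y => s n (p n y.2.2))
      (fun i => if sval i == 0%N then smap_comp (smap_comp s p) D else D).
  - by move=> m n a [t x] /= ->; apply: Delta_const_comp.
  - by move=> m n a y _; rewrite -!sfun_nat.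
  - move=> i n [t x] /= ->; have [Dx _] := DP n x.
    by have [->|->] := vert1P i; rewrite [RHS]/= Dx.
  have [|m n a [t [t' x]] h|n [t [t' x]] h|w [pw wu]] := pfib (cyl E)
      (fun n y => boundary y.1) vert0 (fun n y => u n (y.2.1, (y.1, y.2.2)))
      (smap_comp p (@SMap (cyl (cyl E)) E (fun n y => D n (y.1, y.2.2))
         (fun m n a y => sfun_nat D a (y.1, y.2.2)))).
  - by move=> m n a y; apply: boundary_comp.
  - by have := un m n a (t', (t, x)); apply; case: h; [right | left].
  - case: h => /= [[i ->]|->]; last by rewrite uk //= (DP n x).1.
    by rewrite ub; have [->|->] := vert1P i.
  exists (cyl_end w vert1); split=> [n x|n x|n t x] /=.
  - by rewrite wu /= ?ub /= ?(DP n x).2 //; left; exists vert0.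
  - by rewrite wu /= ?ub /= ?(DP n x).2 //; left; exists vert1.
  - by have /= -> := pw n (Delta_const n vert1, (t, x)); rewrite (DP n x).2.
move=> L K u v k cK un kn k0 k1.
have [|uE [uEn ex ez ep]] := @hpb_mk_on _ _ _ f (smap_id Y) L K u k (fun n x => v n x)
    (fun n x => s n (v n x)) cK un kn _ k0 k1.
  by move=> m n a x _; rewrite sfun_nat.
have pE n x : K n x -> p n (uE n x) = v n x by apply: ez.
(* Over K the vertical homotopy V runs from the section s v to the prescribed lift; lifting the
   constant homotopy of v extends this to all of L. *)
pose u1 n (y : cyl L n) : E n := if pselect (K n y.2) then V n (y.1, uE n y.2)
  else s n (v n y.2).
have u1K n t x : K n x -> u1 n (t, x) = V n (t, uE n x) by rewrite /u1; case: pselect.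
have u10 n x : u1 n (Delta_const n vert0, x) = s n (v n x).
  by rewrite /u1 /=; case: pselect => //= Kx; rewrite V0 pE.
have [||w [pw wu]] := pfib L K vert0 u1 (cyl_fst v) cK.
- move=> m n a [t x] [/= Kx|/= ->].
    rewrite (u1K _ _ _ Kx); have /= <- := sfun_nat V a (t, uE n x).
    by rewrite u1K ?uEn //; apply: cK.
  by rewrite Delta_const_comp !u10 !sfun_nat.
- move=> n [t x] [Kx|et]; first by rewrite (u1K n t x Kx) pV pE.
  by have {et} -> : t = Delta_const n vert0 := et; rewrite u10.
pose e : smap L E := cyl_end w vert1.
have eK n x : K n x -> e n x = uE n x by move=> Kx; rewrite /= wu ?u1K ?V1 //; left.
have en m n (a : Delta m n) (y : cyl L n) :
    hev f (smap_id Y) m ((sact a y).1, e m (sact a y).2) =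
    sact a (hev f (smap_id Y) n (y.1, e n y.2)).
  by rewrite [(sact a y).2]/= sfun_nat -[RHS]sfun_nat.
exists (smap_comp r e), (@SMap (cyl L) Y _ en); split.
- by move=> n x Kx; rewrite -(ex n x Kx) -(eK n x Kx).
- by move=> n x; rewrite [LHS]hev0.
- move=> n x; rewrite [LHS]hev1.
  by have /= := pw n (Delta_const n vert1, x).
- by move=> n t x Kx; rewrite -(ep n t x Kx) -eK.
Qed.

Section HpbPointed.
Variables (X Y Z : psSet) (f : smap X Y) (g : smap Z Y).
Hypotheses (fpt : forall n, f n (pt X n) = pt Y n) (gpt : forall n, g n (pt Z n) = pt Y n).

Definition hpb_pt n : hpb_sset f g n.
Proof.
refine (@Hpb _ _ _ f g n (pt X n) (smap_pt (cyl (simplex n)) Y) (pt Z n) _ _).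
- by move=> m a /=; rewrite fpt pt_nat.
- by move=> m a /=; rewrite gpt pt_nat.
Defined.

Fact hpb_pt_nat m n (a : Delta m n) : sact a (hpb_pt n) = hpb_pt m.
Proof. by apply: hpb_ext; rewrite /= ?pt_nat. Qed.

Definition hpb_psset : psSet := PSSet hpb_pt_nat.

End HpbPointed.

Section HpbWeak.
Variables (X Y Z : psSet) (f : smap X Y) (g : smap Z Y).
Hypotheses (fpt : forall n, f n (pt X n) = pt Y n) (gpt : forall n, g n (pt Z n) = pt Y n).
Hypotheses (kX : hkan X) (kY : hkan Y) (kZ : hkan Z).

Lemma weak_equiv_hpb (X' Y' Z' : sSet) (f' : smap X' Y') (g' : smap Z' Y')
    (al : smap X X') (be : smap Y Y') (ga : smap Z Z')
    (bf : forall n x, be n (f n x) = f' n (al n x))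
    (bg : forall n x, be n (g n x) = g' n (ga n x)) :
  hkan X' -> hkan Y' -> hkan Z' -> weak_equiv al -> weak_equiv be -> weak_equiv ga ->
  weak_equiv (hpb_map bf bg).
Proof.
move=> kX' kY' kZ' hal hbe hga; apply: rel_equiv_weak.
  exact: (smap_pt _ (hpb_psset fpt gpt)).
by apply: rel_equiv_hpb; [apply: weak_rel_equiv..|move=> n; apply: (pt Y)].
Qed.

(** Replacing g by the identity of Y changes the homotopy pullback only by an equivalence, and then
    the projection to X is a deformation along the paths. *)
Lemma hpb1_weak : weak_equiv g -> weak_equiv (hpb1 f g).
Proof.
move=> hg; set m := @hpb_map _ _ _ _ _ _ f g f (smap_id Y) (smap_id X) (smap_id Y) g
  (fun _ _ => erefl) (fun _ _ => erefl).
have -> : hpb1 f g = smap_comp (hpb1 f (smap_id Y)) m by apply: smap_ext.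
apply: weak_equiv_comp => //; [exact: hpb_hkan| |exact: hpb1_id_weak].
by apply: weak_equiv_hpb => //; apply: (@weak_equiv_iso _ _ _ (smap_id _)).
Qed.

Lemma hpb2_weak : weak_equiv f -> weak_equiv (hpb2 f g).
Proof.
move=> hf; set m := @hpb_map _ _ _ _ _ _ f g (smap_id Y) g f (smap_id Y) (smap_id Z)
  (fun _ _ => erefl) (fun _ _ => erefl).
have -> : hpb2 f g = smap_comp (hpb2 (smap_id Y) g) m by apply: smap_ext.
apply: weak_equiv_comp => //; [exact: hpb_hkan| |exact: hpb2_id_weak].
by apply: weak_equiv_hpb => //; apply: (@weak_equiv_iso _ _ _ (smap_id _)).
Qed.

End HpbWeak.

Lemma hfibration_hpb_compl (C B Y Z : sSet) (q : smap C B) (p : smap B Y) (g : smap Z Y) :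
  hfibration q ->
  hfibration (@hpb_map _ _ _ _ _ _ (smap_comp p q) g p g q (smap_id Y) (smap_id Z)
    (fun _ _ => erefl) (fun _ _ => erefl)).
Proof.
move=> hq L K e u v cK un uv.
have [||wc [qwc wcu]] := hq L K e (fun n y => hpx (u n y)) (smap_comp (hpb1 p g) v) cK.
- by move=> m n a y /un ->.
- by move=> n y ry; rewrite /= -uv.
have vn m n (a : Delta m n) (y : cyl (cyl L) n) :
    hev p g m ((sact a y).1, v m (sact a y).2) = sact a (hev p g n (y.1, v n y.2)).
  by rewrite [(sact a y).2]/= sfun_nat -[RHS]sfun_nat.
have e0 n y : @SMap (cyl (cyl L)) Y _ vn n (Delta_const n vert0, y) =
    smap_comp p q n (wc n y).
  by rewrite [LHS]hev0 /= qwc.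
have e1 n y : @SMap (cyl (cyl L)) Y _ vn n (Delta_const n vert1, y) =
    g n (smap_comp (hpb2 p g) v n y).
  by rewrite [LHS]hev1.
exists (hpb_mk e0 e1); split.
- suff h : forall n y, smap_comp (@hpb_map _ _ _ _ _ _ (smap_comp p q) g p g q
    (smap_id Y) (smap_id Z) (fun _ _ => erefl) (fun _ _ => erefl)) (hpb_mk e0 e1) n y = v n y by [].
  apply: hpb_eq => n; [by move=> x; rewrite /= qwc | by [] |].
  move=> s x; rewrite [LHS]hpb_mkE.
  exact: (hpb_mkE e0 e1).
- apply: hpb_eq_on => //; first exact: region_closed.
    by move=> n y ry; rewrite [LHS]/= -uv.
  move=> n s y ry; rewrite [LHS]hpb_mkE [LHS]/= -uv //.
Qed.

(** * Strict fibres of fibrations *)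

Section StrictFibre.
Variables (F E : sSet) (B : psSet) (i : smap F E) (p : smap E B).
Hypotheses (hp : hfibration p) (kB : hkan B).
Hypothesis i_inj : forall n, injective (i n).
Hypothesis iP : forall n x, p n x = pt B n <-> exists y, i n y = x.

Let Bpt : smap sone B := smap_pt sone B.

Fact strict_fibre_subproof0 n y : smap_pt (cyl F) B n (Delta_const n vert0, y) = p n (i n y).
Proof. by symmetry; apply/iP; exists y. Qed.

Definition strict_fibre_map : smap F (hpb_sset p Bpt) :=
  @hpb_mk _ _ _ p Bpt F i (smap_pt _ B) (to_sone F) strict_fibre_subproof0 (fun _ _ => erefl).

(** A square in B is filled that is the base point on two adjacent sides and the path of v on a
    third. Lifting the remaining side along p moves v into the strict fibre, and the square is the
    accompanying homotopy of paths. *)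
Lemma strict_fibre_rel_equiv : rel_equiv strict_fibre_map.
Proof.
move=> L K u v k cK un kn k0 k1.
have vn m n (a : Delta m n) (y : cyl L n) :
    hev p Bpt m ((sact a y).1, v m (sact a y).2) = sact a (hev p Bpt n (y.1, v n y.2)).
  by rewrite [(sact a y).2]/= sfun_nat -[RHS]sfun_nat.
have [||||w [wa wb wk]] := @hkan_box B L K vert1 (smap_pt (cyl L) B)
   (fun i => if sval i == 0%N then smap_pt (cyl L) B else @SMap (cyl L) B _ vn)
   (fun n j s x => hev p Bpt n (j, k n (s, x))) kB cK.
- move=> m n c j s x Kx.
  by have /= -> := kn m n c (s, x) Kx; rewrite -[RHS]sfun_nat.
- move=> t n x; have [->|->] := vert1P t; first by [].
  by rewrite [RHS]hev1.
- by move=> n s x Kx; rewrite hev1.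
- move=> t n j x Kx; have [->|->] := vert1P t; last by rewrite k1.
  by rewrite k0 // hpb_mkE.
pose u1 n (y : cyl L n) : E n := if pselect (K n y.2) then hpx (k n y) else hpx (v n y.2).
have u1K n t x : K n x -> u1 n (t, x) = hpx (k n (t, x)) by rewrite /u1; case: pselect.
have u11 n x : u1 n (Delta_const n vert1, x) = hpx (v n x).
  by rewrite /u1 /=; case: pselect => //= Kx; rewrite k1.
have wbE t n x j : w n (j, (Delta_const n t, x)) =
    if sval t == 0%N then pt B n else hev p Bpt n (j, v n x).
  by rewrite wb; case: ifP.
have [||wx [pwx wxu]] := @hp L K vert1 u1 (cyl_end w vert0) cK.
- move=> m n a [t x] [Kx|et]; last first.
    have {et} -> : t = Delta_const n vert1 := et.
    have := u11 m (sact a x); rewrite -(Delta_const_comp vert1 a) => h.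
    by apply: (etrans h); rewrite (u11 n x) sfun_nat.
  by rewrite (u1K n t x Kx) /= u1K; [have /= -> := kn m n a (t, x) Kx | apply: cK].
- move=> n [t x] [Kx|et].
    by rewrite (u1K n t x Kx); symmetry; apply: (etrans (wk _ _ _ _ Kx)); apply: hev0.
  have {et} -> : t = Delta_const n vert1 := et.
  by rewrite u11 /= wbE /= hpath0 sact_id.
have wx0 n x : exists y, i n y = wx n (Delta_const n vert0, x).
  by apply/iP; rewrite pwx /= wbE.
pose u' n x := sval (cid (wx0 n x)).
have u'P n x : i n (u' n x) = wx n (Delta_const n vert0, x) by rewrite /u'; case: cid.
have u'n m n (a : Delta m n) x : u' m (sact a x) = sact a (u' n x).
  by apply: i_inj; rewrite sfun_nat !u'P -sfun_nat.
have e0 n (y : cyl L n) : w n (Delta_const n vert0, y) = p n (wx n y).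
  by rewrite pwx.
have e1 n (y : cyl L n) : w n (Delta_const n vert1, y) =
    Bpt n (to_sone _ n y).
  by case: y => s x /=; rewrite wa.
set U := SMap u'n; set V := @hpb_mk _ _ _ p Bpt _ wx _ _ e0 e1.
exists U, V; split.
- move=> n x Kx; apply: i_inj; rewrite u'P wxu; last by left.
  by rewrite u1K // k0.
- suff h : forall n x, cyl_end V vert0 n x = smap_comp strict_fibre_map U n x by [].
  apply: hpb_eq => n; [by move=> x; rewrite /= u'P | by [] |].
  by move=> s x; rewrite [LHS]hpb_mkE [LHS]/= wbE [RHS]hpb_mkE.
- suff h : forall n x, cyl_end V vert1 n x = v n x by [].
  apply: hpb_eq => n; [|by move=> x; case: (hpz _) => //; case: (hpz _)|].
    by move=> x; rewrite [LHS]/= wxu ?u11 //; right.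
  by move=> s x; rewrite [LHS]hpb_mkE [LHS]/= wbE.
- move=> n s x Kx.
  apply: (@hpb_eq_on _ _ _ _ _ (cyl L) (fun n y => K n y.2)) => //.
  + by move=> m m' a y; apply: cK.
  + by move=> m [t y] Ky; rewrite [LHS]/= wxu ?u1K //; left.
  + by move=> m y _; case: (hpz _); case: (hpz _).
  + by move=> m t [t' y] Ky; rewrite [LHS]hpb_mkE [LHS]/= wk.
Qed.

End StrictFibre.

(** * Homotopy pullbacks of modules *)

Section Loops.
Variable V : psSet.

Fact lev_subproof m n (a : Delta m n) (y : cyl (loops V) n) :
  sval (sact a y).2 m ((sact a y).1, Delta_id m) =
  sact a (sval y.2 n (y.1, Delta_id n)).
Proof.
case: y => s t /=; rewrite -sfun_nat /=.
by congr (sval t m (_, _)); apply: Delta_ext.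
Qed.

Definition lev : smap (cyl (loops V)) V :=
  @SMap (cyl (loops V)) V (fun n y => sval y.2 n (y.1, Delta_id n)) lev_subproof.

Lemma loopE n (t : loops V n) m s (a : Delta m n) :
  sval t m (s, a) = lev m (s, sact a t).
Proof. by rewrite /=; congr (sval t m (_, _)); apply: Delta_ext. Qed.

Lemma lev_boundary n s (t : loops V n) : boundary s -> lev n (s, t) = pt V n.
Proof. by move=> h; apply: (proj2_sig t). Qed.

Section Mk.
Variables (L : sSet) (w : smap (cyl L) V).
Hypothesis wb : forall n s x, boundary s -> w n (s, x) = pt V n.

Definition lp_mk_fun n (x : L n) : loops V n.
Proof.
exists (@SMap (cyl (simplex n)) V (fun m y => w m (y.1, sact y.2 x))
    (fun m q a y => etrans (congr1 (fun t => w m (Delta_comp y.1 a, t))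
       (esym (sact_comp y.2 a x))) (sfun_nat w a (y.1, sact y.2 x)))).
by move=> m s a bs; apply: wb.
Defined.

Lemma loops_ext n (s t : loops V n) :
  (forall m c a, sval s m (c, a) = sval t m (c, a)) -> s = t.
Proof.
by case: s t => [s hs] [t ht] /= h; apply: eq_exist; apply: smap_ext => m [c a].
Qed.

Definition lp_mk : smap L (loops V).
Proof.
refine (@SMap L (loops V) lp_mk_fun _).
by move=> m n a x; apply: loops_ext => q c b; rewrite /= sact_comp.
Defined.

Lemma lp_mkE n s x : lev n (s, lp_mk n x) = w n (s, x).
Proof. by rewrite /= sact_id. Qed.

End Mk.

Lemma lp_eq (L : sSet) (u u' : smap L (loops V)) :
  (forall n s x, lev n (s, u n x) = lev n (s, u' n x)) -> forall n x, u n x = u' n x.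
Proof.
by move=> h n x; apply: loops_ext => m c a; rewrite !loopE -!sfun_nat.
Qed.

End Loops.

Lemma hkan_retract (X Y : sSet) (i : smap X Y) (r : smap Y X) :
  (forall n x, r n (i n x) = x) -> hkan Y -> hkan X.
Proof.
move=> ri kY L K e u cK un.
have [|w wu] := kY L K e (fun n y => i n (u n y)) cK.
  by move=> m n a y /un ->; rewrite sfun_nat.
by exists (smap_comp r w) => n y ry; rewrite /= wu.
Qed.

Section LoopsHpb.
Variable V : psSet.
Let z : smap sone V := smap_pt sone V.

Fact lh_subproof n s x : boundary s -> hev z z n (s, x) = pt V n.
Proof.
by case=> i ->; have [->|->] := vert1P i; rewrite ?hev0 ?hev1.
Qed.

Definition hpb_to_loops : smap (hpb_sset z z) (loops V) := lp_mk lh_subproof.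

Definition loops_to_hpb : smap (loops V) (hpb_sset z z).
Proof.
refine (@hpb_mk _ _ _ z z (loops V) (to_sone _) (lev V) (to_sone _) _ _).
- by move=> n x; rewrite lev_boundary //; exists vert0.
- by move=> n x; rewrite lev_boundary //; exists vert1.
Defined.

Lemma hpb_to_loopsK n x : loops_to_hpb n (hpb_to_loops n x) = x.
Proof.
suff h : forall n x, smap_comp loops_to_hpb hpb_to_loops n x = smap_id _ n x by apply: h.
apply: hpb_eq => {n x} n => [x|x|s x]; [by case: (hpx _); case: (hpx _)
  |by case: (hpz _); case: (hpz _)|].
by rewrite [LHS]hpb_mkE [LHS]lp_mkE.
Qed.

Lemma loops_to_hpbK n x : hpb_to_loops n (loops_to_hpb n x) = x.
Proof.
suff h : forall n x, smap_comp hpb_to_loops loops_to_hpb n x = smap_id _ n x by apply: h.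
by apply: lp_eq => {n x} n s x; rewrite [LHS]lp_mkE [LHS]hpb_mkE.
Qed.

Lemma sone_hkan : hkan sone.
Proof.
by move=> L K e u _ _; exists (to_sone _) => n y _ /=; case: (u n y).
Qed.

Lemma loops_hkan : hkan V -> hkan (loops V).
Proof.
move=> kV; apply: (hkan_retract loops_to_hpbK).
by apply: hpb_hkan => //; apply: sone_hkan.
Qed.

End LoopsHpb.

Section LoopsMap.
Variables (V U : psSet) (f : smap V U).
Hypothesis fpt : forall n, f n (pt V n) = pt U n.

Fact loops_map_subproof n s x : boundary s -> smap_comp f (lev V) n (s, x) = pt U n.
Proof. by move=> bs; rewrite [LHS]/= -[X in f n X]/(lev V n (s, x)) lev_boundary. Qed.

Definition loops_map : smap (loops V) (loops U) := lp_mk loops_map_subproof.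

Lemma loops_mapE n s x : lev U n (s, loops_map n x) = f n (lev V n (s, x)).
Proof. by rewrite lp_mkE. Qed.

End LoopsMap.

Section LoopsOfHpb.
Variables (X Y Z : psSet) (f : smap X Y) (g : smap Z Y).
Hypotheses (fpt : forall n, f n (pt X n) = pt Y n) (gpt : forall n, g n (pt Z n) = pt Y n).

Let H := hpb_psset fpt gpt.
Let G := hpb_sset (loops_map fpt) (loops_map gpt).

Let ux : smap (cyl G) X := smap_comp (lev X)
  (@SMap (cyl G) (cyl (loops X)) (fun n y => (y.1, hpx y.2)) (fun _ _ _ _ => erefl)).
Let uz : smap (cyl G) Z := smap_comp (lev Z)
  (@SMap (cyl G) (cyl (loops Z)) (fun n y => (y.1, hpz y.2)) (fun _ _ _ _ => erefl)).
Let up : smap (cyl (cyl G)) Y := smap_comp (lev Y)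
  (@SMap (cyl (cyl G)) (cyl (loops Y)) (fun n y => (y.2.1, hev _ _ n (y.1, y.2.2)))
     (fun m n a y => congr1 (pair (Delta_comp y.2.1 a))
        (sfun_nat (hev (loops_map fpt) (loops_map gpt)) a (y.1, y.2.2)))).

Fact loops_hpb0 n x : up n (Delta_const n vert0, x) = f n (ux n x).
Proof.
by case: x => s x; rewrite [LHS]/= hpath0 sact_id; have /= -> := loops_mapE fpt s (hpx x).
Qed.

Fact loops_hpb1 n x : up n (Delta_const n vert1, x) = g n (uz n x).
Proof.
by case: x => s x; rewrite [LHS]/= hpath1 sact_id; have /= -> := loops_mapE gpt s (hpz x).
Qed.

Fact loops_hpb_bd n s x : boundary s -> hpb_mk loops_hpb0 loops_hpb1 n (s, x) = pt H n.
Proof.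
move=> bs; apply: hpb_ext; [exact: lev_boundary..|].
move=> m c a; rewrite hpathE [RHS]/=.
rewrite -sfun_nat hpb_mkE; apply: lev_boundary; exact: boundary_comp.
Qed.

(** The exchange of the loop parameter with the path parameter. It is an isomorphism with inverse
    [hpb_loops]. *)
Definition loops_hpb : smap G (loops H) :=
  @lp_mk H G (hpb_mk loops_hpb0 loops_hpb1) loops_hpb_bd.

Let L := loops H.
Let wx : smap L (loops X).
Proof.
refine (@lp_mk X L (smap_comp (hpb1 f g) (lev H)) _).
by move=> n s x bs; have /= -> := lev_boundary x bs.
Defined.
Let wz : smap L (loops Z).
Proof.
refine (@lp_mk Z L (smap_comp (hpb2 f g) (lev H)) _).
by move=> n s x bs; have /= -> := lev_boundary x bs.
Defined.
Let wp : smap (cyl L) (loops Y).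
Proof.
refine (@lp_mk Y (cyl L) (smap_comp (hev f g)
  (@SMap (cyl (cyl L)) (cyl H) (fun n y => (y.2.1, lev H n (y.1, y.2.2)))
     (fun m n a y => congr1 (pair (Delta_comp y.2.1 a))
        (sfun_nat (lev H) a (y.1, y.2.2))))) _).
by move=> n s [j x] bs; have /= -> := lev_boundary x bs.
Defined.

Fact hpb_loops0 n x : wp n (Delta_const n vert0, x) = loops_map fpt n (wx n x).
Proof.
suff h : forall n x, cyl_end wp vert0 n x = smap_comp (loops_map fpt) wx n x by apply: h.
apply: lp_eq => {n x} n s x; rewrite [LHS]lp_mkE [RHS]loops_mapE lp_mkE.
exact: (@hev0 _ _ _ f g n (lev H n (s, x))).
Qed.

Fact hpb_loops1 n x : wp n (Delta_const n vert1, x) = loops_map gpt n (wz n x).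
Proof.
suff h : forall n x, cyl_end wp vert1 n x = smap_comp (loops_map gpt) wz n x by apply: h.
apply: lp_eq => {n x} n s x; rewrite [LHS]lp_mkE [RHS]loops_mapE lp_mkE.
exact: (@hev1 _ _ _ f g n (lev H n (s, x))).
Qed.

Definition hpb_loops : smap L G := hpb_mk hpb_loops0 hpb_loops1.

Lemma loops_hpbK n x : hpb_loops n (loops_hpb n x) = x.
Proof.
suff h : forall n x, smap_comp hpb_loops loops_hpb n x = smap_id _ n x by apply: h.
apply: hpb_eq => {n x} n.
- suff h : forall n x, smap_comp wx loops_hpb n x = hpb1 _ _ n x by apply: h.
  apply: lp_eq => {}n s x; rewrite [LHS]lp_mkE.
  exact: (congr1 (@hpx _ _ _ f g n) (@lp_mkE H G _ loops_hpb_bd n s x)).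
- suff h : forall n x, smap_comp wz loops_hpb n x = hpb2 _ _ n x by apply: h.
  apply: lp_eq => {}n s x; rewrite [LHS]lp_mkE.
  exact: (congr1 (@hpz _ _ _ f g n) (@lp_mkE H G _ loops_hpb_bd n s x)).
- move=> j x; rewrite [LHS]hpb_mkE.
  suff h : forall n y, smap_comp wp (@SMap (cyl G) (cyl L) (fun n y => (y.1, loops_hpb n y.2))
      (fun m n a y => congr1 (pair (Delta_comp y.1 a)) (sfun_nat loops_hpb a y.2))) n y =
      hev _ _ n y.
    by have := h n (j, x).
  apply: lp_eq => {j x} {}n s [j x]; rewrite [LHS]lp_mkE.
  apply: etrans (hpb_mkE loops_hpb0 loops_hpb1 j (s, x)).
  exact: (congr1 (fun t => hev f g n (j, t)) (@lp_mkE H G _ loops_hpb_bd n s x)).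
Qed.

Lemma hpb_loopsK n x : loops_hpb n (hpb_loops n x) = x.
Proof.
suff h : forall n x, smap_comp loops_hpb hpb_loops n x = smap_id _ n x by apply: h.
apply: lp_eq => {n x} n s x; rewrite [LHS]lp_mkE.
have cn m q (a : Delta m q) (y : cyl L q) :
    hpb_mk loops_hpb0 loops_hpb1 m ((sact a y).1, hpb_loops m (sact a y).2) =
    sact a (hpb_mk loops_hpb0 loops_hpb1 q (y.1, hpb_loops q y.2)).
  by rewrite [(sact a y).2]/= (sfun_nat hpb_loops) -[RHS]sfun_nat.
suff h : forall n y, @SMap (cyl L) H _ cn n y = lev H n y by apply: (h n (s, x)).
apply: hpb_eq => {s x} {}n.
- by move=> [s x]; apply: (lp_mkE _ s x).
- by move=> [s x]; apply: (lp_mkE _ s x).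
- move=> j [s x]; apply: (etrans (hpb_mkE loops_hpb0 loops_hpb1 j (s, hpb_loops n x))).
  have e := hpb_mkE hpb_loops0 hpb_loops1 j x.
  apply: etrans (congr1 (fun t => lev Y n (s, t)) e) _.
  by rewrite [LHS]lp_mkE.
Qed.

Lemma loops_hpb_weak : weak_equiv loops_hpb.
Proof. exact: weak_equiv_iso loops_hpbK hpb_loopsK. Qed.

End LoopsOfHpb.

(** * The zero module and adjoint structure maps *)

Section Zero.
Variable R : E1ring.

Definition zero_psset : psSet := @PSSet sone (fun=> tt) (fun _ _ _ => erefl).

Definition zero_symseq : symseq :=
  @SymSeq (fun=> zero_psset) (fun _ _ _ _ => smap_id sone) (fun _ _ _ _ _ => erefl)
    (fun _ _ _ _ => erefl) (fun _ _ _ _ _ _ _ _ _ _ => erefl).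

Definition zero_act : pairing R zero_symseq zero_symseq :=
  @Pairing R zero_symseq zero_symseq (fun _ _ _ _ _ => tt) (fun _ _ _ _ _ _ _ => erefl)
    (fun _ _ _ _ => erefl) (fun _ _ _ _ => erefl) (fun _ _ _ _ _ _ _ _ _ _ _ => erefl).

Fact unit_eq (x y : unit) : x = y.
Proof. by case: x; case: y. Qed.

Fact zero_fibrant : fibrant (fun B n s x => zero_act funit B n (runit R (fun=> s)) x).
Proof.
have kz : hkan zero_psset by apply: sone_hkan.
split=> [A|B]; first by apply: (@hkan_kan sone) => // n; apply: tt.
exists (@lp_mk zero_psset sone (to_sone _) (fun _ _ _ _ => erefl)); split; last first.
  by move=> n x m s a; apply: unit_eq.
apply: (@weak_equiv_iso _ _ _ (to_sone _)) => [n x|n y]; first exact: unit_eq.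
by apply: loops_ext => m c a; apply: unit_eq.
Qed.

Definition zero_module : module R :=
  @Module R zero_symseq zero_act (fun _ _ _ _ _ _ _ => unit_eq _ _)
    (fun _ _ _ _ => unit_eq _ _) zero_fibrant.

Definition to_zero (M : module R) : mmap M zero_module :=
  @MMap R M zero_module (fun A => to_sone (M A)) (fun _ _ => erefl)
    (fun _ _ _ _ _ _ => erefl) (fun _ _ _ _ _ => erefl).

Definition from_zero (M : module R) : mmap zero_module M :=
  @MMap R zero_module M (fun A => smap_pt sone (M A)) (fun _ _ => erefl)
    (fun A B f ef n x => esym (bact_pt M ef n))
    (fun A B n r x => esym (pprod_ptr (mact M) B r)).

End Zero.

Section Adjoint.
Variable R : E1ring.

Definition is_adjoint (M : module R) B (t : smap (M B) (loops (M (fsum funit B)))) :=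
  forall n (x : M B n) m (s : Delta m 1) (a : Delta m n), sval (t n x) m (s, a) =
    mact M funit B m (runit R (fun=> s)) (sact a x).

Lemma adjoint_lev (M : module R) B (t : smap (M B) (loops (M (fsum funit B)))) n s (x : M B n) :
  is_adjoint t -> lev _ n (s, t n x) = mact M funit B n (runit R (fun=> s)) x.
Proof. by move=> ft; rewrite /= ft sact_id. Qed.

Lemma adjoint_map (M N : module R) (h : mmap M N) B
    (t : smap (M B) (loops (M (fsum funit B)))) (t' : smap (N B) (loops (N (fsum funit B)))) :
  is_adjoint t -> is_adjoint t' -> forall n x,
  t' n (h B n x) = loops_map (mfun_pt h (fsum funit B)) n (t n x).
Proof.
move=> ft ft'.
suff e : forall n x, smap_comp t' (h B) n x =
    smap_comp (loops_map (mfun_pt h (fsum funit B))) t n x by exact: e.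
apply: lp_eq => n s x.
rewrite [LHS](adjoint_lev _ _ ft') [RHS]loops_mapE (adjoint_lev _ _ ft).
by rewrite mfun_act.
Qed.

Lemma module_hkan (M : module R) A : hkan (M A).
Proof. by apply: kan_hkan; have [h _] := mfibrant M. Qed.

Lemma module_adjoint (M : module R) B :
  exists t : smap (M B) (loops (M (fsum funit B))), weak_equiv t /\ is_adjoint t.
Proof. by have [_ /(_ B)] := mfibrant M. Qed.

End Adjoint.

(** * Module structure on homotopy pullbacks *)

Section HpbModule.
Variables (R : E1ring) (X Y Z : module R) (f : mmap X Y) (g : mmap Z Y).

Let lv (A : Defs.finset) : psSet :=
  hpb_psset (mfun_pt f A) (mfun_pt g A).

Definition hpb_bact (A B : Defs.finset) (h : A -> B) (eh : bijective h) : smap (lv A) (lv B) :=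
  @hpb_map _ _ _ _ _ _ (f A) (g A) (f B) (g B) (bact X eh) (bact Y eh) (bact Z eh)
    (fun n x => esym (mfun_bact f eh x)) (fun n x => esym (mfun_bact g eh x)).

Definition hpb_symseq : symseq.
Proof.
refine (@SymSeq lv hpb_bact _ _ _).
- move=> A B h eh n; apply: hpb_ext; rewrite /= ?bact_pt // => m c a.
  by rewrite /= bact_pt.
- move=> A e n x; apply: hpb_ext; rewrite /= ?bact_id // => m c a.
  by rewrite /= bact_id; congr (hpath x m (_, _)); apply: Delta_ext.
- move=> A B C h k eh ek ekh n x; apply: hpb_ext; rewrite /= ?bact_comp // => m c a.
  by rewrite (bact_comp eh ek ekh).
Defined.

Definition hpb_act_path (A B : Defs.finset) n (r : R A n) (t : lv B n) :
  path_space (Y (fsum A B)) n.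
Proof.
refine (@SMap (cyl (simplex n)) (Y (fsum A B))
     (fun m y => mact Y A B m (sact y.2 r) (hpath t m y)) _).
by move=> m q a y; rewrite sfun_nat /= -sact_comp pprod_nat.
Defined.

Definition hpb_act_fun (A B : Defs.finset) n (r : R A n) (t : lv B n) : lv (fsum A B) n.
Proof.
refine (@Hpb _ _ _ (f (fsum A B)) (g (fsum A B)) n (mact X A B n r (hpx t))
  (hpb_act_path r t) (mact Z A B n r (hpz t)) _ _).
- by move=> m a /=; rewrite hpath0 pprod_nat mfun_act.
- by move=> m a /=; rewrite hpath1 pprod_nat mfun_act.
Defined.

Definition hpb_act : pairing R hpb_symseq hpb_symseq.
Proof.
refine (@Pairing R hpb_symseq hpb_symseq hpb_act_fun _ _ _ _).
- move=> A B m n a r t; apply: hpb_ext; rewrite /= ?pprod_nat // => q c b.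
  by rewrite /= sact_comp.
- move=> A B n t; apply: hpb_ext; rewrite /= ?pprod_ptl // => m c a.
  by rewrite /= pt_nat pprod_ptl.
- move=> A B n r; apply: hpb_ext; rewrite /= ?pprod_ptr // => m c a.
  by rewrite /= pprod_ptr.
- move=> A A' B B' h k eh ek n r t; apply: hpb_ext; rewrite /= ?pprod_bact // => m c a.
  by rewrite /= -(sfun_nat (bact R eh)) pprod_bact Delta_comp1.
Defined.

Lemma hpb_lv_hkan A : hkan (lv A).
Proof. by apply: hpb_hkan; apply: module_hkan. Qed.

(** Loops commute with homotopy pullbacks, so the adjoint structure maps of X, Y and Z induce the
    one of the pullback, and it is an equivalence because they are. *)
Fact hpb_fibrant : fibrant (fun B n s x => hpb_act funit B n (runit R (fun=> s)) x).
Proof.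
split=> [A|B].
  apply: (@hkan_kan (lv A)) => [n|]; [exact: pt|exact: hpb_lv_hkan].
have [tx [wx fx]] := module_adjoint X B.
have [ty [wy fy]] := module_adjoint Y B.
have [tz [wz fz]] := module_adjoint Z B.
have ef := adjoint_map f fx fy; have eg := adjoint_map g fz fy.
exists (smap_comp (loops_hpb _ _) (hpb_map ef eg)); split.
  apply: weak_equiv_comp => //.
  - exact: hpb_lv_hkan.
  - by apply: loops_hkan; apply: hpb_lv_hkan.
  - apply: (@weak_equiv_hpb (X B) (Y B) (Z B)) => //; try exact: module_hkan;
      try exact: mfun_pt; try (apply: loops_hkan; exact: module_hkan).
  - exact: loops_hpb_weak.
move=> n x m s a.
have E : lev (hpb_symseq (fsum funit B)) m (s, smap_comp (loops_hpb _ _) (hpb_map ef eg) m (sact a x)) =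
    hpb_act_fun (runit R (fun=> s)) (sact a x).
  rewrite [LHS](@lp_mkE (lv (fsum funit B))).
  apply: hpb_ext.
  - by apply: (etrans _ (adjoint_lev s _ fx)).
  - by apply: (etrans _ (adjoint_lev s _ fz)).
  - move=> q c b; rewrite hpathE -sfun_nat hpb_mkE.
    apply: etrans (adjoint_lev (Delta_comp s b) (hev _ _ q (c, sact b (sact a x))) fy) _.
    by rewrite /= -runit_nat Delta_comp1.
by rewrite -[RHS]E loopE -sfun_nat.
Qed.

Definition hpb_module : module R.
Proof.
refine (@Module R hpb_symseq hpb_act _ _ hpb_fibrant).
- move=> A B C n r s t; apply: hpb_ext; rewrite /= ?mactA // => m c a.
  by rewrite /= !Delta_comp1 -pprod_nat mactA.
- move=> A n s t; apply: hpb_ext; rewrite /= ?mact1 // => m c a.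
  by rewrite /= !Delta_comp1 -runit_nat mact1.
Defined.

Definition mhpb1 : mmap hpb_module X :=
  @MMap R hpb_module X (fun A => hpb1 (f A) (g A)) (fun _ _ => erefl)
    (fun _ _ _ _ _ _ => erefl) (fun _ _ _ _ _ => erefl).

Definition mhpb2 : mmap hpb_module Z :=
  @MMap R hpb_module Z (fun A => hpb2 (f A) (g A)) (fun _ _ => erefl)
    (fun _ _ _ _ _ _ => erefl) (fun _ _ _ _ _ => erefl).

Lemma mhpb1_equiv : level_equiv g -> level_equiv mhpb1.
Proof.
by move=> hg A; apply: (@hpb1_weak (X A) (Y A) (Z A)) => //; try exact: mfun_pt;
  exact: module_hkan.
Qed.

Lemma mhpb2_equiv : level_equiv f -> level_equiv mhpb2.
Proof.
by move=> hf A; apply: (@hpb2_weak (X A) (Y A) (Z A)) => //; try exact: mfun_pt;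
  exact: module_hkan.
Qed.

Lemma mhpb2_kan A : kan_fibration (mhpb2 A).
Proof.
apply: hfibration_kan; first by move=> n; apply: (pt (hpb_module A)).
by apply: hpb2_hfibration; apply: module_hkan.
Qed.

End HpbModule.

Section ModuleMapsHpb.
Variables (R : E1ring).

Section Mk.
Variables (L X Y Z : module R) (f : mmap X Y) (g : mmap Z Y).
Variables (a : mmap L X) (b : mmap L Z) (p : forall A, smap (cyl (L A)) (Y A)).
Hypothesis p0 : forall A n x, p A n (Delta_const n vert0, x) = f A n (a A n x).
Hypothesis p1 : forall A n x, p A n (Delta_const n vert1, x) = g A n (b A n x).
Hypothesis ppt : forall A n s, p A n (s, pt (L A) n) = pt (Y A) n.
Hypothesis pbact : forall (A B : Defs.finset) (h : A -> B) (eh : bijective h) n s x,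
  p B n (s, bact L eh n x) = bact Y eh n (p A n (s, x)).
Hypothesis pact : forall A B n s (r : R A n) x,
  p (fsum A B) n (s, mact L A B n r x) = mact Y A B n r (p B n (s, x)).

Definition mhpb_mk : mmap L (hpb_module f g).
Proof.
refine (@MMap R L (hpb_module f g) (fun A => hpb_mk (@p0 A) (@p1 A)) _ _ _).
- move=> A n; apply: hpb_ext; rewrite /= ?mfun_pt // => m c d.
  by rewrite /= pt_nat ppt.
- move=> A B h eh n x; apply: hpb_ext; rewrite /= ?mfun_bact // => m c d.
  by rewrite /= -sfun_nat pbact Delta_comp1.
- move=> A B n r x; apply: hpb_ext; rewrite /= ?mfun_act // => m c d.
  by rewrite /= -pprod_nat pact.
Defined.

End Mk.

Definition mhpb_const (L X Y Z : module R) (f : mmap X Y) (g : mmap Z Y)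
  (a : mmap L X) (b : mmap L Z)
  (e : forall A n x, f A n (a A n x) = g A n (b A n x)) : mmap L (hpb_module f g).
Proof.
refine (@mhpb_mk L X Y Z f g a b (fun A => cyl_fst (smap_comp (f A) (a A))) _ _ _ _ _).
- by [].
- by move=> A n x; rewrite -e.
- by move=> A n s; rewrite /= !mfun_pt.
- by move=> A B h eh n s x; rewrite /= !mfun_bact.
- by move=> A B n s r x; rewrite /= !mfun_act.
Defined.

Section Map.
Variables (X Y Z X' Y' Z' : module R) (f : mmap X Y) (g : mmap Z Y).
Variables (f' : mmap X' Y') (g' : mmap Z' Y').
Variables (al : mmap X X') (be : mmap Y Y') (ga : mmap Z Z').
Hypothesis bf : forall A n x, be A n (f A n x) = f' A n (al A n x).
Hypothesis bg : forall A n x, be A n (g A n x) = g' A n (ga A n x).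

Definition mhpb_map : mmap (hpb_module f g) (hpb_module f' g').
Proof.
refine (@MMap R (hpb_module f g) (hpb_module f' g')
  (fun A => hpb_map (@bf A) (@bg A)) _ _ _).
- by move=> A n; apply: hpb_ext; rewrite /= ?mfun_pt // => m c d; rewrite /= mfun_pt.
- by move=> A B h eh n x; apply: hpb_ext; rewrite /= ?mfun_bact // => m c d;
    rewrite /= mfun_bact !Delta_comp1.
- move=> A B n r x; apply: hpb_ext; rewrite /= ?mfun_act // => m c d.
  by rewrite /= !Delta_comp1 mfun_act.
Defined.

Lemma mhpb_map_equiv : level_equiv al -> level_equiv be -> level_equiv ga ->
  level_equiv mhpb_map.
Proof.
move=> ha hb hg A; apply: (@weak_equiv_hpb (X A) (Y A) (Z A)) => //;
  by [exact: mfun_pt | exact: module_hkan].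
Qed.

End Map.

Lemma level_equiv_id (M : module R) : level_equiv (mmap_id M).
Proof. by move=> A; apply: (@weak_equiv_iso _ _ _ (smap_id _)). Qed.

Lemma level_equiv_comp (M N P : module R) (f : mmap M N) (g : mmap N P) :
  level_equiv f -> level_equiv g -> level_equiv (mmap_comp g f).
Proof.
by move=> hf hg A; apply: weak_equiv_comp; [apply: module_hkan..|apply: hf|apply: hg].
Qed.

Lemma level_equiv_section (M N : module R) (r : mmap M N) (j : mmap N M) :
  (forall A n x, r A n (j A n x) = x) -> level_equiv r -> level_equiv j.
Proof.
by move=> rj hr A; apply: (weak_equiv_section (@module_hkan R M A) (@rj A)).
Qed.

Lemma mmap_ext (M N : module R) (f g : mmap M N) :
  (forall A n x, f A n x = g A n x) -> f = g.
Proof.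
move=> fg; case: f g fg => [f f1 f2 f3] [g g1 g2 g3] /= fg.
have e : f = g by apply: functional_extensionality_dep => A; apply: smap_ext; apply: fg.
by subst; congr MMap; apply: Prop_irrelevance.
Qed.

End ModuleMapsHpb.

(** * The shift of a module and the adjoint structure map *)

Section Shift.
Variable R : E1ring.

Lemma bij_id (A : Type) : bijective (@id A).
Proof. by exists id. Qed.

Lemma bact_congr (M : symseq) (A B : Defs.finset) (h k : A -> B) (eh : bijective h)
  (ek : bijective k) n x : h =1 k -> bact M eh n x = bact M ek n x.
Proof.
by move=> /funext e; move: ek; case: _ / e => ek; rewrite (Prop_irrelevance eh ek).
Qed.

Lemma bactC (M : symseq) (A B C : Defs.finset) (h : A -> B) (k : B -> C)
  (eh : bijective h) (ek : bijective k) n x :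
  bact M ek n (bact M eh n x) = bact M (bij_comp ek eh) n x.
Proof. exact: bact_comp. Qed.

Definition sh_perm (A B : Defs.finset) (x : fsum A (fsum funit B)) :
  fsum funit (fsum A B) :=
  match x with
  | inl a => inr (inl a)
  | inr (inl u) => inl u
  | inr (inr b) => inr (inr b)
  end.

Lemma sh_perm_bij A B : bijective (@sh_perm A B).
Proof.
exists (fun x : fsum funit (fsum A B) => match x with
  | inl u => inr (inl u)
  | inr (inl a) => inl a
  | inr (inr b) => inr (inr b)
  end : fsum A (fsum funit B)); by [case=> [|[]] | case=> [|[]]].
Qed.

Variable M : module R.

Lemma mact_bactl (A A' B : Defs.finset) (h : A -> A') (eh : bijective h) n (r : R A n)
    (x : M B n) :
  mact M A' B n (bact R eh n r) x = bact M (fmap_bij eh (bij_id B)) n (mact M A B n r x).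
Proof. by rewrite -pprod_bact bact_id. Qed.

Definition sh_symseq : symseq.
Proof.
refine (@SymSeq (fun B => M (fsum funit B))
  (fun A B h eh => bact M (fmap_bij (bij_id funit) eh)) _ _ _).
- by move=> A B h eh n; rewrite bact_pt.
- move=> A e n x; rewrite -[RHS](bact_id (bij_id _)).
  by apply: bact_congr; case.
- move=> A B C h k eh ek ekh n x; rewrite bactC.
  by apply: bact_congr; case.
Defined.

Definition sh_act : pairing R sh_symseq sh_symseq.
Proof.
refine (@Pairing R sh_symseq sh_symseq
  (fun A B n r x => bact M (sh_perm_bij A B) n (mact M A (fsum funit B) n r x)) _ _ _ _).
- by move=> A B m n a r x; rewrite pprod_nat sfun_nat.
- by move=> A B n x; rewrite pprod_ptl bact_pt.
- by move=> A B n r; rewrite pprod_ptr bact_pt.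
- move=> A A' B B' h k eh ek n r x; rewrite /= pprod_bact !bactC.
  by apply: bact_congr; case=> [|[]].
Defined.

Fact sh_fibrant : fibrant (fun B n s x => sh_act funit B n (runit R (fun=> s)) x).
Proof.
split=> [A|B]; first by have [h _] := mfibrant M; apply: h.
have [t [wt ft]] := module_adjoint M (fsum funit B).
pose pm := bact M (sh_perm_bij funit B).
have [q qpm pmq] := sh_perm_bij funit B.
have bq : bijective q by exists (@sh_perm funit B).
have lK n x : loops_map (@bact_pt M _ _ _ bq) n (loops_map (@bact_pt M _ _ _ (sh_perm_bij funit B)) n x) = x.
  suff e : forall n x, smap_comp (loops_map (@bact_pt M _ _ _ bq)) (loops_map (@bact_pt M _ _ _ (sh_perm_bij funit B))) n x = smap_id _ n x by apply: e.
  apply: lp_eq => {n x} n s x; rewrite [LHS]loops_mapE loops_mapE bactC -[RHS](bact_id (bij_id _)).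
  by apply: bact_congr => y; apply: qpm.
have lK' n x : loops_map (@bact_pt M _ _ _ (sh_perm_bij funit B)) n (loops_map (@bact_pt M _ _ _ bq) n x) = x.
  suff e : forall n x, smap_comp (loops_map (@bact_pt M _ _ _ (sh_perm_bij funit B))) (loops_map (@bact_pt M _ _ _ bq)) n x = smap_id _ n x by apply: e.
  apply: lp_eq => {n x} n s x; rewrite [LHS]loops_mapE loops_mapE bactC -[RHS](bact_id (bij_id _)).
  by apply: bact_congr => y; apply: pmq.
exists (smap_comp (loops_map (@bact_pt M _ _ _ (sh_perm_bij funit B))) t); split.
  apply: weak_equiv_comp => //; [exact: module_hkan| |exact: weak_equiv_iso lK lK'].
  by apply: loops_hkan; apply: module_hkan.
move=> n x m s a; rewrite loopE -sfun_nat [LHS]loops_mapE.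
by rewrite (adjoint_lev _ _ ft).
Qed.

(** The shift B |-> M(1 + B) models the suspension of M, by [sigma_equiv]. As R acts from the left,
    the action has to move the added point in front of A, which is the role of [sh_perm]. *)
Definition sh_module : module R.
Proof.
refine (@Module R sh_symseq sh_act _ _ sh_fibrant).
- move=> A B C n r s x /=.
  rewrite -{2}(bact_id (bij_id A) r) pprod_bact -mactA !bactC.
  by apply: bact_congr; case=> [[]|[]].
- move=> A n s x; rewrite /= bactC -[RHS](mact1 s); apply: bact_congr.
  by case=> [[]|[]].
Defined.

End Shift.

Definition sh_map (R : E1ring) (M N : module R) (f : mmap M N) :
  mmap (sh_module M) (sh_module N).
Proof.
refine (@MMap R (sh_module M) (sh_module N) (fun A => f (fsum funit A)) _ _ _).
- exact: (fun A n => mfun_pt f (fsum funit A) n).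
- exact: (fun A B h eh n x => mfun_bact f (fmap_bij (bij_id funit) eh) x).
- by move=> A B n r x; rewrite /= mfun_bact mfun_act.
Defined.

Definition loopm (R : E1ring) (M : module R) : module R :=
  hpb_module (from_zero M) (from_zero M).

Definition loopm_map (R : E1ring) (M N : module R) (f : mmap M N) :
  mmap (loopm M) (loopm N) :=
  @mhpb_map R _ _ _ _ _ _ (from_zero M) (from_zero M) (from_zero N) (from_zero N)
    (mmap_id _) f (mmap_id _) (fun A n _ => mfun_pt f A n) (fun A n _ => mfun_pt f A n).

Section Sigma.
Variables (R : E1ring) (M : module R).

Fact sigma_nat A m n (a : Delta m n) (y : cyl (M A) n) :
  mact M funit A m (runit R (fun=> (sact a y).1)) (sact a y).2 =
  sact a (mact M funit A n (runit R (fun=> y.1)) y.2).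
Proof. by rewrite -pprod_nat -runit_nat. Qed.

Definition sigma_path A : smap (cyl (M A)) (sh_module M A) :=
  @SMap (cyl (M A)) (M (fsum funit A)) _ (@sigma_nat A).

(** The adjoint structure map from M to the loops of its shift. It is linear because the unit of R
    is central, so that the circle coordinate can be moved past r. *)
Definition sigma : mmap M (loopm (sh_module M)).
Proof.
refine (@mhpb_mk R M _ (sh_module M) _ (from_zero _) (from_zero _) (to_zero M) (to_zero M)
  sigma_path _ _ _ _ _).
- move=> A n x; rewrite /= runit_pt ?pprod_ptl //.
  by exists tt; exists vert0.
- move=> A n x; rewrite /= runit_pt ?pprod_ptl //.
  by exists tt; exists vert1.
- by move=> A n s; rewrite /= pprod_ptr.
- move=> A B h eh n s x; rewrite /=.
  by rewrite -pprod_bact; congr (mact M _ _ _ _ _); rewrite bact_id.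
- move=> A B n s r x; rewrite /= -[LHS]mactA -(mactA r) -runit_central mact_bactl.
  by rewrite !bactC; apply: bact_congr; case=> [[]|].
Defined.

(** This is the stable fibrancy of M, with loops rewritten as a homotopy pullback of points. *)
Lemma sigma_equiv : level_equiv sigma.
Proof.
move=> A; have [t [wt ft]] := module_adjoint M A.
have -> : sigma A = smap_comp (loops_to_hpb (M (fsum funit A))) t.
  apply: smap_ext; apply: hpb_eq => n; [by move=> x; apply: unit_eq..|].
  by move=> s x; rewrite [LHS]hpb_mkE [RHS]hpb_mkE (adjoint_lev _ _ ft).
apply: weak_equiv_comp => //; first exact: module_hkan.
  by apply: (@module_hkan R (loopm (sh_module M))).
exact: weak_equiv_iso (@loops_to_hpbK _) (@hpb_to_loopsK _).
Qed.

End Sigma.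

Lemma sigma_map (R : E1ring) (M N : module R) (f : mmap M N) A n x :
  sigma N A n (f A n x) = loopm_map (sh_map f) A n (sigma M A n x).
Proof.
suff e : forall n x, smap_comp (sigma N A) (f A) n x =
    smap_comp (loopm_map (sh_map f) A) (sigma M A) n x by apply: e.
apply: hpb_eq => {n x} n; [by move=> x; apply: unit_eq..|].
by move=> s x; rewrite [LHS]hpb_mkE [RHS]hpb_mkE /= sact_id mfun_act.
Qed.

Lemma sh_map_equiv (R : E1ring) (M N : module R) (f : mmap M N) :
  level_equiv f -> level_equiv (sh_map f).
Proof. by move=> hf A; apply: hf. Qed.

Section ShLoop.
Variables (R : E1ring) (M : module R).

Definition sh_loop : mmap (sh_module (loopm M)) (loopm (sh_module M)).
Proof.
refine (@MMap R (sh_module (loopm M)) (loopm (sh_module M))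
  (fun A => smap_id (loopm M (fsum funit A))) _ _ _).
- by move=> A n; apply: hpb_ext.
- by move=> A B h eh n x; apply: hpb_ext => // m c a; rewrite /= !Delta_comp1.
- by move=> A B n r x; apply: hpb_ext => // m c a; rewrite /= !Delta_comp1.
Defined.

Lemma sh_loop_equiv : level_equiv sh_loop.
Proof. by move=> A; apply: (@weak_equiv_iso _ _ _ (smap_id _)). Qed.

End ShLoop.

(** * Fractions of strict maps *)

Section Homotopy.
Variables (R : E1ring).
Implicit Types X Y Z V : module R.

Lemma mmap_compA X Y Z V (h : mmap Z V) (g : mmap Y Z) (f : mmap X Y) :
  mmap_comp h (mmap_comp g f) = mmap_comp (mmap_comp h g) f.
Proof. exact: mmap_ext. Qed.

Lemma mmap_comp1l X Y (f : mmap X Y) : mmap_comp (mmap_id Y) f = f.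
Proof. exact: mmap_ext. Qed.

Lemma mmap_comp1r X Y (f : mmap X Y) : mmap_comp f (mmap_id X) = f.
Proof. exact: mmap_ext. Qed.

Definition pathm Y : module R := hpb_module (mmap_id Y) (mmap_id Y).
Definition ev0 Y : mmap (pathm Y) Y := mhpb1 (mmap_id Y) (mmap_id Y).
Definition ev1 Y : mmap (pathm Y) Y := mhpb2 (mmap_id Y) (mmap_id Y).
Definition pathm_const Y : mmap Y (pathm Y) :=
  @mhpb_const R Y Y Y Y (mmap_id Y) (mmap_id Y) (mmap_id Y) (mmap_id Y) (fun _ _ _ => erefl).

Definition pathm_map Y Y' (g : mmap Y Y') : mmap (pathm Y) (pathm Y') :=
  @mhpb_map R _ _ _ _ _ _ (mmap_id Y) (mmap_id Y) (mmap_id Y') (mmap_id Y') g g g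
    (fun _ _ _ => erefl) (fun _ _ _ => erefl).

(** Horn fillers are not linear, so homotopies through [pathm] cannot be reversed or composed by
    filling; hence the equivalence relation that they generate. *)
Inductive htp X Y (f : mmap X Y) : mmap X Y -> Prop :=
| htp_refl : htp f f
| htp_fwd (h : mmap X (pathm Y)) : htp f (mmap_comp (ev0 Y) h) -> htp f (mmap_comp (ev1 Y) h)
| htp_bwd (h : mmap X (pathm Y)) : htp f (mmap_comp (ev1 Y) h) -> htp f (mmap_comp (ev0 Y) h).

Lemma htp_trans X Y (f g h : mmap X Y) : htp f g -> htp g h -> htp f h.
Proof. by move=> fg; elim=> [//|k _ /htp_fwd|k _ /htp_bwd]. Qed.

Lemma htp_sym X Y (f g : mmap X Y) : htp f g -> htp g f.
Proof.
elim=> [|h _ IH|h _ IH]; first exact: htp_refl.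
- exact: htp_trans (htp_bwd (htp_refl _)) IH.
- exact: htp_trans (htp_fwd (htp_refl _)) IH.
Qed.

Lemma htp_step X Y (h : mmap X (pathm Y)) : htp (mmap_comp (ev0 Y) h) (mmap_comp (ev1 Y) h).
Proof. exact: htp_fwd (htp_refl _). Qed.

Lemma htp_compr V X Y (f g : mmap X Y) (v : mmap V X) :
  htp f g -> htp (mmap_comp f v) (mmap_comp g v).
Proof.
elim=> [|h _ IH|h _ IH]; [exact: htp_refl|..].
- by rewrite -mmap_compA; apply: htp_fwd; rewrite mmap_compA.
- by rewrite -mmap_compA; apply: htp_bwd; rewrite mmap_compA.
Qed.

Lemma ev0_map Y Y' (g : mmap Y Y') :
  mmap_comp (ev0 Y') (pathm_map g) = mmap_comp g (ev0 Y).
Proof. exact: mmap_ext. Qed.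

Lemma ev1_map Y Y' (g : mmap Y Y') :
  mmap_comp (ev1 Y') (pathm_map g) = mmap_comp g (ev1 Y).
Proof. exact: mmap_ext. Qed.

Lemma htp_compl X Y Y' (f g : mmap X Y) (k : mmap Y Y') :
  htp f g -> htp (mmap_comp k f) (mmap_comp k g).
Proof.
elim=> [|h _|h _]; first exact: htp_refl.
- by rewrite !mmap_compA -ev0_map -ev1_map -!mmap_compA => /htp_fwd.
- by rewrite !mmap_compA -ev0_map -ev1_map -!mmap_compA => /htp_bwd.
Qed.

Lemma htp_hpb X Y Z (f : mmap X Y) (g : mmap Z Y) :
  htp (mmap_comp f (mhpb1 f g)) (mmap_comp g (mhpb2 f g)).
Proof.
have := htp_step (@mhpb_map R _ _ _ _ _ _ f g (mmap_id Y) (mmap_id Y) f (mmap_id Y) g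
   (fun _ _ _ => erefl) (fun _ _ _ => erefl)).
set u := mmap_comp (ev0 Y) _; set v := mmap_comp (ev1 Y) _.
have -> : u = mmap_comp f (mhpb1 f g) by apply: mmap_ext.
by have -> : v = mmap_comp g (mhpb2 f g) by apply: mmap_ext.
Qed.

(* A generalised path object: unlike honest path objects these can be
   concatenated without filling horns. *)
Definition gpo Y (C : module R) (e0 e1 : mmap C Y) (c : mmap Y C) :=
  [/\ level_equiv e0, level_equiv e1, mmap_comp e0 c = mmap_id Y &
      mmap_comp e1 c = mmap_id Y].

Lemma mmap_appE X Y Z (g : mmap Y Z) (f : mmap X Y) h A n x :
  mmap_comp g f = h -> g A n (f A n x) = h A n x.
Proof. by move<-. Qed.

Lemma pathm_gpo Y : gpo (ev0 Y) (ev1 Y) (pathm_const Y).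
Proof.
by split; [apply: mhpb1_equiv|apply: mhpb2_equiv|apply: mmap_ext|apply: mmap_ext];
  try exact: level_equiv_id.
Qed.

Lemma gpo_comp Y C e0 e1 c C' e0' e1' c' :
  @gpo Y C e0 e1 c -> @gpo Y C' e0' e1' c' ->
  exists k, gpo (mmap_comp e0 (mhpb1 e1 e0')) (mmap_comp e1' (mhpb2 e1 e0')) k.
Proof.
move=> [he0 he1 ec0 ec1] [he0' he1' ec0' ec1'].
exists (@mhpb_const R Y C Y C' e1 e0' c c' (fun A n x =>
   etrans (mmap_appE x ec1) (esym (mmap_appE x ec0')))); split.
- by apply: level_equiv_comp => //; apply: mhpb1_equiv.
- by apply: level_equiv_comp => //; apply: mhpb2_equiv.
- by apply: etrans ec0; apply: mmap_ext.
- by apply: etrans ec1'; apply: mmap_ext.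
Qed.

Lemma gpo_sym Y C e0 e1 c : @gpo Y C e0 e1 c -> gpo e1 e0 c.
Proof. by case=> *; split. Qed.

(** Path objects compose as homotopy pullbacks, and consecutive steps of a zigzag agree strictly
    where they meet; so the whole zigzag becomes one map into one generalised path object. *)
Lemma htp_gpo X Y (f g : mmap X Y) : htp f g ->
  exists C (e0 e1 : mmap C Y) c (h : mmap X C),
    [/\ gpo e0 e1 c, mmap_comp e0 h = f & mmap_comp e1 h = g].
Proof.
have step C (e0 e1 : mmap C Y) c (h : mmap X C) C' (e0' e1' : mmap C' Y) c' (h' : mmap X C') :
    gpo e0 e1 c -> gpo e0' e1' c' -> mmap_comp e1 h = mmap_comp e0' h' ->
    exists C'' (e0'' e1'' : mmap C'' Y) c'' (h'' : mmap X C''),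
    [/\ gpo e0'' e1'' c'', mmap_comp e0'' h'' = mmap_comp e0 h &
       mmap_comp e1'' h'' = mmap_comp e1' h'].
  move=> hC hC' e; have [k hk] := gpo_comp hC hC'.
  exists _, (mmap_comp e0 (mhpb1 e1 e0')), (mmap_comp e1' (mhpb2 e1 e0')), k,
    (@mhpb_const R X C Y C' e1 e0' h h' (fun A n x =>
     congr1 (fun m : mmap X Y => m A n x) e)); split; first exact: hk.
  - exact: mmap_ext.
  - exact: mmap_ext.
elim=> [|h _ [C [e0 [e1 [c [k [hC e0k e1k]]]]]]|h _ [C [e0 [e1 [c [k [hC e0k e1k]]]]]]].
- exists Y, (mmap_id Y), (mmap_id Y), (mmap_id Y), f.
  split; rewrite ?mmap_comp1l //; split; rewrite ?mmap_comp1l //; exact: level_equiv_id.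
- have [C' [e0' [e1' [c' [h' [hC' E0 E1]]]]]] := step _ _ _ _ _ _ _ _ _ h hC (pathm_gpo Y) e1k.
  by exists C', e0', e1', c', h'; split; rewrite // E0.
- have [C' [e0' [e1' [c' [h' [hC' E0 E1]]]]]] :=
    step _ _ _ _ _ _ _ _ _ h hC (gpo_sym (pathm_gpo Y)) e1k.
  by exists C', e0', e1', c', h'; split; rewrite // E0.
Qed.

(** Both maps are the components of one map z into the homotopy pullback of e with itself. Its
    diagonal d is an equivalence, being a section of a projection that is one, and after pulling
    back along d the two components become homotopic. *)
Lemma htp_of_equiv0 V X Y (e : mmap X Y) (x y : mmap V X) :
  level_equiv e -> mmap_comp e x = mmap_comp e y ->
  exists U (v : mmap U V), level_equiv v /\ htp (mmap_comp x v) (mmap_comp y v).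
Proof.
move=> he exy.
pose z := @mhpb_const R V X Y X e e x y (fun A n t => congr1 (fun m : mmap V Y => m A n t) exy).
pose d := @mhpb_const R X X Y X e e (mmap_id X) (mmap_id X) (fun _ _ _ => erefl).
have hd : level_equiv d.
  by apply: (level_equiv_section (r := mhpb1 e e)) => //; apply: mhpb1_equiv.
exists _, (mhpb1 z d); split; first exact: mhpb1_equiv.
have H := htp_hpb z d.
have H1 := htp_compl (mhpb1 e e) H; have H2 := htp_compl (mhpb2 e e) H.
have -> : mmap_comp x (mhpb1 z d) = mmap_comp (mhpb1 e e) (mmap_comp z (mhpb1 z d)).
  exact: mmap_ext.
have -> : mmap_comp y (mhpb1 z d) = mmap_comp (mhpb2 e e) (mmap_comp z (mhpb1 z d)).
  exact: mmap_ext.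
apply: (htp_trans H1); apply: htp_sym.
have -> // : mmap_comp (mhpb1 e e) (mmap_comp d (mhpb2 z d)) =
  mmap_comp (mhpb2 e e) (mmap_comp d (mhpb2 z d)) by apply: mmap_ext.
Qed.

(** Points of D are pairs of points of X whose images are joined through C, and d0 and d1 take the
    two points. The constant map s a and the given k agree under the equivalence d0, so they become
    homotopic by [htp_of_equiv0]; d1 sends them to a and b. *)
Lemma htp_of_equiv V X Y (g : mmap X Y) (a b : mmap V X) :
  level_equiv g -> htp (mmap_comp g a) (mmap_comp g b) ->
  exists U (v : mmap U V), level_equiv v /\ htp (mmap_comp a v) (mmap_comp b v).
Proof.
move=> hg /htp_gpo[C [e0 [e1 [c [h [[he0 he1 ec0 ec1] e0h e1h]]]]]].
pose C1 := hpb_module g e0; pose q : mmap C1 Y := mmap_comp e1 (mhpb2 g e0).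
pose D := hpb_module q g.
pose d0 : mmap D X := mmap_comp (mhpb1 g e0) (mhpb1 q g).
pose d1 : mmap D X := mhpb2 q g.
have hd0 : level_equiv d0 by apply: level_equiv_comp; apply: mhpb1_equiv.
pose lift V (a b : mmap V X) (h : mmap V C) (ea : mmap_comp e0 h = mmap_comp g a)
    (eb : mmap_comp e1 h = mmap_comp g b) : mmap V D :=
  @mhpb_const R V C1 Y X q g
    (@mhpb_const R V X Y C g e0 a h (fun A n t => congr1 (fun m : mmap V Y => m A n t) (esym ea)))
    b (fun A n t => congr1 (fun m : mmap V Y => m A n t) eb).
have s0 : mmap_comp e0 (mmap_comp c g) = mmap_comp g (mmap_id X).
  by rewrite mmap_compA ec0 mmap_comp1l mmap_comp1r.
have s1 : mmap_comp e1 (mmap_comp c g) = mmap_comp g (mmap_id X).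
  by rewrite mmap_compA ec1 mmap_comp1l mmap_comp1r.
pose s := lift X (mmap_id X) (mmap_id X) _ s0 s1.
pose k := lift V a b h e0h e1h.
have [|U [v [hv H]]] := htp_of_equiv0 (x := mmap_comp s a) (y := k) hd0.
  exact: mmap_ext.
exists U, v; split=> //.
have := htp_compl d1 H.
set m1 := mmap_comp d1 _; set m2 := mmap_comp d1 _.
have -> : m1 = mmap_comp a v by apply: mmap_ext.
by have -> : m2 = mmap_comp b v by apply: mmap_ext.
Qed.

End Homotopy.

(** * Classes of spans out of a fixed module *)

Section Spans.
Variables (R : E1ring) (A : module R).

Record span Y := Span {
  sV : module R;
  sw : mmap sV A;
  sf : mmap sV Y;
  swP : level_equiv sw }.

Definition span_eq Y (s t : span Y) : Prop :=
  exists V (v1 : mmap V (sV s)) (v2 : mmap V (sV t)),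
  [/\ level_equiv v1, level_equiv v2, htp (mmap_comp (sw s) v1) (mmap_comp (sw t) v2) &
      htp (mmap_comp (sf s) v1) (mmap_comp (sf t) v2)].

Lemma span_eq_refl Y (s : span Y) : span_eq s s.
Proof.
exists _, (mmap_id _), (mmap_id _); split; [exact: level_equiv_id..|exact: htp_refl|].
exact: htp_refl.
Qed.

Lemma span_eq_sym Y (s t : span Y) : span_eq s t -> span_eq t s.
Proof.
by case=> V [v1 [v2 [h1 h2 h3 h4]]]; exists V, v2, v1; split=> //; apply: htp_sym.
Qed.

Lemma span_eq_trans Y (s t u : span Y) : span_eq s t -> span_eq t u -> span_eq s u.
Proof.
case=> V [v1 [v2 [h1 h2 h3 h4]]] [V' [v1' [v2' [h1' h2' h3' h4']]]].
exists _, (mmap_comp v1 (mhpb1 v2 v1')), (mmap_comp v2' (mhpb2 v2 v1')); split.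
- by apply: level_equiv_comp => //; apply: mhpb1_equiv.
- by apply: level_equiv_comp => //; apply: mhpb2_equiv.
- rewrite !mmap_compA; apply: htp_trans (htp_compr _ h3) _.
  apply: htp_trans _ (htp_compr _ h3'); rewrite -!mmap_compA.
  exact: htp_compl (htp_hpb _ _).
- rewrite !mmap_compA; apply: htp_trans (htp_compr _ h4) _.
  apply: htp_trans _ (htp_compr _ h4'); rewrite -!mmap_compA.
  exact: htp_compl (htp_hpb _ _).
Qed.

Definition span_comp Y Y' (g : mmap Y Y') (s : span Y) : span Y' :=
  @Span Y' (sV s) (sw s) (mmap_comp g (sf s)) (@swP Y s).

Lemma span_comp_eq Y Y' (g : mmap Y Y') (s t : span Y) :
  span_eq s t -> span_eq (span_comp g s) (span_comp g t).
Proof.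
case=> V [v1 [v2 [h1 h2 h3 h4]]]; exists V, v1, v2; split=> //=.
by rewrite -!mmap_compA; apply: htp_compl.
Qed.

Definition qspan Y := {P : span Y -> Prop | exists s, P = span_eq s}.

Definition qcl Y (s : span Y) : qspan Y := exist _ (span_eq s) (ex_intro _ s erefl).

Lemma qclP Y (s t : span Y) : qcl s = qcl t <-> span_eq s t.
Proof.
split=> [/(congr1 sval) /= ->|st]; first exact: span_eq_refl.
apply: eq_exist; apply: funext => u; apply: propext; split.
- by apply: span_eq_trans; apply: span_eq_sym.
- exact: span_eq_trans.
Qed.

Lemma qspanE Y (q : qspan Y) : exists s, q = qcl s.
Proof. by case: q => P [s e]; exists s; apply: eq_exist. Qed.

Definition qrep Y (q : qspan Y) : span Y := sval (cid (qspanE q)).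

Lemma qrepK Y (q : qspan Y) : qcl (qrep q) = q.
Proof. by rewrite /qrep; case: cid. Qed.

Definition qmap Y Y' (g : mmap Y Y') (q : qspan Y) : qspan Y' :=
  qcl (span_comp g (qrep q)).

Lemma qmapE Y Y' (g : mmap Y Y') s : qmap g (qcl s) = qcl (span_comp g s).
Proof. by apply/qclP/span_comp_eq/qclP; rewrite qrepK. Qed.

Definition set_cat : category :=
  @Category Type (fun S T => S -> T) (fun S => id) (fun S T U g f => g \o f)
    (fun _ _ _ _ _ _ _ => erefl) (fun _ _ _ => erefl) (fun _ _ _ => erefl).

Fact qmap_id Y : qmap (mmap_id Y) = id.
Proof.
apply: funext => q; have [s ->] := qspanE q; rewrite qmapE; congr qcl.
by case: s => V w f hw; rewrite /span_comp /= mmap_comp1l.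
Qed.

Fact qmap_comp Y Y' Y'' (g : mmap Y' Y'') (f : mmap Y Y') :
  qmap (mmap_comp g f) = qmap g \o qmap f.
Proof.
apply: funext => q; have [s ->] := qspanE q; rewrite /= !qmapE; congr qcl.
by case: s => V w k hw; rewrite /span_comp /= mmap_compA.
Qed.

(** The functor that A should represent in the localisation. As it inverts equivalences, it factors
    through [hhom], and localised maps can be told apart by their action on spans. *)
Definition qfunctor : mfunctor R set_cat :=
  @MFunctor R set_cat (fun Y => qspan Y : Type) (fun Y Y' g => qmap g) qmap_id qmap_comp.

(** A span is lifted by pulling it back along g; that the lift is unique is [htp_of_equiv]. *)
Lemma qmap_equiv Y Y' (g : mmap Y Y') : level_equiv g ->
  cinvertible (C := set_cat) (X := qspan Y) (Y := qspan Y') (qmap g).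
Proof.
move=> hg.
have surj (q' : qspan Y') : exists q, qmap g q = q'.
  have [s ->] := qspanE q'.
  have hs := mhpb1_equiv (sf s) hg.
  exists (qcl (@Span Y _ (mmap_comp (sw s) (mhpb1 (sf s) g)) (mhpb2 (sf s) g)
     (level_equiv_comp hs (@swP _ s)))).
  rewrite qmapE; apply/qclP; exists _, (mmap_id _), (mhpb1 (sf s) g); split=> //=.
  - exact: level_equiv_id.
  - by rewrite mmap_comp1r; apply: htp_refl.
  - by rewrite mmap_comp1r; apply: htp_sym; apply: htp_hpb.
have inj (q1 q2 : qspan Y) : qmap g q1 = qmap g q2 -> q1 = q2.
  have [s ->] := qspanE q1; have [t ->] := qspanE q2; rewrite !qmapE => /qclP.
  case=> V [v1 [v2 [h1 h2 h3 /=]]]; rewrite -!mmap_compA.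
  case/(htp_of_equiv hg) => U [v [hv H]].
  apply/qclP; exists U, (mmap_comp v1 v), (mmap_comp v2 v).
  by split; rewrite ?mmap_compA //; [apply: level_equiv_comp..|apply: htp_compr].
exists (fun q' => sval (cid (surj q'))); split; apply: funext => q /=; last by case: cid.
by apply: inj; case: cid.
Qed.

End Spans.

(** * Consequences of the universal property of the homotopy category *)

Section Localisation.
Import GRing.Theory.
Local Open Scope ring_scope.
Variables (R : E1ring) (H : hocat R).
Implicit Types X Y Z V : module R.

(** Maps with equal localisation act equally on classes of spans; evaluated at the span of two
    identities this is a homotopy after an equivalence. *)
Lemma hloc_eq_htp X Y (f g : mmap X Y) : hloc H f = hloc H g ->
  exists V (v : mmap V X), level_equiv v /\ htp (mmap_comp f v) (mmap_comp g v).
Proof.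
move=> fg; have [Phi [[_ _ hPhi] _]] := @hloc_univ R H set_cat (qfunctor X) (@qmap_equiv R X).
have fgQ : qmap f = qmap g :> (qspan X X -> qspan X Y).
  by rewrite -[qmap f]hPhi -[qmap g]hPhi fg.
pose s0 := @Span R X X X (mmap_id X) (mmap_id X) (@level_equiv_id R X).
have := congr1 (fun q => q (qcl s0)) fgQ; rewrite !qmapE => /qclP.
case=> V [v1 [v2 [h1 h2 /=]]]; rewrite !mmap_comp1l !mmap_comp1r => h12 h.
exists V, v1; split=> //; apply: (htp_trans h).
by apply: htp_compl; apply: htp_sym.
Qed.

Local Notation "g ** f" := (hcomp g f) (at level 40, left associativity).
Local Notation loc := (hloc H).

Lemma htp_hloc X Y (f g : mmap X Y) : htp f g -> loc f = loc g.
Proof.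
have e01 : loc (ev0 Y) = loc (ev1 Y).
  have [he0 _ e0c e1c] := pathm_gpo Y.
  have [k [k1 k2]] := hloc_equiv H he0.
  have kc : k = loc (pathm_const Y).
    by rewrite -[RHS]hcomp1l -k1 -hcompA -hloc_comp e0c hloc_id hcomp1r.
  by rewrite -[RHS]hcomp1r -k1 kc hcompA -hloc_comp e1c hloc_id hcomp1l.
by elim=> // h _ ->; rewrite !hloc_comp e01.
Qed.

Definition is_fraction X Y (phi : hhom H X Y) : Prop :=
  exists V (w : mmap V X) (g : mmap V Y), level_equiv w /\ phi ** loc w = loc g.

Lemma is_fraction_comp X Y Z (psi : hhom H Y Z) (phi : hhom H X Y) :
  is_fraction psi -> is_fraction phi -> is_fraction (psi ** phi).
Proof.
case=> V [w [g [hw e]]] [V' [w' [g' [hw' e']]]].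
exists _, (mmap_comp w' (mhpb1 g' w)), (mmap_comp g (mhpb2 g' w)); split.
  by apply: level_equiv_comp => //; apply: mhpb1_equiv.
rewrite hloc_comp -hcompA (hcompA phi) e' -hloc_comp (htp_hloc (htp_hpb g' w)).
by rewrite !hloc_comp !hcompA e.
Qed.

Lemma is_fraction_loc X Y (f : mmap X Y) : is_fraction (loc f).
Proof.
by exists X, (mmap_id X), f; rewrite hloc_id hcomp1r; split=> //; apply: level_equiv_id.
Qed.

Lemma is_fraction_id X : is_fraction (hid H X).
Proof. by rewrite -hloc_id; apply: is_fraction_loc. Qed.

Definition frac_cat : category.
Proof.
refine (@Category (module R) (fun X Y => {phi : hhom H X Y | is_fraction phi})
  (fun X => exist _ _ (is_fraction_id X))
  (fun X Y Z g f => exist _ _ (is_fraction_comp (proj2_sig g) (proj2_sig f))) _ _ _).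
- by move=> X Y Z W [h hh] [g hg] [f hf]; apply: eq_exist; apply: hcompA.
- by move=> X Y [f hf]; apply: eq_exist; apply: hcomp1l.
- by move=> X Y [f hf]; apply: eq_exist; apply: hcomp1r.
Defined.

Definition hcat : category :=
  @Category (module R) (hhom H) (hid H) (fun X Y Z g f => g ** f)
    (fun X Y Z W h g f => hcompA h g f) (fun X Y f => hcomp1l f) (fun X Y f => hcomp1r f).

Definition frac_functor : mfunctor R frac_cat.
Proof.
refine (@MFunctor R frac_cat id (fun X Y f => exist _ (loc f) (is_fraction_loc f)) _ _).
- by move=> X; apply: eq_exist; apply: hloc_id.
- by move=> X Y Z g f; apply: eq_exist; apply: hloc_comp.
Defined.

Definition loc_functor : mfunctor R hcat :=
  @MFunctor R hcat id (fun X Y f => loc f) (hloc_id H) (fun X Y Z g f => hloc_comp H g f).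

(** Fractions form a subcategory that contains the localised maps and the inverses of localised
    equivalences. The universal property gives a functor from [hhom] to it, and uniqueness for the
    localisation itself makes this functor followed by the inclusion the identity. *)
Lemma fraction X Y (phi : hhom H X Y) : is_fraction phi.
Proof.
have [|Phi [[Phi1 Phi2 Phi3] _]] := @hloc_univ R H frac_cat frac_functor.
  move=> M N f hf; have [k [k1 k2]] := hloc_equiv H hf.
  have hk : is_fraction k.
    by exists M, f, (mmap_id M); rewrite hloc_id.
  by exists (exist _ k hk); split; apply: eq_exist.
have [|Psi [_ Psi_uniq]] := @hloc_univ R H hcat loc_functor.
  by move=> M N f hf; apply: (hloc_equiv H hf).
have e1 : Psi = (fun M N f => f) by apply: Psi_uniq; split.
have e2 : Psi = (fun M N f => sval (Phi M N f)).
  apply: Psi_uniq; split=> [M|M N P g f|M N f].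
  - by rewrite Phi1.
  - by rewrite Phi2.
  - by rewrite Phi3.
have -> : phi = sval (Phi X Y phi) by rewrite -[RHS](congr1 (fun F => F X Y phi) e2) e1.
by case: (Phi X Y phi).
Qed.

Lemma fraction_inv X Y (phi : hhom H X Y) : exists V (w : mmap V X) (g : mmap V Y)
  (k : hhom H X V), [/\ level_equiv w, k ** loc w = hid H V, loc w ** k = hid H X &
    phi = loc g ** k].
Proof.
have [V [w [g [hw e]]]] := fraction phi; have [k [k1 k2]] := hloc_equiv H hw.
by exists V, w, g, k; split; rewrite // -e -hcompA k2 hcomp1r.
Qed.

(** Every map is a localised map times the inverse of one, so naturality against strict maps
    propagates to all maps. *)
Lemma natural_frac (F G : module R -> module R)
    (Fm : forall X Y, hhom H X Y -> hhom H (F X) (F Y))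
    (Gm : forall X Y, hhom H X Y -> hhom H (G X) (G Y))
    (eta : forall X, hhom H (F X) (G X)) :
  (forall X, Fm X X (hid H X) = hid H (F X)) ->
  (forall X Y Z g f, Fm X Z (g ** f) = Fm Y Z g ** Fm X Y f) ->
  (forall X, Gm X X (hid H X) = hid H (G X)) ->
  (forall X Y Z g f, Gm X Z (g ** f) = Gm Y Z g ** Gm X Y f) ->
  (forall X Y (f : mmap X Y), eta Y ** Fm X Y (loc f) = Gm X Y (loc f) ** eta X) ->
  forall X Y (f : hhom H X Y), eta Y ** Fm X Y f = Gm X Y f ** eta X.
Proof.
move=> F1 FM G1 GM nat X Y phi; have [V [w [g [k [hw kw wk ->]]]]] := fraction_inv phi.
rewrite FM GM hcompA nat -!hcompA; congr (_ ** _).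
rewrite -[LHS]hcomp1l -G1 -kw GM -!hcompA; congr (_ ** _).
by rewrite hcompA -nat -hcompA -FM wk F1 hcomp1r.
Qed.

Lemma hhom_zero_unique X (f g : hhom H X (zero_module R)) : f = g.
Proof.
have t_uniq (f0 : hhom H X (zero_module R)) : f0 = loc (to_zero X).
  have [V [w [h [k [hw kw wk ->]]]]] := fraction_inv f0.
  have -> : h = mmap_comp (to_zero X) w by apply: mmap_ext => A n x; apply: unit_eq.
  by rewrite hloc_comp -hcompA wk hcomp1r.
by rewrite (t_uniq f) (t_uniq g).
Qed.

Lemma hid_zero_module : hid H (zero_module R) = 0.
Proof. exact: hhom_zero_unique. Qed.

Lemma hcomp0l X Y Z (f : hhom H X Y) : (0 : hhom H Y Z) ** f = 0.
Proof. by apply: (addrI (0 ** f)); rewrite -hcompDl !addr0. Qed.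

Lemma hcomp0r X Y Z (g : hhom H Y Z) : g ** (0 : hhom H X Y) = 0.
Proof. by apply: (addrI (g ** 0)); rewrite -hcompDr !addr0. Qed.

Lemma hcompNl X Y Z (g : hhom H Y Z) (f : hhom H X Y) : (- g) ** f = - (g ** f).
Proof. by apply/eqP; rewrite -addr_eq0 -hcompDl addNr hcomp0l. Qed.

Lemma hcompNr X Y Z (g : hhom H Y Z) (f : hhom H X Y) : g ** (- f) = - (g ** f).
Proof. by apply/eqP; rewrite -addr_eq0 -hcompDr addNr hcomp0r. Qed.

Lemma hcompBl X Y Z (g g' : hhom H Y Z) (f : hhom H X Y) : (g - g') ** f = g ** f - g' ** f.
Proof. by rewrite hcompDl hcompNl. Qed.

Lemma hcompBr X Y Z (g : hhom H Y Z) (f f' : hhom H X Y) : g ** (f - f') = g ** f - g ** f'.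
Proof. by rewrite hcompDr hcompNr. Qed.

Lemma loc_factor_zero X Y (f : mmap X Y) :
  (forall A n x, f A n x = pt (Y A) n) -> loc f = 0.
Proof.
move=> hf; have -> : f = mmap_comp (from_zero Y) (to_zero X) by apply: mmap_ext.
rewrite hloc_comp -[loc (to_zero X)]hcomp1l hid_zero_module hcomp0l.
exact: hcomp0r.
Qed.

End Localisation.

(** * Homotopy fibres and their rotation *)

Section Pasting.
Variables (Z E Y T : sSet) (g : smap Z E) (f : smap E Y) (h : smap T Y).
Let P := hpb_sset g (smap_id E).
Let G := hpb_sset (smap_comp f (hpb2 g (smap_id E))) h.
Let TL := hpb_sset g (hpb1 f h).

Definition pasteL_in : smap G (hpb_sset f h) :=
  @hpb_map _ _ _ _ _ _ (smap_comp f (hpb2 g (smap_id E))) h f h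
    (hpb2 g (smap_id E)) (smap_id Y) (smap_id T) (fun _ _ => erefl) (fun _ _ => erefl).

Definition pasteL_path : smap (cyl G) E := @SMap (cyl G) E
  (fun n y => hev g (smap_id E) n (y.1, hpx y.2))
  (fun m n a y => sfun_nat (hev g (smap_id E)) a (y.1, hpx y.2)).

Definition pasteL : smap G TL :=
  @hpb_mk _ _ _ g (hpb1 f h) G (smap_comp (hpb1 g (smap_id E)) (hpb1 _ _)) pasteL_path
    pasteL_in (fun n x => hev0 (hpx x)) (fun n x => hev1 (hpx x)).

Definition pasteL_inv1 : smap TL P :=
  @hpb_mk _ _ _ g (smap_id E) TL (hpb1 _ _) (hev g (hpb1 f h))
    (smap_comp (hpb1 f h) (hpb2 _ _)) (@hev0 _ _ _ _ _) (@hev1 _ _ _ _ _).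

Definition pasteL_inv2 : smap (cyl TL) Y := @SMap (cyl TL) Y
  (fun n y => hev f h n (y.1, hpz y.2))
  (fun m n a y => sfun_nat (hev f h) a (y.1, hpz y.2)).

Definition pasteL_inv : smap TL G :=
  @hpb_mk _ _ _ (smap_comp f (hpb2 g (smap_id E))) h TL pasteL_inv1 pasteL_inv2
    (smap_comp (hpb2 f h) (hpb2 _ _)) (fun n x => hev0 (hpz x)) (fun n x => hev1 (hpz x)).

Lemma pasteLK1 n x : smap_comp pasteL_inv1 pasteL n x = hpb1 _ _ n x.
Proof.
by move: n x; apply: hpb_eq => n x // y; rewrite [LHS]hpb_mkE [LHS]hpb_mkE.
Qed.

Lemma pasteLK2 n x : smap_comp pasteL_in pasteL_inv n x = hpb2 _ _ n x.
Proof.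
by move: n x; apply: hpb_eq => n x // y; rewrite [LHS]hpb_mkE [LHS]hpb_mkE.
Qed.

(** The pasting law, here even an isomorphism: on both sides a simplex consists of points of Z, E
    and T, a path in E from the first to the second and a path in Y from the second to the third. *)
Lemma pasteL_weak : weak_equiv pasteL.
Proof.
have k1 : forall n x, smap_comp pasteL_inv pasteL n x = smap_id _ n x.
  by apply: hpb_eq => n x //; apply: pasteLK1.
have k2 : forall n x, smap_comp pasteL pasteL_inv n x = smap_id _ n x.
  by apply: hpb_eq => n x //; apply: pasteLK2.
exact: (@weak_equiv_iso _ _ pasteL pasteL_inv k1 k2).
Qed.

End Pasting.

Section PastingR.
Variables (Z E Y T : sSet) (g : smap Z E) (f : smap E Y) (h : smap T Y).
Let P := hpb_sset (smap_id E) g.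
Let G := hpb_sset h (smap_comp f (hpb1 (smap_id E) g)).
Let TR := hpb_sset (hpb2 h f) g.

Definition pasteR_in : smap G (hpb_sset h f) :=
  @hpb_map _ _ _ _ _ _ h (smap_comp f (hpb1 (smap_id E) g)) h f
    (smap_id T) (smap_id Y) (hpb1 (smap_id E) g) (fun _ _ => erefl) (fun _ _ => erefl).

Definition pasteR_path : smap (cyl G) E := @SMap (cyl G) E
  (fun n y => hev (smap_id E) g n (y.1, hpz y.2))
  (fun m n a y => sfun_nat (hev (smap_id E) g) a (y.1, hpz y.2)).

Definition pasteR : smap G TR :=
  @hpb_mk _ _ _ (hpb2 h f) g G pasteR_in pasteR_path
    (smap_comp (hpb2 (smap_id E) g) (hpb2 _ _)) (fun n x => hev0 (hpz x)) (fun n x => hev1 (hpz x)).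

Definition pasteR_inv1 : smap TR P :=
  @hpb_mk _ _ _ (smap_id E) g TR (smap_comp (hpb2 h f) (hpb1 _ _)) (hev (hpb2 h f) g)
    (hpb2 _ _) (@hev0 _ _ _ _ _) (@hev1 _ _ _ _ _).

Definition pasteR_inv2 : smap (cyl TR) Y := @SMap (cyl TR) Y
  (fun n y => hev h f n (y.1, hpx y.2))
  (fun m n a y => sfun_nat (hev h f) a (y.1, hpx y.2)).

Definition pasteR_inv : smap TR G :=
  @hpb_mk _ _ _ h (smap_comp f (hpb1 (smap_id E) g)) TR (smap_comp (hpb1 h f) (hpb1 _ _))
    pasteR_inv2 pasteR_inv1 (fun n x => hev0 (hpx x)) (fun n x => hev1 (hpx x)).

Lemma pasteRK1 n x : smap_comp pasteR_inv1 pasteR n x = hpb2 _ _ n x.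
Proof.
by move: n x; apply: hpb_eq => n x // y; rewrite [LHS]hpb_mkE [LHS]hpb_mkE.
Qed.

Lemma pasteRK2 n x : smap_comp pasteR_in pasteR_inv n x = hpb1 _ _ n x.
Proof.
by move: n x; apply: hpb_eq => n x // y; rewrite [LHS]hpb_mkE [LHS]hpb_mkE.
Qed.

Lemma pasteR_weak : weak_equiv pasteR.
Proof.
have k1 : forall n x, smap_comp pasteR_inv pasteR n x = smap_id _ n x.
  by apply: hpb_eq => n x //; apply: pasteRK1.
have k2 : forall n x, smap_comp pasteR pasteR_inv n x = smap_id _ n x.
  by apply: hpb_eq => n x //; apply: pasteRK2.
exact: (@weak_equiv_iso _ _ pasteR pasteR_inv k1 k2).
Qed.

End PastingR.

Section FibreTheories.
Variables (R : E1ring).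
Implicit Types X Y Z V : module R.

(* The two homotopy fibres of a map, {(x, f x ~ pt)} and {(x, pt ~ f x)}, share
   the following structure.  Rotating a triangle exchanges them; keeping both
   makes all signs disappear. *)
Record fibre_theory := FibreTheory {
  fib : forall X Y, mmap X Y -> module R;
  fpi : forall X Y (f : mmap X Y), mmap (fib f) X;
  fj : forall X Y (f : mmap X Y), mmap (loopm Y) (fib f);
  fmap_fib : forall X Y X' Y' (f : mmap X Y) (f' : mmap X' Y') (a : mmap X X')
    (b : mmap Y Y'), (forall A n x, b A n (f A n x) = f' A n (a A n x)) ->
    exists c : mmap (fib f) (fib f'),
    [/\ mmap_comp (fpi f') c = mmap_comp a (fpi f),
        mmap_comp c (fj f) = mmap_comp (fj f') (loopm_map b) &
        level_equiv a -> level_equiv b -> level_equiv c];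
  fib_null : forall V X Y (f : mmap X Y) (a : mmap V X),
    (forall A n x, f A n (a A n x) = pt (Y A) n) ->
    exists c : mmap V (fib f), mmap_comp (fpi f) c = a;
  fib_comp0 : forall X Y (f : mmap X Y),
    htp (mmap_comp f (fpi f)) (mmap_comp (from_zero Y) (to_zero (fib f))) }.

Definition fibL_theory : fibre_theory.
Proof.
refine (@FibreTheory (fun X Y f => hpb_module f (from_zero Y))
  (fun X Y f => mhpb1 f (from_zero Y))
  (fun X Y f => @mhpb_map R _ _ _ _ _ _ (from_zero Y) (from_zero Y) f (from_zero Y)
     (from_zero X) (mmap_id Y) (mmap_id _) (fun A n x => esym (mfun_pt f A n))
     (fun _ _ _ => erefl)) _ _ _).
- move=> X Y X' Y' f f' a b e.
  exists (@mhpb_map R _ _ _ _ _ _ f (from_zero Y) f' (from_zero Y') a b (mmap_id _) e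
    (fun A n x => mfun_pt b A n)); split; first exact: mmap_ext.
    apply: mmap_ext => A; apply: hpb_eq => n; [by move=> x; rewrite /= mfun_pt|by []|].
    by move=> s x; rewrite [LHS]hpb_mkE [RHS]hpb_mkE /= !Delta_comp1.
  by move=> ha hb; apply: mhpb_map_equiv => //; apply: level_equiv_id.
- move=> V X Y f a e; exists (@mhpb_const R V X Y _ f (from_zero Y) a (to_zero V) e).
  exact: mmap_ext.
- move=> X Y f; have h := htp_hpb f (from_zero Y).
  suff <- : mmap_comp (from_zero Y) (mhpb2 f (from_zero Y)) =
    mmap_comp (from_zero Y) (to_zero (hpb_module f (from_zero Y))) by [].
  exact: mmap_ext.
Defined.

Definition fibR_theory : fibre_theory.
Proof.
refine (@FibreTheory (fun X Y f => hpb_module (from_zero Y) f)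
  (fun X Y f => mhpb2 (from_zero Y) f)
  (fun X Y f => @mhpb_map R _ _ _ _ _ _ (from_zero Y) (from_zero Y) (from_zero Y) f
     (mmap_id _) (mmap_id Y) (from_zero X) (fun _ _ _ => erefl)
     (fun A n x => esym (mfun_pt f A n))) _ _ _).
- move=> X Y X' Y' f f' a b e.
  exists (@mhpb_map R _ _ _ _ _ _ (from_zero Y) f (from_zero Y') f' (mmap_id _) b a
    (fun A n x => mfun_pt b A n) e); split; first exact: mmap_ext.
    apply: mmap_ext => A; apply: hpb_eq => n; [by []|by move=> x; rewrite /= mfun_pt|].
    by move=> s x; rewrite [LHS]hpb_mkE [RHS]hpb_mkE /= !Delta_comp1.
  by move=> ha hb; apply: mhpb_map_equiv => //; apply: level_equiv_id.
- move=> V X Y f a e; exists (@mhpb_const R V _ Y X (from_zero Y) f (to_zero V) a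
    (fun A n x => esym (e A n x))).
  exact: mmap_ext.
- move=> X Y f; have h := htp_sym (htp_hpb (from_zero Y) f).
  suff <- : mmap_comp (from_zero Y) (mhpb1 (from_zero Y) f) =
    mmap_comp (from_zero Y) (to_zero (hpb_module (from_zero Y) f)) by [].
  exact: mmap_ext.
Defined.

Section LinearFamilies.
Variables (L X Y Z : module R) (f : mmap X Y) (g : mmap Z Y).

Definition linear_family (T : module R) (p : forall A, smap (cyl (L A)) (T A)) :=
  [/\ forall A n s, p A n (s, pt (L A) n) = pt (T A) n,
      forall (A B : Defs.finset) (h : A -> B) (eh : bijective h) n s x,
        p B n (s, bact L eh n x) = bact T eh n (p A n (s, x)) &
      forall A B n s (r : R A n) x,
        p (fsum A B) n (s, mact L A B n r x) = mact T A B n r (p B n (s, x))].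

Definition linear_family2 (T : module R) (p : forall A, smap (cyl (cyl (L A))) (T A)) :=
  [/\ forall A n s t, p A n (s, (t, pt (L A) n)) = pt (T A) n,
      forall (A B : Defs.finset) (h : A -> B) (eh : bijective h) n s t x,
        p B n (s, (t, bact L eh n x)) = bact T eh n (p A n (s, (t, x))) &
      forall A B n s t (r : R A n) x,
        p (fsum A B) n (s, (t, mact L A B n r x)) = mact T A B n r (p B n (s, (t, x)))].

Lemma hpb_mk_linear (ux : forall A, smap (cyl (L A)) (X A))
    (up : forall A, smap (cyl (cyl (L A))) (Y A)) (uz : forall A, smap (cyl (L A)) (Z A))
    (e0 : forall A n x, up A n (Delta_const n vert0, x) = f A n (ux A n x))
    (e1 : forall A n x, up A n (Delta_const n vert1, x) = g A n (uz A n x)) :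
  @linear_family X ux -> @linear_family2 Y up -> @linear_family Z uz ->
  @linear_family (hpb_module f g) (fun A => hpb_mk (e0 A) (e1 A)).
Proof.
move=> [x1 x2 x3] [p1 p2 p3] [z1 z2 z3]; split.
- move=> A n s; apply: hpb_ext; rewrite /= ?x1 ?z1 // => m c d.
  by rewrite /= pt_nat p1.
- move=> A B h eh n s x; apply: hpb_ext; rewrite /= ?x2 ?z2 // => m c d.
  by rewrite /= -sfun_nat p2 !Delta_comp1.
- move=> A B n s r x; apply: hpb_ext; rewrite /= ?x3 ?z3 // => m c d.
  by rewrite /= -pprod_nat p3.
Qed.

Lemma linear_family_htp (T : module R) (p : forall A, smap (cyl (L A)) (T A))
    (a b : mmap L T) : linear_family p ->
  (forall A n x, p A n (Delta_const n vert0, x) = a A n x) ->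
  (forall A n x, p A n (Delta_const n vert1, x) = b A n x) -> htp a b.
Proof.
move=> [p1 p2 p3] pa pb.
have := htp_step (@mhpb_mk R L T T T (mmap_id T) (mmap_id T) a b p pa pb p1 p2 p3).
set u := mmap_comp (ev0 T) _; set v := mmap_comp (ev1 T) _.
have -> : u = a by apply: mmap_ext.
by have -> : v = b by apply: mmap_ext.
Qed.

End LinearFamilies.

Section Rotation.
Variables (E B : module R) (f : mmap E B).

Let D := loopm E.
Let dev A : smap (cyl (D A)) (E A) := hev (from_zero E A) (from_zero E A).

Fact dev0 A n t : dev A n (Delta_const n vert0, t) = pt (E A) n.
Proof. exact: hev0. Qed.
Fact dev1 A n t : dev A n (Delta_const n vert1, t) = pt (E A) n.
Proof. exact: hev1. Qed.

Lemma dev_linear : linear_family dev.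
Proof.
split=> [A n s //|A C h eh n s x|A C n s r x].
  by rewrite /= ?Delta_comp1 ?sact_id.
by rewrite /= ?Delta_comp1 ?sact_id.
Qed.

Lemma dev_min_linear : linear_family2 (fun A => smap_comp (dev A) (cyl_min (D A))).
Proof. by have [d1 d2 d3] := dev_linear; split=> *; [apply: d1|apply: d2|apply: d3]. Qed.

Lemma dev_max_linear : linear_family2 (fun A => smap_comp (dev A) (cyl_max (D A))).
Proof. by have [d1 d2 d3] := dev_linear; split=> *; [apply: d1|apply: d2|apply: d3]. Qed.

Lemma comp_linear2 (L T T' : module R) (p : forall A, smap (cyl (cyl (L A))) (T A))
    (k : mmap T T') :
  linear_family2 p -> linear_family2 (fun A => smap_comp (k A) (p A)).
Proof.
case=> p1 p2 p3; split=> [A n s t|A C h eh n s t x|A C n s t r x]; rewrite /=.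
- by rewrite p1 mfun_pt.
- by rewrite p2 mfun_bact.
- by rewrite p3 mfun_act.
Qed.

Lemma to_zero_linear (L : module R) :
  @linear_family L (zero_module R) (fun A => to_sone (cyl (L A))).
Proof. by split. Qed.

Let TL := fib fibR_theory (fpi fibL_theory f).

Definition rotL : mmap (loopm B) TL :=
  @mhpb_const R (loopm B) _ E _ (from_zero E) (fpi fibL_theory f) (to_zero _)
    (fj fibL_theory f) (fun _ _ _ => erefl).

Section InnerL.
Variable A : Defs.finset.

Let dmax_ n y : E A n := smap_comp (dev A) (cyl_max (D A)) n y.
Let dmin_ n y : E A n := smap_comp (dev A) (cyl_min (D A)) n y.

Fact dmx0 n x : dmax_ (Delta_const n vert0, x) = dev A n x.
Proof. by case: x => s x; congr (dev A n (_, x)); apply: dmax0. Qed.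

Fact dmx1 n x : dmax_ (Delta_const n vert1, x) = pt (E A) n.
Proof. by case: x => s x; rewrite -(dev1 x); congr (dev A n (_, x)); apply: dmax1. Qed.

Fact dmn0 n x : dmin_ (Delta_const n vert0, x) = pt (E A) n.
Proof. by case: x => s x; rewrite -(dev0 x); congr (dev A n (_, x)); apply: dmin0. Qed.

Fact dmn1 n x : dmin_ (Delta_const n vert1, x) = dev A n x.
Proof. by case: x => s x; congr (dev A n (_, x)); apply: dmin1. Qed.

Fact dmx0' n s x : dmax_ (n := n) (s, (Delta_const n vert0, x)) = dev A n (s, x).
Proof. by congr (dev A n (_, x)); rewrite -[RHS]dmax0; apply: dmaxC. Qed.

Fact dmx1' n s x : dmax_ (n := n) (s, (Delta_const n vert1, x)) = pt (E A) n.
Proof. by rewrite -(dev1 x); congr (dev A n (_, x)); rewrite -[RHS](dmax1 s); apply: dmaxC. Qed.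

Fact dmn0' n s x : dmin_ (n := n) (s, (Delta_const n vert0, x)) = pt (E A) n.
Proof. by rewrite -(dev0 x); congr (dev A n (_, x)); rewrite -[RHS](dmin0 s); apply: dminC. Qed.

Fact dmn1' n s x : dmin_ (n := n) (s, (Delta_const n vert1, x)) = dev A n (s, x).
Proof. by congr (dev A n (_, x)); rewrite -[RHS]dmin1; apply: dminC. Qed.

Fact rotL_in0 n x : smap_comp (f A) (smap_comp (dev A) (cyl_max (D A))) n
  (Delta_const n vert0, x) = f A n (dev A n x).
Proof. by rewrite -[LHS]/(f A n (dmax_ (_, x))) dmx0. Qed.

Fact rotL_in1 n x : smap_comp (f A) (smap_comp (dev A) (cyl_max (D A))) n
  (Delta_const n vert1, x) = from_zero B A n (to_sone (cyl (D A)) n x).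
Proof. by rewrite -[LHS]/(f A n (dmax_ (_, x))) dmx1 mfun_pt. Qed.

Definition rotL_in : smap (cyl (D A)) (fib fibL_theory f A) := hpb_mk rotL_in0 rotL_in1.

Definition rotL_out : smap (cyl (D A)) (TL A) :=
  @hpb_mk _ _ _ (from_zero E A) (fpi fibL_theory f A) _ (to_sone _)
    (smap_comp (dev A) (cyl_min (D A))) rotL_in dmn0 dmn1.

End InnerL.

(** The homotopy cuts a loop in E at time s. The part before s, cut out by the minimum, is the path
    of the outer fibre; the image in B of the part after s, cut out by the maximum, is the path of
    the inner fibre. One of the two parts is trivial at either end. *)
Lemma rotL_htp : htp (mmap_comp rotL (loopm_map f)) (fj fibR_theory (fpi fibL_theory f)).
Proof.
apply: (linear_family_htp (p := rotL_out)).
- apply: hpb_mk_linear; [exact: to_zero_linear|exact: dev_min_linear|].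
  apply: hpb_mk_linear; [exact: dev_linear| |exact: to_zero_linear].
  by apply: comp_linear2; apply: dev_max_linear.
- move=> A.
  suff h : forall n x, cyl_end (rotL_out A) vert0 n x = mmap_comp rotL (loopm_map f) A n x by [].
  apply: hpb_eq => n; [by move=> x; apply: unit_eq| |].
    suff h : forall n x, cyl_end (rotL_in A) vert0 n x =
      mmap_comp (fj fibL_theory f) (loopm_map f) A n x by apply: h.
    apply: hpb_eq => {}n; [by move=> x; apply: dev0|by move=> x; apply: unit_eq|].
    move=> s x; rewrite [LHS]hpb_mkE [RHS]hpb_mkE.
    apply: etrans (congr1 (f A n) (dmx0' s x)) _.
    by rewrite [RHS]hpb_mkE.
  move=> s x; rewrite [LHS]hpb_mkE [RHS]hpb_mkE; apply: etrans (dmn0' s x) _.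
  by [].
- move=> A.
  suff h : forall n x, cyl_end (rotL_out A) vert1 n x = fj fibR_theory (fpi fibL_theory f) A n x by [].
  apply: hpb_eq => n; [by move=> x; apply: unit_eq| |].
    suff h : forall n x, cyl_end (rotL_in A) vert1 n x =
      mmap_comp (from_zero _) (to_zero (loopm E)) A n x by apply: h.
    apply: hpb_eq => {}n; [by move=> x; apply: dev1|by move=> x; apply: unit_eq|].
    move=> s x; rewrite [LHS]hpb_mkE.
    exact: etrans (congr1 (f A n) (dmx1' s x)) (mfun_pt f A n).
  move=> s x; rewrite [LHS]hpb_mkE [RHS]hpb_mkE; apply: etrans (dmn1' s x) _.
  by [].
Qed.

Let PE : module R := hpb_module (from_zero E) (mmap_id E).
Let ev : mmap PE E := mhpb2 (from_zero E) (mmap_id E).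

Lemma from_zero_path_equiv : level_equiv (from_zero PE).
Proof.
apply: (level_equiv_section (r := to_zero PE)) => [A n x|]; first exact: unit_eq.
have -> : to_zero PE = mhpb1 (from_zero E) (mmap_id E) by apply: mmap_ext => A n x; apply: unit_eq.
exact: mhpb1_equiv (@level_equiv_id R E).
Qed.

Let G := hpb_module (mmap_comp f ev) (from_zero B).

Definition rotL_gl : mmap (loopm B) G := @mhpb_map R _ _ _ _ _ _ (from_zero B) (from_zero B)
  (mmap_comp f ev) (from_zero B) (from_zero PE) (mmap_id B) (mmap_id _)
  (fun A n x => esym (mfun_pt f A n)) (fun _ _ _ => erefl).

Definition rotL_gb : mmap G (hpb_module f (from_zero B)) :=
  @mhpb_map R _ _ _ _ _ _ (mmap_comp f ev) (from_zero B)
  f (from_zero B) ev (mmap_id B) (mmap_id _) (fun _ _ _ => erefl) (fun _ _ _ => erefl).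

Definition rotL_gp A : smap (cyl (G A)) (E A) := @SMap (cyl (G A)) (E A)
  (fun n y => hev (from_zero E A) (mmap_id E A) n (y.1, hpx y.2))
  (fun m n a y => sfun_nat (hev (from_zero E A) (mmap_id E A)) a (y.1, hpx y.2)).

Let TL' := hpb_module (from_zero E) (mhpb1 f (from_zero B)).

Definition rotL_gt : mmap G TL'.
Proof.
refine (@mhpb_mk R G _ E _ (from_zero E) (mhpb1 f (from_zero B)) (to_zero G)
  rotL_gb rotL_gp _ _ _ _ _).
- by move=> A n x; apply: (hev0 (hpx x)).
- by move=> A n x; apply: (hev1 (hpx x)).
- by [].
- by move=> A C h eh n s x; rewrite /= ?Delta_comp1 ?sact_id.
- by move=> A C n s r x; rewrite /= ?Delta_comp1 ?sact_id.
Defined.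

Lemma rotL_gtE A n x : rotL_gt A n x = pasteL (from_zero E A) (f A) (from_zero B A) n x.
Proof.
move: n x; apply: hpb_eq => n; [by move=> x; apply: unit_eq|by []|].
by move=> s x; rewrite [LHS]hpb_mkE [RHS]hpb_mkE.
Qed.

Lemma rotL_gt_equiv : level_equiv rotL_gt.
Proof.
move=> A; have -> : rotL_gt A = pasteL (from_zero E A) (f A) (from_zero B A).
  exact: smap_ext (rotL_gtE (A := A)).
exact: pasteL_weak.
Qed.

Lemma rotL_factor : mmap_comp rotL_gt rotL_gl = rotL.
Proof.
apply: mmap_ext => A; apply: hpb_eq => n; [by []| |].
  suff h : forall n x, mmap_comp rotL_gb rotL_gl A n x = fj fibL_theory f A n x by apply: h.
  by apply: hpb_eq => {}n // s x; rewrite [LHS]hpb_mkE [RHS]hpb_mkE [LHS]/= ?Delta_comp1.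
by move=> s x; rewrite [LHS]hpb_mkE [RHS]hpb_mkE.
Qed.
(** Pasting turns the fibre of the fibre projection into the fibre of PE -> B, where PE is the
    contractible module of paths in E that start at the base point. *)
Lemma rotL_equiv : level_equiv rotL.
Proof.
rewrite -rotL_factor; apply: level_equiv_comp rotL_gt_equiv.
by apply: mhpb_map_equiv; [exact: from_zero_path_equiv|exact: level_equiv_id..].
Qed.

Let TR := fib fibL_theory (fpi fibR_theory f).

Definition rotR : mmap (loopm B) TR :=
  @mhpb_const R (loopm B) _ E _ (fpi fibR_theory f) (from_zero E)
    (fj fibR_theory f) (to_zero _) (fun _ _ _ => erefl).

Section InnerR.
Variable A : Defs.finset.

Fact rotR_in0 n x : smap_comp (f A) (smap_comp (dev A) (cyl_min (D A))) n
  (Delta_const n vert0, x) = from_zero B A n (to_sone (cyl (D A)) n x).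
Proof. by rewrite -[LHS]/(f A n (smap_comp (dev A) (cyl_min (D A)) n (_, x))) dmn0 mfun_pt. Qed.

Fact rotR_in1 n x : smap_comp (f A) (smap_comp (dev A) (cyl_min (D A))) n
  (Delta_const n vert1, x) = f A n (dev A n x).
Proof. by rewrite -[LHS]/(f A n (smap_comp (dev A) (cyl_min (D A)) n (_, x))) dmn1. Qed.

Definition rotR_in : smap (cyl (D A)) (fib fibR_theory f A) := hpb_mk rotR_in0 rotR_in1.

Definition rotR_out : smap (cyl (D A)) (TR A) :=
  @hpb_mk _ _ _ (fpi fibR_theory f A) (from_zero E A) _ rotR_in
    (smap_comp (dev A) (cyl_max (D A))) (to_sone _) (@dmx0 A) (@dmx1 A).

End InnerR.

(** The same cut with the parts exchanged: the part before s is pushed to B and belongs to the inner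
    fibre. *)
Lemma rotR_htp : htp (fj fibL_theory (fpi fibR_theory f)) (mmap_comp rotR (loopm_map f)).
Proof.
apply: (linear_family_htp (p := rotR_out)).
- apply: hpb_mk_linear; [|exact: dev_max_linear|exact: to_zero_linear].
  apply: hpb_mk_linear; [exact: to_zero_linear| |exact: dev_linear].
  by apply: comp_linear2; apply: dev_min_linear.
- move=> A.
  suff h : forall n x, cyl_end (rotR_out A) vert0 n x = fj fibL_theory (fpi fibR_theory f) A n x by [].
  apply: hpb_eq => n; [|by move=> x; apply: unit_eq|].
    suff h : forall n x, cyl_end (rotR_in A) vert0 n x =
      mmap_comp (from_zero _) (to_zero (loopm E)) A n x by apply: h.
    apply: hpb_eq => {}n; [by move=> x; apply: unit_eq|by move=> x; apply: dev0|].
    move=> s x; rewrite [LHS]hpb_mkE.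
    exact: etrans (congr1 (f A n) (dmn0' s x)) (mfun_pt f A n).
  move=> s x; rewrite [LHS]hpb_mkE [RHS]hpb_mkE; apply: etrans (dmx0' s x) _.
  by [].
- move=> A.
  suff h : forall n x, cyl_end (rotR_out A) vert1 n x = mmap_comp rotR (loopm_map f) A n x by [].
  apply: hpb_eq => n; [|by move=> x; apply: unit_eq|].
    suff h : forall n x, cyl_end (rotR_in A) vert1 n x =
      mmap_comp (fj fibR_theory f) (loopm_map f) A n x by apply: h.
    apply: hpb_eq => {}n; [by move=> x; apply: unit_eq|by move=> x; apply: dev1|].
    move=> s x; rewrite [LHS]hpb_mkE [RHS]hpb_mkE.
    apply: etrans (congr1 (f A n) (dmn1' s x)) _.
    by rewrite [RHS]hpb_mkE.
  move=> s x; rewrite [LHS]hpb_mkE [RHS]hpb_mkE; apply: etrans (dmx1' s x) _.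
  by [].
Qed.

Let PE' : module R := hpb_module (mmap_id E) (from_zero E).
Let ev' : mmap PE' E := mhpb1 (mmap_id E) (from_zero E).

Lemma from_zero_path_equiv' : level_equiv (from_zero PE').
Proof.
apply: (level_equiv_section (r := to_zero PE')) => [A n x|]; first exact: unit_eq.
have -> : to_zero PE' = mhpb2 (mmap_id E) (from_zero E) by apply: mmap_ext => A n x; apply: unit_eq.
exact: mhpb2_equiv (@level_equiv_id R E).
Qed.

Let G' := hpb_module (from_zero B) (mmap_comp f ev').

Definition rotR_gl : mmap (loopm B) G' := @mhpb_map R _ _ _ _ _ _ (from_zero B) (from_zero B)
  (from_zero B) (mmap_comp f ev') (mmap_id _) (mmap_id B) (from_zero PE')
  (fun _ _ _ => erefl) (fun A n x => esym (mfun_pt f A n)).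

Definition rotR_gb : mmap G' (hpb_module (from_zero B) f) :=
  @mhpb_map R _ _ _ _ _ _ (from_zero B) (mmap_comp f ev')
  (from_zero B) f (mmap_id _) (mmap_id B) ev' (fun _ _ _ => erefl) (fun _ _ _ => erefl).

Definition rotR_gp A : smap (cyl (G' A)) (E A) := @SMap (cyl (G' A)) (E A)
  (fun n y => hev (mmap_id E A) (from_zero E A) n (y.1, hpz y.2))
  (fun m n a y => sfun_nat (hev (mmap_id E A) (from_zero E A)) a (y.1, hpz y.2)).

Let TR' := hpb_module (mhpb2 (from_zero B) f) (from_zero E).

Definition rotR_gt : mmap G' TR'.
Proof.
refine (@mhpb_mk R G' _ E _ (mhpb2 (from_zero B) f) (from_zero E) rotR_gb (to_zero G')
  rotR_gp _ _ _ _ _).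
- by move=> A n x; apply: (hev0 (hpz x)).
- by move=> A n x; apply: (hev1 (hpz x)).
- by [].
- by move=> A C h eh n s x; rewrite /= ?Delta_comp1 ?sact_id.
- by move=> A C n s r x; rewrite /= ?Delta_comp1 ?sact_id.
Defined.

Lemma rotR_gtE A n x : rotR_gt A n x = pasteR (from_zero E A) (f A) (from_zero B A) n x.
Proof.
move: n x; apply: hpb_eq => n; [by []|by move=> x; apply: unit_eq|].
by move=> s x; rewrite [LHS]hpb_mkE [RHS]hpb_mkE.
Qed.

Lemma rotR_gt_equiv : level_equiv rotR_gt.
Proof.
move=> A; have -> : rotR_gt A = pasteR (from_zero E A) (f A) (from_zero B A).
  exact: smap_ext (rotR_gtE (A := A)).
exact: pasteR_weak.
Qed.

Lemma rotR_factor : mmap_comp rotR_gt rotR_gl = rotR.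
Proof.
apply: mmap_ext => A; apply: hpb_eq => n; [|by []|].
  suff h : forall n x, mmap_comp rotR_gb rotR_gl A n x = fj fibR_theory f A n x by apply: h.
  by apply: hpb_eq => {}n // s x; rewrite [LHS]hpb_mkE [RHS]hpb_mkE [LHS]/= ?Delta_comp1.
by move=> s x; rewrite [LHS]hpb_mkE [RHS]hpb_mkE.
Qed.

Lemma rotR_equiv : level_equiv rotR.
Proof.
rewrite -rotR_factor; apply: level_equiv_comp rotR_gt_equiv.
by apply: mhpb_map_equiv; [exact: level_equiv_id..|exact: from_zero_path_equiv'].
Qed.

End Rotation.
End FibreTheories.

(** * Comparison with strict fibre sequences *)

Section StrictFibres.
Variables (R : E1ring).

Section One.
Variables (X Y : module R) (f : mmap X Y).

Definition fibre_incl : mmap (hpb_module f (from_zero Y)) (hpb_module f (mmap_id Y)) :=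
  @mhpb_map R _ _ _ _ _ _ f (from_zero Y) f (mmap_id Y) (mmap_id X) (mmap_id Y) (from_zero Y)
    (fun _ _ _ => erefl) (fun _ _ _ => erefl).

Lemma fibre_incl_strict : strict_fibre_seq fibre_incl (mhpb2 f (mmap_id Y)).
Proof.
split; first exact: mhpb2_kan.
- move=> A n x y e; apply: hpb_ext.
  + exact: (congr1 (@hpx _ _ _ _ _ n) e).
  + exact: unit_eq.
  + move=> m c a; have := congr1 (fun t => hpath t m (c, a)) e.
    by rewrite /= !Delta_comp1.
- move=> A n x; split=> [e|[y <-] //].
  have p1 m (a : Delta m n) : hpath x m (Delta_const m vert1, a) =
      sact a (from_zero Y A n tt).
    by rewrite hpath1; congr (sact a _); apply: e.
  exists (@Hpb _ _ _ (f A) (from_zero Y A) n (hpx x) (hpath x) tt (@hpath0 _ _ _ _ _ n x) p1).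
  apply: hpb_ext => [//||m c a]; first by symmetry; apply: e.
  by rewrite /= Delta_comp1.
Qed.

End One.

Section Two.
Variables (C B A0 : module R) (q : mmap C B) (p : mmap B A0).

Let pq : mmap (hpb_module q (mmap_id B)) B := mhpb2 q (mmap_id B).

Definition comp_fibre_incl :
  mmap (hpb_module q (from_zero B)) (hpb_module (mmap_comp p pq) (from_zero A0)) :=
  @mhpb_const R _ _ _ _ (mmap_comp p pq) (from_zero A0) (fibre_incl q) (to_zero _)
    (fun A n x => mfun_pt p A n).

Definition comp_fibre_proj :
  mmap (hpb_module (mmap_comp p pq) (from_zero A0)) (hpb_module p (from_zero A0)) :=
  @mhpb_map R _ _ _ _ _ _ (mmap_comp p pq) (from_zero A0) p (from_zero A0) pq
    (mmap_id A0) (mmap_id _) (fun _ _ _ => erefl) (fun _ _ _ => erefl).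

(** With q replaced by its mapping path fibration, the induced map from the fibre of the composite
    to the fibre of p is a fibration that leaves the path in A0 alone, so its strict fibre is that
    of the replacement of q. *)
Lemma comp_fibre_strict : strict_fibre_seq comp_fibre_incl comp_fibre_proj.
Proof.
have [_ inj ex] := fibre_incl_strict q.
split.
- move=> A; apply: hfibration_kan.
    by move=> n; apply: (pt (hpb_module (mmap_comp p pq) (from_zero A0) A)).
  have h := @hfibration_hpb_compl _ _ _ _ (pq A) (p A) (from_zero A0 A)
    (hpb2_hfibration (@module_hkan R C A) (@module_hkan R B A)).
  exact: h.
- move=> A n x y e; apply: (inj A n).
  exact: (congr1 (@hpx _ _ _ _ _ n) e).
- move=> A n x; split=> [e|[y <-]]; last first.
    apply: hpb_ext => // m c a.
    exact: (mfun_pt p A m).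
  have /ex [y ey] : mhpb2 q (mmap_id B) A n (hpx x) = pt (B A) n.
    exact: (congr1 (@hpx _ _ _ _ _ n) e).
  exists y; apply: hpb_ext => //; first exact: unit_eq.
  move=> m c a.
  have := congr1 (fun t => hpath t m (c, a)) e; rewrite /= Delta_comp1 => ->.
  exact: (mfun_pt p A m).
Qed.

End Two.

Lemma strict_fibre_equiv (F E B : module R) (i : mmap F E) (p : mmap E B) :
  strict_fibre_seq i p -> exists c : mmap F (fib (fibL_theory R) p),
    level_equiv c /\ mmap_comp (fpi (fibL_theory R) p) c = i.
Proof.
case=> hk inj ex.
have pi0 A n x : p A n (i A n x) = pt (B A) n by apply/ex; exists x.
pose c := @mhpb_const R F E B _ p (from_zero B) i (to_zero F) pi0.
exists c; split; last exact: mmap_ext.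
move=> A; apply: rel_equiv_weak; first exact: smap_pt.
have hp : hfibration (p A) by apply: kan_hfibration.
have e : c A = strict_fibre_map (ex A).
  apply: smap_ext; apply: hpb_eq => n; [by []|by move=> x; apply: unit_eq|].
  by move=> s x; rewrite [LHS]hpb_mkE [RHS]hpb_mkE; apply: pi0.
rewrite e; apply: strict_fibre_rel_equiv => //; exact: module_hkan.
Qed.

Lemma path_contractible (N : module R) :
  contractible (hpb_module (from_zero N) (mmap_id N)).
Proof.
move=> A; apply: homotopic_sym; first exact: module_hkan.
have h := cocyl_retract (from_zero N A).
set V := hpb_module (from_zero N) (mmap_id N).
have e : forall n x, smap_comp (cocyl_const (from_zero N A)) (hpb1 (from_zero N A) (smap_id (N A))) n x
    = smap_pt (V A) (V A) n x.
  by apply: hpb_eq => n; [by move=> x; apply: unit_eq|by []|by []].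
by rewrite (smap_ext e) in h.
Qed.

Definition path_fib (N : module R) : path_fibration N :=
  PathFibration (fibre_incl_strict (from_zero N)) (path_contractible N).

End StrictFibres.

(** * Loops and stability *)

Import GRing.Theory.
Local Open Scope ring_scope.

Section Stable.
Variables (R : E1ring) (H : hocat R) (W : loop_functor H).
Implicit Types X Y Z V : module R.
Local Notation "g ** f" := (hcomp g f) (at level 40, left associativity).
Local Notation loc := (hloc H).
Local Notation Om := (lob W).
Local Notation Omf := (lmor W).

Lemma invertible_loc X Y (f : mmap X Y) : level_equiv f -> invertible (loc f).
Proof. by move=> /(hloc_equiv H) [g [g1 g2]]; exists g. Qed.

Lemma invertible_id X : invertible (hid H X).
Proof. by exists (hid H X); rewrite hcomp1l. Qed.

Lemma invertible_comp X Y Z (g : hhom H Y Z) (f : hhom H X Y) :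
  invertible g -> invertible f -> invertible (g ** f).
Proof.
move=> [g' [g1 g2]] [f' [f1 f2]]; exists (f' ** g'); split.
  by rewrite -hcompA (hcompA g') g1 hcomp1l.
by rewrite -hcompA (hcompA f) f2 hcomp1l.
Qed.

Lemma invertible_monic X Y Z (g : hhom H Y Z) (f f' : hhom H X Y) :
  invertible g -> g ** f = g ** f' -> f = f'.
Proof. by move=> [k [k1 k2]] e; rewrite -[f]hcomp1l -[f']hcomp1l -k1 -!hcompA e. Qed.

Lemma invertible_epic X Y Z (g g' : hhom H Y Z) (f : hhom H X Y) :
  invertible f -> g ** f = g' ** f -> g = g'.
Proof. by move=> [k [k1 k2]] e; rewrite -[g]hcomp1r -[g']hcomp1r -k2 !hcompA e. Qed.

Lemma invertible_lmor X Y (f : hhom H X Y) : invertible f -> invertible (Omf f).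
Proof. by move=> [k [k1 k2]]; exists (Omf k); rewrite -!lmor_comp k1 k2 !lmor_id. Qed.

Definition lam Y : hhom H (loopm Y) (Om Y) := lfib W (path_fib Y).

Lemma lam_inv Y : invertible (lam Y).
Proof. exact: (lfib_inv W (path_fib Y)). Qed.

Lemma lam_nat X Y (f : mmap X Y) : Omf (loc f) ** lam X = lam Y ** loc (loopm_map f).
Proof.
apply: (@lfib_nat _ _ W X Y (path_fib X) (path_fib Y) f
  (@mhpb_map R _ _ _ _ _ _ (from_zero X) (mmap_id X) (from_zero Y) (mmap_id Y)
    (mmap_id _) f f (fun A n _ => mfun_pt f A n) (fun _ _ _ => erefl)) (loopm_map f)) => //.
move=> A n x; set gP := mhpb_map _ _.
suff h : forall n x, mmap_comp gP (fibre_incl (from_zero X)) A n x =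
  mmap_comp (fibre_incl (from_zero Y)) (loopm_map f) A n x by apply: h.
apply: hpb_eq => {x} {}n; [by []|by move=> x; apply: mfun_pt|].
by move=> s x; rewrite [LHS]hpb_mkE [RHS]hpb_mkE [LHS]/= [RHS]/= ?Delta_comp1.
Qed.

(** The shift preserves levelwise equivalences, so the universal property extends it to the homotopy
    category. *)
Lemma hsh_exists : exists Sh : forall X Y, hhom H X Y -> hhom H (sh_module X) (sh_module Y),
  [/\ forall X, Sh X X (hid H X) = hid H (sh_module X),
      forall X Y Z g f, Sh X Z (g ** f) = Sh Y Z g ** Sh X Y f &
      forall X Y (f : mmap X Y), Sh X Y (loc f) = loc (sh_map f)].
Proof.
have F1 X : loc (sh_map (mmap_id X)) = hid H (sh_module X).
  by rewrite -(hloc_id H); congr hloc; apply: mmap_ext.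
have F2 X Y Z (g : mmap Y Z) (f : mmap X Y) :
    loc (sh_map (mmap_comp g f)) = loc (sh_map g) ** loc (sh_map f).
  by rewrite -(hloc_comp H); congr hloc; apply: mmap_ext.
pose F := @MFunctor R (hcat H) (fun X => sh_module X) (fun X Y f => loc (sh_map f)) F1 F2.
have [|Sh [[h1 h2 h3] _]] := @hloc_univ R H (hcat H) F; last by exists Sh.
by move=> X Y f hf; apply: (hloc_equiv H (sh_map_equiv hf)).
Qed.

Definition Sh X Y (f : hhom H X Y) : hhom H (sh_module X) (sh_module Y) :=
  sval (cid hsh_exists) X Y f.

Lemma Sh_id X : Sh (hid H X) = hid H (sh_module X).
Proof. by rewrite /Sh; case: cid => S []. Qed.

Lemma Sh_comp X Y Z (g : hhom H Y Z) (f : hhom H X Y) : Sh (g ** f) = Sh g ** Sh f.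
Proof. by rewrite /Sh; case: cid => S []. Qed.

Lemma Sh_loc X Y (f : mmap X Y) : Sh (loc f) = loc (sh_map f).
Proof. by rewrite /Sh; case: cid => S []. Qed.

Lemma invertible_Sh X Y (f : hhom H X Y) : invertible f -> invertible (Sh f).
Proof. by move=> [k [k1 k2]]; exists (Sh k); rewrite -!Sh_comp k1 k2 !Sh_id. Qed.

Definition eta X : hhom H X (Om (sh_module X)) := lam (sh_module X) ** loc (sigma X).

Lemma eta_inv X : invertible (eta X).
Proof. exact: invertible_comp (lam_inv _) (invertible_loc (sigma_equiv X)). Qed.

Lemma eta_nat X Y (f : hhom H X Y) : eta Y ** f = Omf (Sh f) ** eta X.
Proof.
move: X Y f; apply: (@natural_frac R H id (fun X => Om (sh_module X)) (fun X Y f => f)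
   (fun X Y f => Omf (Sh f)) eta) => //.
- by move=> X; rewrite Sh_id lmor_id.
- by move=> X Y Z g f; rewrite Sh_comp lmor_comp.
move=> X Y f; rewrite Sh_loc /eta hcompA lam_nat -!hcompA -!hloc_comp; congr (_ ** loc _).
by apply: mmap_ext => A n x; apply: sigma_map.
Qed.

Definition theta_pre X : hhom H (sh_module (loopm X)) (Om (sh_module X)) :=
  lam (sh_module X) ** loc (sh_loop X).

(** Shift and loops commute: on the strict models the comparison [sh_loop] is levelwise the
    identity. Conjugation with [lam] carries this over to the given loop functor. *)
Lemma theta_exists X : exists th : hhom H (sh_module (Om X)) (Om (sh_module X)),
  invertible th /\ th ** Sh (lam X) = theta_pre X.
Proof.
have [k [k1 k2]] := invertible_Sh (lam_inv X).
exists (theta_pre X ** k); split; last by rewrite -hcompA k1 hcomp1r.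
apply: invertible_comp; last by exists (Sh (lam X)).
exact: invertible_comp (lam_inv _) (invertible_loc (sh_loop_equiv X)).
Qed.

Definition theta X := sval (cid (theta_exists X)).

Lemma thetaP X : invertible (theta X) /\ theta X ** Sh (lam X) = theta_pre X.
Proof. by rewrite /theta; case: cid. Qed.

Lemma theta_nat X Y (f : hhom H X Y) : theta Y ** Sh (Omf f) = Omf (Sh f) ** theta X.
Proof.
move: X Y f; apply: (@natural_frac R H (fun X => sh_module (Om X)) (fun X => Om (sh_module X))
   (fun X Y f => Sh (Omf f)) (fun X Y f => Omf (Sh f)) theta).
- by move=> X; rewrite lmor_id Sh_id.
- by move=> X Y Z g f; rewrite lmor_comp Sh_comp.
- by move=> X; rewrite Sh_id lmor_id.
- by move=> X Y Z g f; rewrite Sh_comp lmor_comp.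
move=> X Y f; apply: (invertible_epic (invertible_Sh (lam_inv X))).
rewrite -!hcompA -Sh_comp lam_nat Sh_comp (proj2 (thetaP X)) hcompA (proj2 (thetaP Y)).
rewrite !Sh_loc /theta_pre hcompA lam_nat -!hcompA -!hloc_comp; congr (_ ** loc _).
apply: mmap_ext => A n x; suff h : forall n x, mmap_comp (sh_loop Y) (sh_map (loopm_map f)) A n x =
  mmap_comp (loopm_map (sh_map f)) (sh_loop X) A n x by apply: h.
apply: hpb_eq => {x} {}n; [by []|by []|].
by move=> s x; rewrite [LHS]hpb_mkE [RHS]hpb_mkE.
Qed.

Lemma Sh_inj X Y (f g : hhom H X Y) : Sh f = Sh g -> f = g.
Proof. by move=> e; apply: (invertible_monic (eta_inv Y)); rewrite !eta_nat e. Qed.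

(** By [eta] the loops of Sh f are conjugate to f, and by [theta] they are conjugate to Sh of the
    loops of f; so the loops of f determine f. *)
Lemma lmor_inj X Y (f g : hhom H X Y) : Omf f = Omf g -> f = g.
Proof.
move=> e; have h : Sh (Omf f) = Sh (Omf g) by rewrite e.
have {}h : Omf (Sh f) = Omf (Sh g).
  by apply: (invertible_epic (proj1 (thetaP X))); rewrite -!theta_nat h.
by apply: (invertible_monic (eta_inv Y)); rewrite !eta_nat h.
Qed.

(** Through [theta], Sh h becomes a map between loops of shifts, and conjugation with [eta] turns it
    into the candidate. That its loops are h is checked after Sh, which is faithful. *)
Lemma lmor_surj X Y (h : hhom H (Om X) (Om Y)) : exists f : hhom H X Y, Omf f = h.
Proof.
have [e' [e1 e2]] := eta_inv Y; have [t' [t1 t2]] := proj1 (thetaP X).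
pose h' := theta Y ** Sh h ** t'.
exists (e' ** (h' ** eta X)).
have E : Omf (Sh (e' ** (h' ** eta X))) = h'.
  apply: (invertible_epic (eta_inv X)).
  by rewrite -eta_nat hcompA e2 hcomp1l.
apply: Sh_inj; apply: (invertible_monic (proj1 (thetaP Y))).
by rewrite theta_nat E /h' -hcompA t1 hcomp1r.
Qed.

Lemma hid0_hom X Y (f : hhom H X Y) : hid H Y = 0 -> f = 0.
Proof. by move=> e; rewrite -[f]hcomp1l e hcomp0l. Qed.

Lemma hid0_iso X Y : isomorphic H X Y -> hid H Y = 0 -> hid H X = 0.
Proof. by move=> [f [g [gf fg]]] e; rewrite -gf (hid0_hom f e) hcomp0r. Qed.

(** The zero map factors through the zero module, whose loops are again zero. Additivity of the loop
    functor is obtained only later, from biproducts. *)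
Lemma lmor0 X Y : Omf (0 : hhom H X Y) = 0.
Proof.
have z : hid H (Om (zero_module R)) = 0.
  apply: (@hid0_iso _ (zero_module R)); last exact: hid_zero_module.
  have [k [k1 k2]] := lam_inv (zero_module R).
  apply: (@ex_intro _ _ (loc (to_zero (loopm (zero_module R))) ** k)).
  apply: invertible_comp; last by exists (lam (zero_module R)).
  apply: invertible_loc.
  have -> : to_zero (loopm (zero_module R)) = mhpb1 (from_zero _) (from_zero _).
    by apply: mmap_ext => A n x; apply: unit_eq.
  apply: mhpb1_equiv.
  by have -> : from_zero (zero_module R) = mmap_id _; [apply: mmap_ext => A n x; apply: unit_eq | apply: level_equiv_id].
have -> : (0 : hhom H X Y) = loc (from_zero Y) ** loc (to_zero X).
  by rewrite (hid0_hom (loc (to_zero X)) (hid_zero_module H)) hcomp0r.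
by rewrite lmor_comp (hid0_hom (Omf (loc (to_zero X))) z) hcomp0r.
Qed.

(* Maps of arrows that extend to the homotopy fibres, compatibly with both
   ends of the fibre sequence. *)
Section Theory.
Variable T : fibre_theory R.

Definition conn X Y (f : mmap X Y) (d : hhom H (Om Y) (fib T f)) : Prop :=
  d ** lam Y = loc (fj T f).

Lemma conn_exists X Y (f : mmap X Y) : exists d, conn (f := f) d.
Proof.
have [k [k1 k2]] := lam_inv Y; exists (loc (fj T f) ** k).
by rewrite /conn -hcompA k1 hcomp1r.
Qed.

Definition fconn X Y (f : mmap X Y) := sval (cid (conn_exists f)).

Lemma fconnP X Y (f : mmap X Y) : fconn f ** lam Y = loc (fj T f).
Proof. by rewrite /fconn; case: cid. Qed.

Definition good X Y X' Y' (f : mmap X Y) (f' : mmap X' Y') (a : hhom H X X')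
    (b : hhom H Y Y') : Prop :=
  exists c : hhom H (fib T f) (fib T f'),
    loc (fpi T f') ** c = a ** loc (fpi T f) /\ c ** fconn f = fconn f' ** Omf b.

Lemma good_comp X Y X' Y' X'' Y'' (f : mmap X Y) (f' : mmap X' Y') (f'' : mmap X'' Y'')
    a b a' b' : good f f' a b -> good f' f'' a' b' -> good f f'' (a' ** a) (b' ** b).
Proof.
move=> [c [c1 c2]] [c' [c1' c2']]; exists (c' ** c); split.
  by rewrite hcompA c1' -hcompA c1 hcompA.
by rewrite -hcompA c2 hcompA c2' -hcompA lmor_comp.
Qed.

Lemma good_strict X Y X' Y' (f : mmap X Y) (f' : mmap X' Y') (a : mmap X X') (b : mmap Y Y') :
  mmap_comp b f = mmap_comp f' a ->
  exists c : mmap (fib T f) (fib T f'),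
  [/\ loc (fpi T f') ** loc c = loc a ** loc (fpi T f),
      loc c ** fconn f = fconn f' ** Omf (loc b) &
      level_equiv a -> level_equiv b -> level_equiv c].
Proof.
move=> e; have [c [c1 c2 c3]] := fmap_fib (f := f) (f' := f') (a := a) (b := b) T
  (fun A n x => congr1 (fun m : mmap X Y' => m A n x) e).
exists c; split=> //; first by rewrite -!hloc_comp c1.
apply: (invertible_epic (lam_inv Y)).
by rewrite -!hcompA lam_nat fconnP -hloc_comp c2 hloc_comp hcompA fconnP.
Qed.

Lemma good_strict_fwd X Y X' Y' (f : mmap X Y) (f' : mmap X' Y') (a : mmap X X') (b : mmap Y Y') :
  mmap_comp b f = mmap_comp f' a -> good f f' (loc a) (loc b).
Proof. by case/good_strict => c [c1 c2 _]; exists (loc c). Qed.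

Lemma good_strict_bwd X Y X' Y' (f : mmap X Y) (f' : mmap X' Y') (a : mmap X X') (b : mmap Y Y')
    (a' : hhom H X' X) (b' : hhom H Y' Y) :
  mmap_comp b f = mmap_comp f' a -> level_equiv a -> level_equiv b ->
  loc a ** a' = hid H X' -> loc b ** b' = hid H Y' -> good f' f a' b'.
Proof.
move=> e ha hb aa bb; have [c [c1 c2 /(_ ha hb) hc]] := good_strict e.
have [k [k1 k2]] := hloc_equiv H hc.
exists k; split.
  apply: (invertible_monic (invertible_loc ha)).
  by rewrite !hcompA -c1 aa hcomp1l -hcompA k2 hcomp1r.
apply: (invertible_monic (invertible_loc hc)).
by rewrite !hcompA k2 hcomp1l c2 -hcompA -lmor_comp bb lmor_id hcomp1r.
Qed.

(** A homotopy turns into an equality once X is replaced by pairs of a point of X and a path from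
    its image: f' takes the end of the path, j adds the constant path and a' adds the given
    homotopy. This is repeated for each step of the zigzag. *)
Lemma strictify V X Y (f : mmap X Y) (a : mmap V X) (c : mmap V Y) :
  htp (mmap_comp f a) c ->
  exists X' (f' : mmap X' Y) (j : mmap X X') (a' : mmap V X'),
  [/\ level_equiv j, mmap_comp f' j = f, mmap_comp f' a' = c & loc a' = loc j ** loc a].
Proof.
have step (C : module R) (e0 e1 : mmap C Y) k (h : mmap V C) X' (f' : mmap X' Y)
    (j : mmap X X') (a' : mmap V X') : gpo e0 e1 k -> level_equiv j -> mmap_comp f' j = f ->
    mmap_comp f' a' = mmap_comp e0 h -> loc a' = loc j ** loc a ->
    exists X'' (f'' : mmap X'' Y) (j' : mmap X X'') (a'' : mmap V X''),
    [/\ level_equiv j', mmap_comp f'' j' = f, mmap_comp f'' a'' = mmap_comp e1 h &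
       loc a'' = loc j' ** loc a].
  move=> [he0 he1 ek0 ek1] hj fj fa aj.
  pose j2 : mmap X' (hpb_module f' e0) := @mhpb_const R _ _ _ _ f' e0 (mmap_id X') (mmap_comp k f')
    (fun A n x => esym (congr1 (fun m : mmap Y Y => m A n (f' A n x)) ek0)).
  pose a2 : mmap V (hpb_module f' e0) := @mhpb_const R _ _ _ _ f' e0 a' h
    (fun A n x => congr1 (fun m : mmap V Y => m A n x) fa).
  pose r := mhpb1 f' e0.
  have hr : level_equiv r by apply: mhpb1_equiv.
  have hj2 : level_equiv j2 by apply: (level_equiv_section (r := r)).
  exists _, (mmap_comp e1 (mhpb2 f' e0)), (mmap_comp j2 j), a2; split.
  - exact: level_equiv_comp.
  - rewrite -fj; apply: mmap_ext => A n x.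
    exact: (congr1 (fun m : mmap Y Y => m A n (f' A n (j A n x))) ek1).
  - exact: mmap_ext.
  - apply: (invertible_monic (invertible_loc hr)).
    have e1' : loc r ** loc a2 = loc a' by rewrite -hloc_comp; congr hloc; apply: mmap_ext.
    have e2' : loc r ** loc j2 = hid H X'.
      by rewrite -hloc_comp -(hloc_id H); congr hloc; apply: mmap_ext.
    by rewrite e1' hloc_comp !hcompA e2' hcomp1l.
elim=> [|h _ [X' [f' [j [a' [hj fj fa aj]]]]]|h _ [X' [f' [j [a' [hj fj fa aj]]]]]].
- exists X, f, (mmap_id X), a; split=> //; rewrite ?mmap_comp1r ?hloc_id ?hcomp1l //.
  exact: level_equiv_id.
- exact: step (pathm_gpo Y) hj fj fa aj.
- exact: step (gpo_sym (pathm_gpo Y)) hj fj fa aj.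
Qed.

(** Written as a fraction, phi has a strict numerator a for which f a is homotopic to zero after an
    equivalence. Then [strictify] makes the composite strictly zero, so that it lifts by
    [fib_null]. *)
Lemma fib_exact V X Y (f : mmap X Y) (phi : hhom H V X) :
  loc f ** phi = 0 -> exists psi, phi = loc (fpi T f) ** psi.
Proof.
have [U [w [a [k [hw kw wk ->]]]]] := fraction_inv phi.
rewrite hcompA => fa0.
have {fa0} : loc (mmap_comp f a) = loc (mmap_comp (from_zero Y) (to_zero U)).
  rewrite (loc_factor_zero _ (f := mmap_comp (from_zero Y) (to_zero U))) //.
  by rewrite -[LHS]hcomp1r -kw hcompA hloc_comp fa0 hcomp0l.
case/hloc_eq_htp => P [v [hv]]; rewrite -!mmap_compA.
case/strictify => X' [f' [j [a' [hj fj fa aj]]]].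
have [c ec] : exists c : mmap P (fib T f'), mmap_comp (fpi T f') c = a'.
  apply: fib_null => A n x.
  exact: (congr1 (fun m : mmap P Y => m A n x) fa).
have [j' [j1 j2]] := hloc_equiv H hj.
have [g [g1 g2]] : good f' f j' (hid H Y).
  apply: (good_strict_bwd (a := j) (b := mmap_id Y)) => //.
  - by rewrite mmap_comp1l fj.
  - exact: level_equiv_id.
  - by rewrite hloc_id hcomp1l.
have [v' [v1 v2]] := hloc_equiv H hv.
exists (g ** loc c ** v' ** k).
rewrite !hcompA g1 -(hcompA j') -hloc_comp ec aj hloc_comp.
by rewrite !hcompA j1 hcomp1l -(hcompA (loc a)) v2 hcomp1r.
Qed.

(** The square is cut into strict squares, read forwards, and squares whose vertical maps are strict
    equivalences, read backwards; [good] holds for both kinds and composes. Homotopies in between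
    are absorbed by pulling back along w and by [strictify]. *)
Lemma fib_square X Y X' Y' (f : mmap X Y) (f' : mmap X' Y') (a : hhom H X X')
    (b : hhom H Y Y') : b ** loc f = loc f' ** a -> good f f' a b.
Proof.
have [Y1 [w [b1 [k [hw kw wk eb]]]]] := fraction_inv b => e.
pose f1 := mhpb2 f w; pose pr := mhpb1 f w.
have hpr : level_equiv pr by apply: mhpb1_equiv.
have [pr' [pr1 pr2]] := hloc_equiv H hpr.
have sq : htp (mmap_comp f pr) (mmap_comp w f1) := htp_hpb f w.
(* f and f1 are compared through the path space of f *)
have g1 : good f f1 pr' k.
  pose q := mhpb2 f (mmap_id Y).
  pose cc : mmap X (hpb_module f (mmap_id Y)) := @mhpb_const R _ _ _ _ f (mmap_id Y)
     (mmap_id X) f (fun _ _ _ => erefl).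
  pose m : mmap (hpb_module f w) (hpb_module f (mmap_id Y)) :=
    @mhpb_map R _ _ _ _ _ _ f w f (mmap_id Y) (mmap_id X) (mmap_id Y) w
      (fun _ _ _ => erefl) (fun _ _ _ => erefl).
  have hm : level_equiv m by apply: mhpb_map_equiv => //; apply: level_equiv_id.
  have [m' [m1 m2]] := hloc_equiv H hm.
  have gc : good f q (loc cc) (loc (mmap_id Y)) by apply: good_strict_fwd; apply: mmap_ext.
  have gm : good q f1 m' k.
    by apply: (good_strict_bwd (a := m) (b := w)) => //; apply: mmap_ext.
  have := good_comp gc gm; rewrite hloc_id hcomp1r.
  suff -> : m' ** loc cc = pr' by [].
  apply: (invertible_monic (invertible_loc hpr)); rewrite pr2.
  have -> : loc pr = loc (mhpb1 f (mmap_id Y)) ** loc m by rewrite -hloc_comp; congr hloc; apply: mmap_ext.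
  rewrite -hcompA (hcompA (loc m)) m2 hcomp1l -hloc_comp -(hloc_id H); congr hloc.
  exact: mmap_ext.
have [X2 [v [a2 [kv [hv kvv vkv ea]]]]] := fraction_inv (a ** loc pr).
have e2 : loc (mmap_comp f' a2) = loc (mmap_comp b1 (mmap_comp f1 v)).
  have -> : loc (mmap_comp f' a2) = loc f' ** (a ** loc pr) ** loc v.
    by rewrite ea hloc_comp -!hcompA kvv hcomp1r.
  rewrite (hcompA (loc f')) -e eb.
  have -> : loc b1 ** k ** loc f ** loc pr = loc b1 ** loc f1.
    rewrite -!hcompA -hloc_comp (htp_hloc H sq) hloc_comp (hcompA k) kw hcomp1l //.
  by rewrite !hloc_comp hcompA.
have [X3 [u [hu]]] := hloc_eq_htp e2; rewrite -!mmap_compA.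
case/strictify => X4 [f4 [j [a4 [hj fj fa aj]]]].
have [u' [u1 u2]] := hloc_equiv H hu; have [j' [j1 j2]] := hloc_equiv H hj.
pose f3 := mmap_comp f1 (mmap_comp v u).
have g3 : good f1 f3 (u' ** kv) (hid H Y1).
  apply: (good_strict_bwd (a := mmap_comp v u) (b := mmap_id Y1)) => //.
  - by rewrite mmap_comp1l.
  - exact: level_equiv_comp.
  - exact: level_equiv_id.
  - by rewrite hloc_comp -hcompA (hcompA (loc u)) u2 hcomp1l.
  - by rewrite hloc_id hcomp1l.
have g4 : good f3 f4 (loc a4) (loc b1) by apply: good_strict_fwd; rewrite fa.
have g5 : good f4 f' j' (hid H Y').
  apply: (good_strict_bwd (a := j) (b := mmap_id Y')) => //.
  - by rewrite mmap_comp1l fj.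
  - exact: level_equiv_id.
  - by rewrite hloc_id hcomp1l.
have := good_comp (good_comp (good_comp g1 g3) g4) g5.
rewrite !hcomp1l -eb.
suff -> : j' ** (loc a4 ** (u' ** kv ** pr')) = a by [].
rewrite aj hloc_comp !hcompA j1 hcomp1l -(hcompA (loc a2)) u2 hcomp1r.
by rewrite -ea -hcompA pr2 hcomp1r.
Qed.

Lemma fib_comp_zero X Y (f : mmap X Y) : loc f ** loc (fpi T f) = 0.
Proof.
rewrite -hloc_comp (htp_hloc H (fib_comp0 T f)).
exact: loc_factor_zero.
Qed.

End Theory.
End Stable.

(** * Triangles *)

Section Triangles.
Variables (R : E1ring) (H : hocat R) (W : loop_functor H).
Implicit Types X Y Z V : module R.
Local Notation "g ** f" := (hcomp g f) (at level 40, left associativity).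
Local Notation loc := (hloc H).
Local Notation Om := (lob W).
Local Notation Omf := (lmor W).

Lemma lmor_full X Y (h : hhom H (Om X) (Om Y)) : exists f : hhom H X Y, h = Omf f.
Proof. by have [f <-] := lmor_surj h; exists f. Qed.

(* The connecting map d of a triangle starts at the loops of Z, so that no
   suspension is needed. *)
Definition tri_of (T : fibre_theory R) X Y Z (d : hhom H (Om Z) X) (i : hhom H X Y)
    (p : hhom H Y Z) : Prop :=
  exists E B (f : mmap E B) (x : hhom H X (fib T f)) (y : hhom H Y E) (z : hhom H Z B),
  [/\ invertible x, invertible y, invertible z &
    [/\ y ** i = loc (fpi T f) ** x, z ** p = loc f ** y & x ** d = fconn W T f ** Omf z]].

Lemma tri_rotate (T T' : fibre_theory R)
    (r : forall E B (f : mmap E B), mmap (loopm B) (fib T' (fpi T f))) :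
  (forall E B (f : mmap E B), level_equiv (r E B f)) ->
  (forall E B (f : mmap E B), mmap_comp (fpi T' (fpi T f)) (r E B f) = fj T f) ->
  (forall E B (f : mmap E B),
    loc (r E B f) ** loc (loopm_map f) = loc (fj T' (fpi T f))) ->
  forall X Y Z (d : hhom H (Om Z) X) (i : hhom H X Y) (p : hhom H Y Z),
  tri_of T d i p -> tri_of T' (Omf p) d i.
Proof.
move=> rE rp rj X Y Z d i p [E [B [f [x [y [z [hx hy hz [yi zp xd]]]]]]]].
have [k [k1 k2]] := lam_inv W B; have [k' [k1' k2']] := lam_inv W E.
exists _, _, (fpi T f), (loc (r E B f) ** k ** Omf z), x, y; split=> //.
  apply: invertible_comp (invertible_lmor W hz).
  by apply: invertible_comp (invertible_loc H (rE E B f)) _; exists (lam W B).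
split=> //.
- rewrite xd !hcompA -hloc_comp rp -(fconnP W) -!hcompA; congr (_ ** _).
  by rewrite hcompA k2 hcomp1l.
- rewrite -!hcompA -lmor_comp zp lmor_comp !hcompA; congr (_ ** _).
  apply: (invertible_epic (lam_inv W E)).
  by rewrite fconnP -rj -!hcompA lam_nat; congr (_ ** _); rewrite hcompA k1 hcomp1l.
Qed.

Definition theory_of (b : bool) : fibre_theory R :=
  if b then fibL_theory R else fibR_theory R.

Definition tri b := tri_of (theory_of b).
Arguments tri b [X Y Z] d i p.

Lemma tri_rot b X Y Z (d : hhom H (Om Z) X) (i : hhom H X Y) (p : hhom H Y Z) :
  tri b d i p -> tri (~~ b) (Omf p) d i.
Proof.
case: b.
- apply: (@tri_rotate (fibL_theory R) (fibR_theory R) (@rotL R)); first exact: rotL_equiv.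
    by move=> E B f; apply: mmap_ext.
  by move=> E B f; rewrite -hloc_comp; apply: htp_hloc (rotL_htp f).
- apply: (@tri_rotate (fibR_theory R) (fibL_theory R) (@rotR R)); first exact: rotR_equiv.
    by move=> E B f; apply: mmap_ext.
  by move=> E B f; rewrite -hloc_comp; apply/esym/htp_hloc/(rotR_htp f).
Qed.

Lemma tri_iso b X Y Z X' Y' Z' (d : hhom H (Om Z) X) (i : hhom H X Y) (p : hhom H Y Z)
    (d' : hhom H (Om Z') X') (i' : hhom H X' Y') (p' : hhom H Y' Z') x y z :
  tri b d i p -> invertible x -> invertible y -> invertible z ->
  y ** i' = i ** x -> z ** p' = p ** y -> x ** d' = d ** Omf z -> tri b d' i' p'.
Proof.
move=> [E [B [f [x0 [y0 [z0 [hx hy hz [yi zp xd]]]]]]]] hx' hy' hz' e1 e2 e3.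
exists E, B, f, (x0 ** x), (y0 ** y), (z0 ** z); split; try exact: invertible_comp.
split.
- by rewrite -hcompA e1 hcompA yi -hcompA.
- by rewrite -hcompA e2 hcompA zp -hcompA.
- by rewrite -hcompA e3 hcompA xd -hcompA lmor_comp.
Qed.

Lemma tri_strict b E B (f : mmap E B) :
  tri b (fconn W (theory_of b) f) (loc (fpi (theory_of b) f)) (loc f).
Proof.
exists E, B, f, (hid H _), (hid H _), (hid H _); split; try exact: invertible_id.
by rewrite lmor_id !hcomp1l !hcomp1r.
Qed.

Lemma tri_fibre b Y Z (p : hhom H Y Z) : exists X d (i : hhom H X Y), tri b d i p.
Proof.
have [V [w [f [k [hw kw wk ->]]]]] := fraction_inv p.
exists _, (fconn W (theory_of b) f), (loc w ** loc (fpi (theory_of b) f)).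
apply: (tri_iso (x := hid H _) (y := k) (z := hid H _) (tri_strict b f)).
- exact: invertible_id.
- by exists (loc w).
- exact: invertible_id.
- by rewrite hcompA kw hcomp1l hcomp1r.
- by rewrite hcomp1l.
- by rewrite lmor_id hcomp1l hcomp1r.
Qed.

(** Up to [eta], d is the loops of a map f from Z to the shift of X; rotating the triangle of the
    fibre of f makes that fibre the cofibre of d. The rotation accounts for the opposite orientation
    at the start. *)
Lemma tri_cofibre b X Z (d : hhom H (Om Z) X) : exists Y i (p : hhom H Y Z), tri b d i p.
Proof.
have [f ef] := lmor_full (eta W X ** d).
have [Y [d1 [i1 h]]] := tri_fibre (~~ b) f.
have := tri_rot h; rewrite negbK => {}h.
exists Y, (d1 ** eta W X), i1.
apply: (tri_iso (x := eta W X) (y := hid H _) (z := hid H _) h).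
- exact: eta_inv.
- exact: invertible_id.
- exact: invertible_id.
- by rewrite hcomp1l.
- by rewrite hcomp1l hcomp1r.
- by rewrite lmor_id hcomp1r.
Qed.

Section Exact.
Variables (b : bool) (X Y Z : module R).
Variables (d : hhom H (Om Z) X) (i : hhom H X Y) (p : hhom H Y Z).
Hypothesis h : tri b d i p.

Lemma tri_pi : p ** i = 0.
Proof.
have [E [B [f [x [y [z [hx hy hz [yi zp xd]]]]]]]] := h.
apply: (invertible_monic hz); rewrite hcomp0r hcompA zp -hcompA yi hcompA.
by rewrite fib_comp_zero hcomp0l.
Qed.

Lemma tri_exact_mid V (phi : hhom H V Y) : p ** phi = 0 -> exists psi, phi = i ** psi.
Proof.
have [E [B [f [x [y [z [hx hy hz [yi zp xd]]]]]]]] := h => e.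
have [|psi epsi] := @fib_exact R H W (theory_of b) V E B f (y ** phi).
  by rewrite hcompA -zp -hcompA e hcomp0r.
have [k [k1 k2]] := hx; exists (k ** psi).
apply: (invertible_monic hy).
by rewrite epsi !hcompA yi -!hcompA; congr (_ ** _); rewrite !hcompA k2 hcomp1l.
Qed.

End Exact.

Lemma tri_map_fib b X Y Z X' Y' Z' (d : hhom H (Om Z) X) (i : hhom H X Y) (p : hhom H Y Z)
    (d' : hhom H (Om Z') X') (i' : hhom H X' Y') (p' : hhom H Y' Z') y z :
  tri b d i p -> tri b d' i' p' -> z ** p = p' ** y ->
  exists x, i' ** x = y ** i /\ x ** d = d' ** Omf z.
Proof.
move=> [E [B [f [x1 [y1 [z1 [[k1 [xa xb]] hy1 hz1 [yi1 zp1 xd1]]]]]]]]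
  [E' [B' [f' [x2 [y2 [z2 [hx2 hy2 hz2 [yi2 zp2 xd2]]]]]]]] e.
have [l1 [ya yb]] := hy1; have [m1 [za zb]] := hz1.
have [c [c1 c2]] : good W (theory_of b) f f' (y2 ** y ** l1) (z2 ** z ** m1).
  apply: fib_square.
  have -> : loc f = z1 ** p ** l1 by rewrite zp1 -hcompA yb hcomp1r.
  rewrite -!hcompA (hcompA m1) za hcomp1l (hcompA z) e !hcompA zp2.
  by rewrite -!hcompA.
have [k2 [xa2 xb2]] := hx2.
exists (k2 ** c ** x1); split.
  apply: (invertible_monic hy2).
  rewrite !hcompA yi2 -(hcompA _ x2) xb2 hcomp1r c1.
  by rewrite -!hcompA -yi1 (hcompA l1) ya hcomp1l.
apply: (invertible_monic hx2).
rewrite !hcompA xb2 hcomp1l -(hcompA c) xd1 (hcompA c) c2 -(hcompA _ _ (Omf z1)).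
by rewrite -lmor_comp -(hcompA _ m1) za hcomp1r xd2 lmor_comp !hcompA.
Qed.

Section More.
Variables (b : bool) (X Y Z : module R).
Variables (d : hhom H (Om Z) X) (i : hhom H X Y) (p : hhom H Y Z).
Hypothesis h : tri b d i p.

Lemma tri_id : i ** d = 0.
Proof. exact: (tri_pi (tri_rot h)). Qed.

Lemma tri_dp : d ** Omf p = 0.
Proof. exact: (tri_pi (tri_rot (tri_rot h))). Qed.

Lemma tri_exact_fib V (phi : hhom H V X) : i ** phi = 0 -> exists psi, phi = d ** psi.
Proof. exact: (tri_exact_mid (tri_rot h)). Qed.

Lemma tri_exact_conn V (phi : hhom H V (Om Z)) :
  d ** phi = 0 -> exists psi, phi = Omf p ** psi.
Proof. exact: (tri_exact_mid (tri_rot (tri_rot h))). Qed.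

Lemma tri_lift V (phi : hhom H V Z) : d ** Omf phi = 0 -> exists psi, phi = p ** psi.
Proof.
move=> /tri_exact_conn [psi e]; have [f ef] := lmor_full psi.
by exists f; apply: (@lmor_inj R H W); rewrite e ef lmor_comp.
Qed.

End More.

Lemma tri_co_conn_zero b T X Z (d : hhom H (Om T) X) (i : hhom H X Z) (p : hhom H Z T) :
  tri b d i p -> hid H Z = 0 -> invertible d.
Proof.
move=> h e0.
have z1 V (f : hhom H V Z) : f = 0 := hid0_hom f e0.
have [s es] := tri_exact_fib h (phi := hid H X) (z1 _ _).
exists s; split=> //.
have : d ** (s ** d - hid H _) = 0.
  by rewrite hcompBr hcompA -es hcomp1l hcomp1r subrr.
move=> /(tri_exact_conn h) [psi].
rewrite -[Omf p ** psi]hcomp1l.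
have -> : p = 0 by rewrite -[p]hcomp1r e0 hcomp0r.
by rewrite lmor0 hcomp0l hcomp0r => /eqP; rewrite subr_eq0 => /eqP.
Qed.

Section Contra.
Variables (b : bool) (X Y Z : module R).
Variables (d : hhom H (Om Z) X) (i : hhom H X Y) (p : hhom H Y Z).
Hypothesis h : tri b d i p.

(** The map g extends to a morphism from the rotated triangle to the one over 0 -> T, whose
    connecting map out of the loops of T is invertible. Its component on fibres is thus the loops of
    a map k, the required factor. *)
Lemma tri_desc_mid T (g : hhom H Y T) : g ** i = 0 -> exists k, g = k ** p.
Proof.
move=> e; have [F [d' [i' h']]] := tri_fibre (~~ b) (loc (from_zero T)).
have [c1 c2] := tri_co_conn_zero h' (hid_zero_module H).
have [|x [x1 x2]] := tri_map_fib (y := 0) (z := g) (tri_rot h) h'.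
  by rewrite e hcomp0r.
have [k ek] := lmor_full (c1 ** x).
exists k; apply: (@lmor_inj R H W); rewrite lmor_comp -ek -hcompA x2 hcompA.
by rewrite (proj1 c2) hcomp1l.
Qed.

End Contra.

Section Contra2.
Variables (b : bool) (X Y Z : module R).
Variables (d : hhom H (Om Z) X) (i : hhom H X Y) (p : hhom H Y Z).
Hypothesis h : tri b d i p.

Lemma tri_desc_fib T (g : hhom H X T) : g ** d = 0 -> exists k, g = k ** i.
Proof. exact: (tri_desc_mid (tri_rot h)). Qed.

Lemma tri_desc_conn T (g : hhom H (Om Z) T) : g ** Omf p = 0 -> exists k, g = k ** d.
Proof. exact: (tri_desc_mid (tri_rot (tri_rot h))). Qed.

End Contra2.

Lemma tri_map_mid b X Y Z X' Y' Z' (d : hhom H (Om Z) X) (i : hhom H X Y) (p : hhom H Y Z)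
    (d' : hhom H (Om Z') X') (i' : hhom H X' Y') (p' : hhom H Y' Z') x z :
  tri b d i p -> tri b d' i' p' -> x ** d = d' ** Omf z ->
  exists y, y ** i = i' ** x /\ p' ** y = z ** p.
Proof.
move=> h h' e.
have [w [w1 w2]] := tri_map_fib (tri_rot (tri_rot h)) (tri_rot (tri_rot h')) e.
have [y ey] := lmor_full w; exists y.
by split; apply: (@lmor_inj R H W); rewrite !lmor_comp -ey.
Qed.

(* If 1 - u squares to zero then 2 - u is inverse to u. *)
Lemma invertible_unipotent X (u : hhom H X X) :
  (hid H X - u) ** (hid H X - u) = 0 -> invertible u.
Proof.
move=> e; exists (hid H X + (hid H X - u)).
have {e} e : u ** u = u + u - hid H X.
  move/eqP: e; rewrite hcompBl !hcompBr !hcomp1l hcomp1r subr_eq0 => /eqP e.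
  have -> : u ** u = u - (u - u ** u) by rewrite opprB addrC subrK.
  by rewrite -e opprB addrA.
rewrite addrA hcompBl hcompBr hcompDl hcompDr hcomp1l hcomp1r e.
by rewrite opprB addrC -addrA addNr addr0.
Qed.

Lemma invertible_sides X Y (f : hhom H X Y) (g g' : hhom H Y X) :
  invertible (g ** f) -> invertible (f ** g') -> invertible f.
Proof.
move=> [k [k1 _]] [l [_ l2]]; exists (k ** g); split; first by rewrite -hcompA.
have e : k ** g = g' ** l.
  by rewrite -[LHS]hcomp1r -l2 !hcompA -(hcompA k) k1 hcomp1l.
by rewrite e hcompA.
Qed.

(** The difference 1 - u factors through d, and u fixes d, so it squares to zero. *)
Lemma tri_end_fib b X Y Z (d : hhom H (Om Z) X) (i : hhom H X Y) (p : hhom H Y Z) u :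
  tri b d i p -> i ** u = i -> u ** d = d -> invertible u.
Proof.
move=> h iu ud; apply: invertible_unipotent.
have [|w ew] := tri_exact_fib h (phi := hid H X - u).
  by rewrite hcompBr hcomp1r iu subrr.
by rewrite [X in _ ** X]ew hcompA hcompBl hcomp1l ud subrr hcomp0l.
Qed.

Lemma tri_end_mid b X Y Z (d : hhom H (Om Z) X) (i : hhom H X Y) (p : hhom H Y Z) u :
  tri b d i p -> u ** i = i -> p ** u = p -> invertible u.
Proof.
move=> h iu ud; apply: invertible_unipotent.
have [|w ew] := tri_exact_mid h (phi := hid H Y - u).
  by rewrite hcompBr hcomp1r ud subrr.
by rewrite [X in _ ** X]ew hcompA hcompBl hcomp1l iu subrr hcomp0l.
Qed.

Lemma tri_fib_unique b X X' Y Z (d : hhom H (Om Z) X) (i : hhom H X Y) (p : hhom H Y Z)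
    (d' : hhom H (Om Z) X') (i' : hhom H X' Y) :
  tri b d i p -> tri b d' i' p -> exists x, [/\ invertible x, i' ** x = i & x ** d = d'].
Proof.
move=> h h'.
have sq : hid H Z ** p = p ** hid H Y by rewrite hcomp1l hcomp1r.
have [x [x1 x2]] := tri_map_fib h h' sq; have [y [y1 y2]] := tri_map_fib h' h sq.
move: x1 x2 y1 y2; rewrite lmor_id !hcomp1l !hcomp1r => x1 x2 y1 y2.
exists x; split=> //; apply: (invertible_sides (g := y) (g' := y)).
  by apply: (tri_end_fib h); rewrite ?hcompA ?y1 // -hcompA x2.
by apply: (tri_end_fib h'); rewrite ?hcompA ?x1 // -hcompA y2.
Qed.

(** Strict fibres are compared with the fibre of [fibL_theory], which is why the orientation is
    [true]. *)
Lemma fibre_seq_tri X Y Z (i : hhom H X Y) (p : hhom H Y Z) :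
  fibre_seq i p <-> exists d, tri true d i p.
Proof.
split.
- move=> [F [E [B [i0 [p0 [x [y [z [hs [hx hy hz] yi zp]]]]]]]]].
  have [c [hc ec]] := strict_fibre_equiv hs.
  have hcx : invertible (loc c ** x) by apply: invertible_comp hx; apply: invertible_loc.
  have [k [k1 k2]] := hcx.
  exists (k ** fconn W (fibL_theory R) p0 ** Omf z).
  exists E, B, p0, (loc c ** x), y, z; split=> //; split=> //.
    by rewrite yi -ec hloc_comp -hcompA.
  by rewrite -!hcompA (hcompA x) (hcompA (loc c)) (hcompA (loc c)) k2 hcomp1l.
- move=> [d [E [B [f [x [y [z [hx hy hz [yi zp xd]]]]]]]]].
  pose c : mmap E (hpb_module f (mmap_id B)) :=
    @mhpb_const R _ _ _ _ f (mmap_id B) (mmap_id E) f (fun _ _ _ => erefl).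
  have hc : level_equiv c.
    apply: (level_equiv_section (r := mhpb1 f (mmap_id B))) => //.
    by apply: mhpb1_equiv; apply: level_equiv_id.
  exists _, _, _, (fibre_incl f), (mhpb2 f (mmap_id B)), x, (loc c ** y), z; split.
  + exact: fibre_incl_strict.
  + by split=> //; apply: invertible_comp hy; apply: invertible_loc.
  + rewrite -hcompA yi hcompA; congr (_ ** _).
    have hr : level_equiv (mhpb1 f (mmap_id B)).
      by apply: mhpb1_equiv; apply: level_equiv_id.
    apply: (invertible_monic (invertible_loc H hr)).
    by rewrite hcompA -!hloc_comp; apply: congr1; apply: mmap_ext.
  + rewrite zp hcompA -hloc_comp.
    by have -> : mmap_comp (mhpb2 f (mmap_id B)) c = f by apply: mmap_ext.
Qed.

End Triangles.

(** * Even epimorphisms *)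

Section Even.
Variables (R : E1ring) (H : hocat R) (W : loop_functor H).
Implicit Types X Y Z V : module R.
Local Notation "g ** f" := (hcomp g f) (at level 40, left associativity).
Local Notation loc := (hloc H).
Local Notation Om := (lob W).
Local Notation Omf := (lmor W).
Local Notation ftri := (@tri R H W true _ _ _).

(* A fibre sequence with zero connecting map exhibits Y + Y as its middle term. *)
Lemma biproduct X Z : exists Y (i : hhom H X Y) (r : hhom H Y X) (s : hhom H Z Y)
    (p : hhom H Y Z),
  [/\ r ** i = hid H X, p ** s = hid H Z, r ** s = 0, p ** i = 0 &
      forall V (f : hhom H V X) (g : hhom H V Z), exists u, r ** u = f /\ p ** u = g] /\
  [/\ i ** r + s ** p = hid H Y &
      Omf i ** Omf r + Omf s ** Omf p = hid H (Om Y)].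
Proof.
have [Y [i [p h]]] := tri_cofibre true (0 : hhom H (Om Z) X).
have [r er] : exists r, hid H X = r ** i by apply: (tri_desc_fib h); rewrite hcomp0r.
have [s0 es0] : exists s, hid H Z = p ** s by apply: (tri_lift h); rewrite hcomp0l.
have pi := tri_pi h.
pose s := s0 - i ** (r ** s0).
have rs : r ** s = 0 by rewrite /s hcompBr !hcompA -er hcomp1l subrr.
have ps : p ** s = hid H Z by rewrite /s hcompBr hcompA pi hcomp0l subr0 -es0.
have E : i ** r + s ** p = hid H Y.
  have [|w ew] := tri_desc_mid h (g := hid H Y - (i ** r + s ** p)).
    by rewrite hcompBl hcompDl hcomp1l -!hcompA -er pi hcomp0r hcomp1r addr0 subrr.
  have : w ** (p ** s) = 0.
    rewrite hcompA -ew hcompBl hcompDl hcomp1l -!hcompA rs hcomp0r add0r ps hcomp1r.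
    exact: subrr.
  rewrite ps hcomp1r => w0; move/eqP: ew; rewrite w0 hcomp0l subr_eq0 => /eqP.
  by move=> <-.
have E' : Omf i ** Omf r + Omf s ** Omf p = hid H (Om Y).
  have [|w ew] := tri_exact_fib (tri_rot (tri_rot h))
     (phi := hid H (Om Y) - (Omf i ** Omf r + Omf s ** Omf p)).
    rewrite hcompBr hcompDr !hcompA -(lmor_comp W p i) -(lmor_comp W p s) pi ps lmor0 lmor_id.
    by rewrite hcomp0l add0r hcomp1l hcomp1r subrr.
  have : Omf r ** (Omf i ** w) = 0.
    rewrite -ew hcompBr hcompDr hcomp1r !hcompA -(lmor_comp W r i) -(lmor_comp W r s) -er rs lmor0 lmor_id.
    by rewrite hcomp1l hcomp0l addr0 subrr.
  rewrite hcompA -lmor_comp -er lmor_id hcomp1l => w0.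
  by move/eqP: ew; rewrite w0 hcomp0r subr_eq0 => /eqP <-.
exists Y, i, r, s, p; split=> //; split=> // V f g.
exists (i ** f + s ** g); split.
  by rewrite hcompDr !hcompA -er rs hcomp1l hcomp0l addr0.
by rewrite hcompDr !hcompA pi ps hcomp1l hcomp0l add0r.
Qed.

(** The sum f + g is a composite through a biproduct of Y with itself, and [biproduct] says that its
    decomposition of the identity survives the loop functor. *)
Lemma lmorD X Y (f g : hhom H X Y) : Omf (f + g) = Omf f + Omf g.
Proof.
have [P [i [r [s [p [[ri ps rs pi lift] [E E']]]]]]] := biproduct Y Y.
have [u [ru pu]] := lift X f g.
have Eu : Omf u = Omf i ** Omf f + Omf s ** Omf g.
  by rewrite -[Omf u]hcomp1l -E' hcompDl -!hcompA -!lmor_comp ru pu.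
have -> : f + g = (r + p) ** u by rewrite hcompDl ru pu.
rewrite lmor_comp Eu hcompDr !hcompA -!lmor_comp !hcompDl ri rs pi ps !hcomp0l add0r addr0.
by rewrite !hcomp1l.
Qed.

Lemma lmorN X Y (f : hhom H X Y) : Omf (- f) = - Omf f.
Proof. by apply/eqP; rewrite -addr_eq0 -lmorD addNr lmor0. Qed.

Lemma lmorB X Y (f g : hhom H X Y) : Omf (f - g) = Omf f - Omf g.
Proof. by rewrite lmorD lmorN. Qed.

Lemma lmor_sum X Y (s : seq (hhom H X Y)) : Omf (\sum_(f <- s) f) = \sum_(f <- s) Omf f.
Proof.
elim: s => [|f s IH]; first by rewrite !big_nil lmor0.
by rewrite !big_cons lmorD IH.
Qed.

Lemma lmornD k X Y (f g : hhom H X Y) : lmorn W k (f + g) = lmorn W k f + lmorn W k g.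
Proof. by elim: k => //= k ->; apply: lmorD. Qed.

Lemma isomorphic_lob X Y : isomorphic H X Y -> isomorphic H (Om X) (Om Y).
Proof. by move=> [f hf]; exists (Omf f); apply: invertible_lmor. Qed.

Lemma isomorphic_lobn k X Y : isomorphic H X Y -> isomorphic H (lobn W k X) (lobn W k Y).
Proof. by move=> h; elim: k => //= k; apply: isomorphic_lob. Qed.

Lemma perfect_even_iso X Y : isomorphic H X Y -> perfect_even W X -> perfect_even W Y.
Proof. by move=> [f [g [e e']]]; apply: pe_retract; exists g, f. Qed.

Lemma lobn_add m k X : lobn W m (lobn W k X) = lobn W (m + k) X.
Proof. by rewrite /lobn iterD. Qed.

(** Three rotations loop a triangle once and exchange the two kinds of fibre; six return to the kind
    that fibre sequences use. *)
Lemma fibre_seq_loop2 X Y Z (i : hhom H X Y) (p : hhom H Y Z) : fibre_seq i p ->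
  exists (i' : hhom H (Om (Om X)) (Om (Om Y))) (p' : hhom H (Om (Om Y)) (Om (Om Z))),
    fibre_seq i' p'.
Proof.
move=> /(fibre_seq_tri W) [d h].
have h6 := tri_rot (tri_rot (tri_rot (tri_rot (tri_rot (tri_rot h))))).
by exists (Omf (Omf i)), (Omf (Omf p)); apply/(fibre_seq_tri W); exists (Omf (Omf d)).
Qed.

Lemma perfect_even_loop2 X : perfect_even W X -> perfect_even W (Om (Om X)).
Proof.
elim=> {X} [k X h|[|k] X h|X Y Z i p h _ IHX _ IHZ|X Y [i [r e]] _ IH].
- apply: (@pe_desusp R H W k.+1); exact: (isomorphic_lobn 2 h).
- by apply: (@pe_desusp R H W 1); apply: (isomorphic_lobn 2 h).
- apply: (@pe_susp R H W k); rewrite (lobn_add _ 2) addn2.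
  by move: h; rewrite doubleS.
- by have [i' [p' h']] := fibre_seq_loop2 h; apply: pe_ext h' _ _.
- apply: pe_retract IH; exists (Omf (Omf i)), (Omf (Omf r)).
  by rewrite -!lmor_comp e !lmor_id.
Qed.

Lemma perfect_even_zero X : hid H X = 0 -> perfect_even W X.
Proof.
move=> e; apply: (pe_retract (Y := regular R)).
  by exists 0, 0; rewrite hcomp0l e.
by apply: (@pe_desusp R H W 0); exists (hid H _); apply: invertible_id.
Qed.

Lemma even_epi_tri (A B : perf W) (p : hhom H B A) : even_epi p ->
  exists (K : perf W) (i : hhom H K B) d, ftri d i p.
Proof. by move=> [K [i /(fibre_seq_tri W) [d h]]]; exists K, i, d. Qed.

Lemma tri_even_epi (A B K : perf W) (p : hhom H B A) (i : hhom H K B) d :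
  ftri d i p -> even_epi p.
Proof. by move=> h; exists K, i; apply/(fibre_seq_tri W); exists d. Qed.

Lemma tri_perfect_even X Y Z (i : hhom H X Y) (p : hhom H Y Z) d : ftri d i p ->
  perfect_even W X -> perfect_even W Z -> perfect_even W Y.
Proof. by move=> h; apply: (pe_ext (i := i) (p := p)); apply/(fibre_seq_tri W); exists d. Qed.

Lemma even_epi_fibre (A B : perf W) (p : hhom H B A) X (i : hhom H X B) d :
  even_epi p -> ftri d i p -> perfect_even W X.
Proof.
move=> /even_epi_tri [K [i' [d' h']]] h.
have [x [hx _ _]] := tri_fib_unique h' h.
by apply: (perfect_even_iso (X := K)); [exists x | apply: perfP].
Qed.

Lemma even_epi_iso (A B : perf W) (p : hhom H B A) : invertible p -> even_epi p.
Proof.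
move=> [q [qp pq]]; have [X [d [i h]]] := tri_fibre W true p.
have i0 : i = 0 by rewrite -[i]hcomp1l -qp -hcompA (tri_pi h) hcomp0r.
have [|psi e] := tri_exact_fib h (phi := hid H X); first by rewrite i0 hcomp0l.
have d0 : d = 0.
  by rewrite -[d]hcomp1r -lmor_id -pq lmor_comp hcompA (tri_dp h) hcomp0l.
apply: (@tri_even_epi _ _ (Perf (perfect_even_zero (X := X) _)) _ i d) => //.
by rewrite e d0 hcomp0l.
Qed.

(* The strict fibre sequence fib q -> fib (p q) -> fib p is the only instance of
   the octahedral axiom that is needed. *)
Lemma even_epi_comp (A B C : perf W) (p : hhom H B A) (q : hhom H C B) :
  even_epi p -> even_epi q -> even_epi (p ** q).
Proof.
move=> hp hq.
have [B1 [w [p1 [k [hw kw wk ep]]]]] := fraction_inv p.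
have [C1 [v [q1 [l [hv lv vl eq]]]]] := fraction_inv (k ** q).
have hk : invertible k by exists (loc w).
have hl : invertible l by exists (loc v).
pose T := theory_of R true.
have peq : perfect_even W (fib T q1).
  apply: (even_epi_fibre (i := loc v ** loc (fpi T q1))
    (d := fconn W T q1 ** Omf k) hq).
  apply: (tri_iso (x := hid H _) (y := l) (z := k) (tri_strict W true q1)) => //.
  - exact: invertible_id.
  - by rewrite hcompA lv hcomp1l hcomp1r.
  - by rewrite hcomp1l.
have pep : perfect_even W (fib T p1).
  apply: (even_epi_fibre (i := loc w ** loc (fpi T p1)) (d := fconn W T p1) hp).
  apply: (tri_iso (x := hid H _) (y := k) (z := hid H _) (tri_strict W true p1)) => //.
  - exact: invertible_id.
  - exact: invertible_id.
  - by rewrite hcompA kw hcomp1l hcomp1r.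
  - by rewrite hcomp1l.
  - by rewrite lmor_id hcomp1l hcomp1r.
pose q2 := mhpb2 q1 (mmap_id B1); pose f := mmap_comp p1 q2.
have pef : perfect_even W (fib T f).
  apply: (pe_ext (i := loc (comp_fibre_incl q1 p1)) (p := loc (comp_fibre_proj q1 p1)) _ peq pep).
  exists _, _, _, (comp_fibre_incl q1 p1), (comp_fibre_proj q1 p1), (hid H _), (hid H _), (hid H _).
  split; first exact: comp_fibre_strict.
  - by split; apply: invertible_id.
  - by rewrite hcomp1l hcomp1r.
  - by rewrite hcomp1l hcomp1r.
pose c : mmap C1 (hpb_module q1 (mmap_id B1)) :=
  @mhpb_const R _ _ _ _ q1 (mmap_id B1) (mmap_id C1) q1 (fun _ _ _ => erefl).
have hc : level_equiv c.
  apply: (level_equiv_section (r := mhpb1 q1 (mmap_id B1))) => //.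
  by apply: mhpb1_equiv; apply: level_equiv_id.
have [c' [c1 c2]] := hloc_equiv H hc.
have cq : loc q2 ** loc c = loc q1 by rewrite -hloc_comp; apply: congr1; apply: mmap_ext.
apply: (@tri_even_epi _ _ (Perf pef) _ (loc v ** c' ** loc (fpi T f)) (fconn W T f)).
apply: (tri_iso (x := hid H _) (y := loc c ** l) (z := hid H _) (tri_strict W true f)).
- exact: invertible_id.
- by apply: invertible_comp => //; apply: invertible_loc.
- exact: invertible_id.
- rewrite hcomp1r !hcompA -(hcompA (loc c)) lv hcomp1r c2 hcomp1l //.
- by rewrite hcomp1l hloc_comp -hcompA (hcompA (loc q2)) cq -eq ep -!hcompA.
- by rewrite lmor_id hcomp1l hcomp1r.
Qed.

(** The pullback is the extension of C by K whose connecting map is that of p restricted along f; in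
    particular it is again perfect even. *)
Lemma even_epi_pullback (A B C : perf W) (p : hhom H B A) (f : hhom H C A) :
  even_epi p -> exists (D : perf W) (q : hhom H D C) (g : hhom H D B),
    even_epi q /\ p ** g = f ** q.
Proof.
move=> /even_epi_tri [K [i [d h]]].
have [D [j [q h']]] := tri_cofibre true (d ** Omf f).
have pD : perfect_even W D by apply: (tri_perfect_even h'); apply: perfP.
have [|g [_ g2]] := tri_map_mid (x := hid H K) (z := f) h' h; first by rewrite hcomp1l.
by exists (Perf pD), q, g; split=> //; apply: (tri_even_epi (B := Perf pD) h').
Qed.

(* A map from a perfect even module to the loops of one is locally zero: its
   fibre is an extension of the source by double loops. *)
Lemma loop_target_local (C : perf W) X (f : hhom H C (Om X)) : perfect_even W X ->
  exists (D : perf W) (q : hhom H D C), even_epi q /\ f ** q = 0.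
Proof.
move=> hX; have [D [d [q h]]] := tri_fibre W false f.
have h' := tri_rot h.
have pK : perfect_even W (Om (Om X)) by apply: perfect_even_loop2.
have pD : perfect_even W D by apply: (tri_perfect_even h') => //; apply: perfP.
exists (Perf pD), q; split; first exact: (@tri_even_epi _ (Perf pD) (Perf pK) _ _ _ h').
exact: (tri_pi h).
Qed.

Lemma even_epi_refine (A B B' : perf W) (p : hhom H B A) (p' : hhom H B' A) :
  even_epi p -> even_epi p' -> exists (D : perf W) (g : hhom H D B) (g' : hhom H D B'),
    even_epi (p ** g) /\ p ** g = p' ** g'.
Proof.
move=> hp hp'; have [D [q [g [hq e]]]] := even_epi_pullback p' hp.
by exists D, g, q; rewrite e; split=> //; apply: even_epi_comp.
Qed.

End Even.

(** * Cells *)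

Section Cells.
Variables (R : E1ring) (H : hocat R) (W : loop_functor H).
Implicit Types X Y Z V : module R.
Local Notation "g ** f" := (hcomp g f) (at level 40, left associativity).
Local Notation Om := (lob W).
Local Notation Omf := (lmor W).
Local Notation ftri := (@tri R H W true _ _ _).
Local Notation Rm := (regular R).

Lemma lmorn_full m X Y (h : hhom H (lobn W m X) (lobn W m Y)) : exists f, h = lmorn W m f.
Proof.
elim: m h => [|m IH] h; first by exists h.
by have [g ->] := lmor_full h; have [f ->] := IH g; exists f.
Qed.

Lemma lmorn0 m X Y : lmorn W m (0 : hhom H X Y) = 0.
Proof. by elim: m => //= m ->; apply: lmor0. Qed.

Lemma lmorn_inj m X Y (f g : hhom H X Y) : lmorn W m f = lmorn W m g -> f = g.
Proof. by elim: m => //= m IH /lmor_inj /IH. Qed.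

Lemma tri_lobn m X Y Z b (d : hhom H (Om Z) X) (i : hhom H X Y) (p : hhom H Y Z) :
  tri b d i p -> exists b' (d' : hhom H (Om (lobn W m Z)) (lobn W m X)),
    tri b' d' (lmorn W m i) (lmorn W m p).
Proof.
move=> h; elim: m => [|m [b' [d' h']]]; first by exists b, d.
by exists (~~ ~~ ~~ b'), (Omf d'); apply/tri_rot/tri_rot/tri_rot.
Qed.

(** The loops common to both sides cancel because the loop functor is full; what remains is an
    element of a negative homotopy group of M. *)
Lemma connective_vanish (M : module R) : connective W M ->
  forall a b, (b < a)%N -> forall f : hhom H (lobn W a Rm) (lobn W b M), f = 0.
Proof.
move=> hM a b ab; have -> : a = (b + (a - b).-1.+1)%N by lia.
rewrite -lobn_add => f; have [g ->] := lmorn_full f.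
by rewrite (hM _ g) lmorn0.
Qed.

Inductive cell (j : nat) : module R -> Prop :=
| cell_zero X : hid H X = 0 -> cell j X
| cell_loop k X : (j <= k)%N -> isomorphic H X (lobn W k.*2 Rm) -> cell j X
| cell_ext X Y Z (d : hhom H (Om Z) X) (i : hhom H X Y) (p : hhom H Y Z) :
    ftri d i p -> cell j X -> cell j Z -> cell j Y.

Lemma cell_perf j X : cell j X -> perfect_even W X.
Proof.
elim=> {X} [X|k X _|X Y Z d i p h _ IHX _ IHZ].
- exact: perfect_even_zero.
- exact: pe_desusp.
- exact: tri_perfect_even h IHX IHZ.
Qed.

Lemma cell_le j k X : (j <= k)%N -> cell k X -> cell j X.
Proof.
move=> jk; elim=> {X} [X|l X kl|X Y Z d i p h _ IHX _ IHZ].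
- exact: cell_zero.
- exact: cell_loop (leq_trans jk kl).
- exact: cell_ext h IHX IHZ.
Qed.

Lemma cell_vanish m j (A N : module R) : cell j A ->
  (forall k, (j <= k)%N -> forall f : hhom H (lobn W (m + k.*2) Rm) N, f = 0) ->
  forall f : hhom H (lobn W m A) N, f = 0.
Proof.
move=> hA hN; elim: hA => {A} [X e|k X jk [u [v [uv vu]]]|X Y Z d i p h _ IHX _ IHZ] f.
- have : lmorn W m (hid H X) = 0 by rewrite e lmorn0.
  by rewrite lmorn_id => e'; rewrite -[f]hcomp1r e' hcomp0r.
- rewrite -[f]hcomp1r -lmorn_id -uv lmorn_comp hcompA.
  suff -> : f ** lmorn W m v = 0 by rewrite hcomp0l.
  by move: (f ** _); rewrite lobn_add => f'; apply: hN f'.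
- have [b' [d' h']] := tri_lobn m h.
  have [|k ->] := tri_desc_mid h' (g := f); first exact: IHX.
  by rewrite (IHZ k) hcomp0l.
Qed.

Definition approximates (j : nat) L G (l : hhom H L G) : Prop :=
  (forall m, (j.*2 <= m.+1)%N -> forall f : hhom H (lobn W m Rm) G, exists g, f = l ** g) /\
  (forall m, (j.*2 <= m)%N -> forall g : hhom H (lobn W m Rm) L, l ** g = 0 -> g = 0).

Lemma approximates_lift j i L G (l : hhom H L G) (A : module R) : (0 < j <= i.+1)%N ->
  approximates j l -> cell i A -> forall f : hhom H (Om A) G, exists g, f = l ** g.
Proof.
move=> /andP [j0 ji] [ls li] hA f.
have [F [d [u h]]] := tri_fibre W true l.
have vF m : (j.*2 <= m)%N -> forall g : hhom H (lobn W m Rm) F, g = 0.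
  move=> jm g.
  have /(tri_exact_fib h) [psi ->] : u ** g = 0.
    by apply: (li m jm); rewrite hcompA (tri_pi h) hcomp0l.
  case: m jm psi {g} => [|m] jm psi; first by lia.
  have [psi' ->] := lmor_full psi; have [g ->] := ls m jm psi'.
  by rewrite lmor_comp hcompA (tri_dp h) hcomp0l.
apply: (tri_lift h).
apply: (cell_vanish (m := 2) hA) => k ik g.
by apply: vF; rewrite -(doubleD 1) leq_double; lia.
Qed.

Section Extension.
Variables (j : nat) (j0 : (0 < j)%N).
Variables (L1 L L3 G1 G G3 : module R) (dL : hhom H (Om L3) L1) (iL : hhom H L1 L)
  (pL : hhom H L L3) (dG : hhom H (Om G3) G1) (iG : hhom H G1 G) (pG : hhom H G G3)
  (l1 : hhom H L1 G1) (l : hhom H L G) (l3 : hhom H L3 G3).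
Hypotheses (hL : ftri dL iL pL) (hG : ftri dG iG pG).
Hypotheses (sqd : l1 ** dL = dG ** Omf l3) (sqi : l ** iL = iG ** l1)
  (sqp : pG ** l = l3 ** pL).

(** The five lemma; surjectivity one degree further than injectivity is the range that it
    preserves. *)
Lemma approximates_ext : approximates j l1 -> approximates j l3 -> approximates j l.
Proof.
move=> [s1 i1] [s3 i3]; split=> m jm.
- move=> f; have [a ea] := s3 m jm (pG ** f).
  have [|c ec] := tri_lift hL (phi := a).
    apply: (i1 m.+1) => //.
    by rewrite hcompA sqd -hcompA -lmor_comp -ea lmor_comp hcompA (tri_dp hG) hcomp0l.
  have [|e ee] := tri_exact_mid hG (phi := f - l ** c).
    by rewrite hcompBr ea hcompA sqp -hcompA -ec subrr.
  have [e' ee'] := s1 m jm e.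
  exists (c + iL ** e'); rewrite hcompDr hcompA sqi -hcompA -ee' -ee.
  by rewrite addrC subrK.
- move=> g lg.
  have /(tri_exact_mid hL) [a ea] : pL ** g = 0.
    by apply: (i3 m jm); rewrite hcompA -sqp -hcompA lg hcomp0r.
  have /(tri_exact_fib hG) [b eb] : iG ** (l1 ** a) = 0.
    by rewrite hcompA -sqi -hcompA -ea.
  case: m jm g a b ea eb lg => [|m] jm g a b ea eb lg; first by lia.
  have [b' eb'] := lmor_full b; have [c ec] := s3 m jm b'.
  have : a - dL ** Omf c = 0.
    apply: (i1 m.+1 jm); rewrite hcompBr eb eb' ec lmor_comp !hcompA sqd.
    by rewrite subrr.
  by move/subr0_eq => ea'; rewrite ea ea' hcompA (tri_id hL) hcomp0l.
Qed.

End Extension.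

Lemma approximates_id j X : approximates j (hid H X).
Proof.
split=> m _ f; first by exists f; rewrite hcomp1l.
by rewrite hcomp1l.
Qed.

Lemma approximates_zero j X Z : hid H Z = 0 ->
  (forall m, (j.*2 <= m.+1)%N -> forall f : hhom H (lobn W m Rm) X, f = 0) ->
  approximates j (0 : hhom H Z X).
Proof.
move=> e0 hX; split=> m jm f; first by exists 0; rewrite hcomp0r; apply: (hX m).
by move=> _; rewrite -[f]hcomp1l e0 hcomp0l.
Qed.

(** The retractions of the outer terms respect the connecting maps, so the middle terms receive maps
    whose composite on Y is compatible with i and p. It need not be the identity but is invertible
    by [tri_end_mid]. *)
Lemma retract_tri X Y Z X' Y' Z' (d : hhom H (Om Z) X) (i : hhom H X Y) (p : hhom H Y Z)
    (d' : hhom H (Om Z') X') (i' : hhom H X' Y') (p' : hhom H Y' Z') x r z s :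
  ftri d i p -> ftri d' i' p' -> r ** x = hid H X -> s ** z = hid H Z ->
  x ** d = d' ** Omf z -> r ** d' = d ** Omf s -> retract_of H Y Y'.
Proof.
move=> h h' rx sz e e'.
have [y [y1 y2]] := tri_map_mid h h' e; have [t [t1 t2]] := tri_map_mid h' h e'.
have [k [k1 k2]] : invertible (t ** y).
  apply: (tri_end_mid h).
    by rewrite -hcompA y1 hcompA t1 -hcompA rx hcomp1r.
  by rewrite hcompA t2 -hcompA y2 hcompA sz hcomp1l.
by exists y, (k ** t); rewrite -hcompA.
Qed.

Hypothesis hR : connective W Rm.

(* Counting lobn W m R as a cell of dimension -m, the module L consists of the
   cells of G of dimension at most -2j. *)
Lemma approximation j K : (0 < j)%N -> perfect_even W K ->
  exists L G (l : hhom H L G), [/\ retract_of H K G, cell j L & approximates j l].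
Proof.
move=> j0; elim=> {K} [k X [u [v [uv vu]]]|k X [u [v [uv vu]]]|
  X Y Z i p h _ [L1 [G1 [l1 [[x [r rx]] c1 a1]]]] _ [L3 [G3 [l3 [[z [s sz]] c3 a3]]]]|
  X Y [i [r e]] _ [L [G [l [[i' [r' e']] c a]]]]].
- have hX : isomorphic H X (lobn W k.*2 Rm) by exists u, v.
  (* For k < j the module is not seen: m >= 2j - 1 > 2k, and by connectivity of R there are no maps
     from Loops^m R to Loops^(2k) R. *)
  case: (leqP j k) => jk.
    exists X, X, (hid H X); split; [|exact: cell_loop hX|exact: approximates_id].
    by exists (hid H X), (hid H X); rewrite hcomp1l.
  exists (zero_module R), X, 0; split.
  + by exists (hid H X), (hid H X); rewrite hcomp1l.
  + exact/cell_zero/hid_zero_module.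
  + apply: approximates_zero; first exact: hid_zero_module.
    move=> m jm f; rewrite -[f]hcomp1l -uv -hcompA.
    rewrite (connective_vanish hR (a := m) (b := k.*2) _ (u ** f)) ?hcomp0r //.
    by move: jm; rewrite -!addnn; lia.
- exists (zero_module R), X, 0; split.
  + by exists (hid H X), (hid H X); rewrite hcomp1l.
  + exact/cell_zero/hid_zero_module.
  + apply: approximates_zero; first exact: hid_zero_module.
    move=> m jm f; apply: (lmorn_inj (m := k.*2)); rewrite lmorn0.
    rewrite -[LHS]hcomp1l -uv -hcompA.
    suff -> : u ** lmorn W k.*2 f = 0 by rewrite hcomp0r.
    move: (u ** _); rewrite lobn_add => f'.
    have m0 : (0 < m)%N by move: jm; rewrite -addnn; lia.
    by apply: (connective_vanish hR (b := 0)); rewrite addn_gt0 m0 orbT.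
- have [d {}h] := (fibre_seq_tri W i p).1 h.
  (* The retractions carry the connecting map d to a map from the loops of G3 to G1, with cofibre G.
     Restricted to the loops of the j-cell L3 it lifts to L1, and the lift has the wanted L as its
     cofibre. *)
  have [G [iG [pG hG]]] := tri_cofibre true (x ** d ** Omf s).
  have [dL edL] : exists dL, x ** d ** Omf s ** Omf l3 = l1 ** dL.
    apply: (approximates_lift (j := j) (i := j)) a1 c3 _.
    by rewrite j0 leqnSn.
  have [L [iL [pL hL]]] := tri_cofibre true dL.
  have [l [l_i l_p]] := tri_map_mid hL hG (esym edL).
  exists L, G, l; split.
  + apply: (retract_tri h hG rx sz).
      by rewrite -[RHS]hcompA -lmor_comp sz lmor_id hcomp1r.
    by rewrite !hcompA rx hcomp1l.
  + exact: cell_ext hL c1 c3.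
  + exact: (approximates_ext j0 hL hG (esym edL) l_i l_p a1 a3).
- exists L, G, l; split=> //; exists (i' ** i), (r ** r').
  by rewrite -hcompA (hcompA r') e' hcomp1l e.
Qed.

(** The connecting map, followed by the inclusion of K into G as a retract, lifts to the (i+1)-cell
    L because A is an i-cell. The cofibre D of the lift maps to B over A by way of l and the
    retraction of G onto K. *)
Lemma cell_refine i (A B : perf W) (p : hhom H B A) : cell i A -> even_epi p ->
  exists (K D : perf W) (d : hhom H (Om A) K) (j : hhom H K D) (q : hhom H D A)
    (y : hhom H D B),
  [/\ ftri d j q, cell i.+1 K, cell i D & p ** y = q].
Proof.
move=> hA /even_epi_tri [K [u [d h]]].
have [L [G [l [[x [r rx]] cL aL]]]] := approximation (j := i.+1) isT (perfP K).
have [|d' ed'] := approximates_lift (j := i.+1) (i := i) _ aL hA (x ** d); first exact: leqnn.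
have [D [j [q h']]] := tri_cofibre true d'.
have cD : cell i D by apply: (cell_ext h' _ hA); apply: cell_le cL.
have [|y [y1 y2]] := tri_map_mid (x := r ** l) (z := hid H A) h' h.
  by rewrite lmor_id hcomp1r -hcompA -ed' hcompA rx hcomp1l.
exists (Perf (cell_perf cL)), (Perf (cell_perf cD)), d', j, q, y; split=> //.
by rewrite y2 hcomp1l.
Qed.

End Cells.

(** * Sheafification *)

Local Open Scope quotient_scope.

Section Additive.
Variables U V : zmodType.

Lemma additive_exists (f : U -> V) : zmod_morphism f ->
  exists g : {additive U -> V}, forall x, g x = f x.
Proof.
move=> hf.
pose g : {additive U -> V} := HB.pack f (GRing.isZmodMorphism.Build U V f hf).
by exists g.
Qed.

Lemma additive_rel (Rl : U -> V -> Prop) : (forall u, exists v, Rl u v) ->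
  (forall v, Rl 0 v -> v = 0) ->
  (forall u v u' v', Rl u v -> Rl u' v' -> Rl (u - u') (v - v')) ->
  exists f : {additive U -> V}, forall u v, Rl u v <-> f u = v.
Proof.
move=> tot zero sub; have [f hf] := choice tot.
have fun_ u v : Rl u v -> f u = v.
  move=> h; apply/subr0_eq/zero; rewrite -(subrr u); exact: sub.
have [|g hg] := @additive_exists f.
  by move=> x y; apply/fun_/sub.
exists g => u v; rewrite hg; split; first exact: fun_.
by move=> <-.
Qed.

End Additive.

Section Sheaves.
Variables (R : E1ring) (H : hocat R) (W : loop_functor H).
Implicit Types (A B C D : perf W) (F G S : presheaf W).
Local Notation "g ** f" := (hcomp g f) (at level 40, left associativity).

Definition locally_zero F A (x : F A) : Prop :=
  exists B (p : hhom H B A), even_epi p /\ pres F p x = 0.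

Lemma locally_zero0 F A : locally_zero (0 : F A).
Proof.
exists A, (hid H A); split; last exact: raddf0.
exact/even_epi_iso/invertible_id.
Qed.

Lemma locally_zeroB F A (x y : F A) :
  locally_zero x -> locally_zero y -> locally_zero (x - y).
Proof.
move=> [B [p [hp px]]] [B' [p' [hp' py]]].
have [D [g [g' [he e]]]] := even_epi_refine hp hp'.
exists D, (p ** g); split=> //; rewrite raddfB /= pres_comp px e pres_comp py.
by rewrite !raddf0 addr0.
Qed.

Lemma locally_zero_pres F A B (f : hhom H B A) (x : F A) :
  locally_zero x -> locally_zero (pres F f x).
Proof.
move=> [C [p [hp px]]]; have [D [q [g [hq e]]]] := even_epi_pullback f hp.
by exists D, q; split=> //; rewrite -pres_comp -e pres_comp px raddf0.
Qed.

Lemma locally_zero_local F A B (p : hhom H B A) (x : F A) :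
  even_epi p -> locally_zero (pres F p x) -> locally_zero x.
Proof.
move=> hp [C [q [hq e]]]; exists C, (p ** q); rewrite pres_comp.
by split=> //; apply: even_epi_comp.
Qed.

Lemma sheaf_separated F A B (p : hhom H B A) (x y : F A) :
  is_sheaf F -> even_epi p -> pres F p x = pres F p y -> x = y.
Proof.
move=> hF hp e; have [|z [_ hz]] := hF B A p hp (pres F p x).
- by move=> C g h pgh; rewrite -!pres_comp pgh.
- by rewrite -(hz x) // -(hz y).
Qed.

Lemma sheaf_locally_zero F A (x : F A) : is_sheaf F -> locally_zero x -> x = 0.
Proof.
move=> hF [B [p [hp e]]]; apply: (sheaf_separated hF hp); by rewrite e raddf0.
Qed.

Lemma pshmap_exists F G (f : forall A, F A -> G A) :
  (forall A, zmod_morphism (f A)) ->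
  (forall A B (h : hhom H A B) x, f A (pres F h x) = pres G h (f B x)) ->
  exists u : pshmap F G, forall A x, u A x = f A x.
Proof.
move=> fB fn; have [g hg] := choice_dep (fun A => additive_exists (fB A)).
have gn A B (h : hhom H A B) x : g A (pres F h x) = pres G h (g B x).
  by rewrite !hg fn.
by exists (PshMap gn) => A x; apply: hg.
Qed.

Lemma pshmap_locally_zero F G (u : pshmap F G) A (x : F A) :
  locally_zero x -> locally_zero (u A x).
Proof.
by move=> [B [p [hp e]]]; exists B, p; split=> //; rewrite -pfun_nat e raddf0.
Qed.

Definition locally_injective F G (u : pshmap F G) : Prop :=
  forall A (x : F A), u A x = 0 -> locally_zero x.

Definition locally_surjective F G (u : pshmap F G) : Prop :=
  forall A (y : G A), exists B (p : hhom H B A) (x : F B),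
    even_epi p /\ pres G p y = u B x.

Lemma sheafification_local F G (u : pshmap F G) : is_sheaf G ->
  locally_injective u -> locally_surjective u -> is_sheafification u.
Proof.
move=> hG ui us; split=> // S w hS.
have w0 A (x : F A) : u A x = 0 -> w A x = 0.
  by move=> /ui h; apply: (sheaf_locally_zero hS); apply: pshmap_locally_zero.
split; last first.
  move=> v v' e A y; have [B [p [x [hp ey]]]] := us A y.
  by apply: (sheaf_separated hS hp); rewrite -!pfun_nat ey e.
pose Rl A (y : G A) (a : S A) := exists B (p : hhom H B A) (x : F B),
  [/\ even_epi p, pres G p y = u B x & pres S p a = w B x].
have tot A y : exists a, @Rl A y a.
  have [B [p [x [hp ey]]]] := us A y.
  have [|a [ea _]] := hS B A p hp (w B x); last by exists a, B, p, x.
  move=> C g h pgh; apply/subr0_eq; rewrite -!pfun_nat -raddfB; apply: w0.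
  by rewrite raddfB /= !pfun_nat -ey -!pres_comp pgh subrr.
have zero A a : @Rl A 0 a -> a = 0.
  move=> [B [p [x [hp ey ea]]]]; apply: (sheaf_separated hS hp).
  by rewrite ea raddf0 w0 // -ey raddf0.
have sub A y a y' a' : @Rl A y a -> @Rl A y' a' -> @Rl A (y - y') (a - a').
  move=> [B [p [x [hp ey ea]]]] [B' [p' [x' [hp' ey' ea']]]].
  have [D [g [g' [he e]]]] := even_epi_refine hp hp'.
  exists D, (p ** g), (pres F g x - pres F g' x'); split=> //.
    by rewrite !raddfB /= !pfun_nat -ey -ey' -!pres_comp e.
  by rewrite !raddfB /= !pfun_nat -ea -ea' -!pres_comp e.
have [v hv] := choice_dep (fun A => additive_rel (tot A) (@zero A) (@sub A)).
have vn A B (f : hhom H A B) y : v A (pres G f y) = pres S f (v B y).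
  apply/hv; have /(hv B) [C [p [x [hp ey ea]]]] : v B y = v B y by [].
  have [D [q [g [hq e]]]] := even_epi_pullback f hp.
  exists D, q, (pres F g x); split=> //.
    by rewrite -pres_comp -e pres_comp ey pfun_nat.
  by rewrite -pres_comp -e pres_comp ea pfun_nat.
exists (PshMap vn) => A x; apply/hv; exists A, (hid H A), x.
by split; rewrite ?pres_id //; apply/even_epi_iso/invertible_id.
Qed.

Section Plus.
Variable P : presheaf W.

(* Sections of the associated sheaf over A are represented by families of
   sections of P, one for each map C -> A, of which only the germs along maps
   that factor through a cover B -> A matter; there the family must come, up to
   locally zero sections, from a single section over B. *)
Definition family A := forall C, hhom H C A -> P C.

HB.instance Definition _ A := gen_eqMixin (family A).
HB.instance Definition _ A := gen_choiceMixin (family A).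

Definition family_add A (x y : family A) : family A := fun C f => x C f + y C f.
Definition family_opp A (x : family A) : family A := fun C f => - x C f.
Definition family_zero A : family A := fun C f => 0.

Fact family_ext A (x y : family A) : (forall C f, x C f = y C f) -> x = y.
Proof. by move=> e; apply: functional_extensionality_dep => C; apply: funext. Qed.

Fact family_addA A : associative (@family_add A).
Proof. by move=> x y z; apply: family_ext => C f; apply: addrA. Qed.

Fact family_addC A : commutative (@family_add A).
Proof. by move=> x y; apply: family_ext => C f; apply: addrC. Qed.

Fact family_add0 A : left_id (@family_zero A) (@family_add A).
Proof. by move=> x; apply: family_ext => C f; apply: add0r. Qed.

Fact family_addN A : left_inverse (@family_zero A) (@family_opp A) (@family_add A).
Proof. by move=> x; apply: family_ext => C f; apply: addNr. Qed.

HB.instance Definition _ A := GRing.isZmodule.Build (family A)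
  (@family_addA A) (@family_addC A) (@family_add0 A) (@family_addN A).

Definition coherent A : {pred family A} := fun x =>
  `[< exists B (p : hhom H B A), even_epi p /\
      forall C (g : hhom H C B), locally_zero (x C (p ** g) - pres P g (x B p)) >].

Fact coherent_closed A : zmod_closed (@coherent A).
Proof.
split=> [|x y]; rewrite !unfold_in /coherent.
  apply/asboolP; exists A, (hid H A); split; first exact/even_epi_iso/invertible_id.
  by move=> C g; rewrite raddf0 subrr; apply: locally_zero0.
move=> /asboolP [B [p [hp hx]]] /asboolP [B' [p' [hp' hy]]]; apply/asboolP.
have [D [g [g' [he e]]]] := even_epi_refine hp hp'.
exists D, (p ** g); split=> // C h.
have refine_ (z : family A) (E : perf W) (q : hhom H E A) (k : hhom H D E) :
    (forall C (g : hhom H C E), locally_zero (z C (q ** g) - pres P g (z E q))) ->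
    locally_zero (z C (q ** k ** h) - pres P h (z D (q ** k))).
  move=> hz.
  have h1 := hz C (k ** h); have h2 := locally_zero_pres h (hz D k).
  have := locally_zeroB h1 h2; rewrite raddfB /= pres_comp hcompA.
  by rewrite opprB addrA subrK.
have h1 := refine_ x B p g hx.
have h2 := refine_ y B' p' g' hy; rewrite -e in h2.
have -> : (x - y) C (p ** g ** h) - pres P h ((x - y) D (p ** g)) =
    x C (p ** g ** h) - pres P h (x D (p ** g)) - (y C (p ** g ** h) - pres P h (y D (p ** g))).
  by rewrite -[(x - y) D _]/(x D _ - y D _) raddfB /= !opprD addrACA.
exact: locally_zeroB.
Qed.

HB.instance Definition _ A := GRing.isZmodClosed.Build _ (@coherent A) (@coherent_closed A).

Definition null A : {pred subgroup (@coherent A)} := fun x =>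
  `[< exists B (p : hhom H B A), even_epi p /\
      forall C (g : hhom H C B), locally_zero (val x C (p ** g)) >].

Fact null_closed A : zmod_closed (@null A).
Proof.
split=> [|x y]; rewrite !unfold_in /null.
  apply/asboolP; exists A, (hid H A); split; first exact/even_epi_iso/invertible_id.
  by move=> C g; apply: locally_zero0.
move=> /asboolP [B [p [hp hx]]] /asboolP [B' [p' [hp' hy]]]; apply/asboolP.
have [D [g [g' [he e]]]] := even_epi_refine hp hp'.
exists D, (p ** g); split=> // C h.
have h1 := hx C (g ** h); have h2 := hy C (g' ** h).
by rewrite hcompA -e -hcompA in h2; move: (locally_zeroB h1 h2); rewrite hcompA.
Qed.

HB.instance Definition _ A := GRing.isZmodClosed.Build _ (@null A) (@null_closed A).

Definition plus A : zmodType := Quotient.quot (@null A).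

End Plus.
End Sheaves.

Section PlusSheaf.
Variables (R : E1ring) (H : hocat R) (W : loop_functor H) (P : presheaf W).
Implicit Types (A B C D : perf W).
Local Notation "g ** f" := (hcomp g f) (at level 40, left associativity).
Local Notation sect A := (subgroup (@coherent R H W P A)).

Lemma plus_eqP A (x y : sect A) : (\pi_(plus P A) x = \pi_(plus P A) y) <-> null (x - y).
Proof.
have -> : null (x - y) = (x - y \in @null R H W P A) by [].
by rewrite Quotient.idealrBE; split=> [e|/eqP //]; apply/eqP.
Qed.

Lemma plus_surj A (c : plus P A) : exists x, c = \pi_(plus P A) x.
Proof. by exists (repr c); rewrite reprK. Qed.

Definition family_res A B (f : hhom H A B) (x : family P B) : family P A :=
  fun C g => x C (f ** g).

Lemma family_res_coherent A B (f : hhom H A B) (x : sect B) :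
  family_res f (val x) \in @coherent R H W P A.
Proof.
have /asboolP [C [p [hp hx]]] := sgvalP x; apply/asboolP.
have [D [q [g [hq e]]]] := even_epi_pullback f hp.
exists D, q; split=> // E h; rewrite /family_res.
have h1 := hx E (g ** h); have h2 := locally_zero_pres h (hx D g).
have := locally_zeroB h1 h2; rewrite raddfB /= !hcompA e -pres_comp.
by rewrite opprB addrA subrK.
Qed.

Definition sect_res A B (f : hhom H A B) (x : sect B) : sect A :=
  Subgroup (family_res_coherent f x).

Lemma sect_resB A B (f : hhom H A B) : zmod_morphism (@sect_res A B f).
Proof. by move=> x y; apply: val_inj; apply: family_ext. Qed.

Definition plus_res A B (f : hhom H A B) (c : plus P B) : plus P A :=
  \pi_(plus P A) (sect_res f (repr c)).

Lemma plus_resE A B (f : hhom H A B) x :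
  plus_res f (\pi_(plus P B) x) = \pi_(plus P A) (sect_res f x).
Proof.
apply/plus_eqP; rewrite -sect_resB.
have /plus_eqP : \pi_(plus P B) (repr (\pi_(plus P B) x)) = \pi_(plus P B) x by rewrite reprK.
move=> /asboolP [C [p [hp hx]]]; apply/asboolP.
have [D [q [g [hq e]]]] := even_epi_pullback f hp.
exists D, q; split=> // E h; have := hx E (g ** h).
by rewrite hcompA e -hcompA.
Qed.

Lemma plus_piB A (x y : sect A) :
  \pi_(plus P A) (x - y) = \pi_(plus P A) x - \pi_(plus P A) y.
Proof. exact: (raddfB (\pi_(plus P A))). Qed.

Fact plus_res_additive A B (f : hhom H A B) : zmod_morphism (@plus_res A B f).
Proof.
move=> c c'; have [x ->] := plus_surj c; have [y ->] := plus_surj c'.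
by rewrite -plus_piB !plus_resE sect_resB plus_piB.
Qed.

HB.instance Definition _ A B (f : hhom H A B) :=
  GRing.isZmodMorphism.Build _ _ (@plus_res A B f) (@plus_res_additive A B f).

Definition plus_presheaf : presheaf W.
Proof.
refine (@Presheaf R H W (plus P) (fun A B f => @plus_res A B f) _ _).
- move=> A c; have [x ->] := plus_surj c; rewrite [LHS]plus_resE; congr (\pi _).
  by apply: val_inj; apply: family_ext => C g /=; rewrite /family_res hcomp1l.
- move=> A B C g f c; have [x ->] := plus_surj c.
  transitivity (plus_res f (plus_res g (\pi_(plus P C) x))) => //.
  rewrite (plus_resE g) (plus_resE f) [LHS]plus_resE; congr (\pi _).
  by apply: val_inj; apply: family_ext => D h /=; rewrite /family_res hcompA.
Defined.

Lemma unit_coherent A (x : P A) : ((fun C f => pres P f x) : family P A) \in @coherent R H W P A.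
Proof.
apply/asboolP; exists A, (hid H A); split; first exact/even_epi_iso/invertible_id.
by move=> C g; rewrite pres_comp subrr; apply: locally_zero0.
Qed.

Lemma plus_unit_exists : exists u : pshmap P plus_presheaf,
  forall A x, u A x = \pi_(plus P A) (Subgroup (unit_coherent x)).
Proof.
apply: pshmap_exists.
  move=> A x y; rewrite -plus_piB; congr (\pi _); apply: val_inj; apply: family_ext => C f /=.
  by rewrite raddfB.
move=> A B f x; rewrite [RHS]plus_resE; congr (\pi _); apply: val_inj.
by apply: family_ext => C g /=; rewrite /family_res pres_comp.
Qed.

Definition plus_unit := sval (cid plus_unit_exists).

Lemma plus_unitE A x : plus_unit A x = \pi_(plus P A) (Subgroup (unit_coherent x)).
Proof. by rewrite /plus_unit; case: cid. Qed.

Lemma plus_unit_eq0 A (x : P A) : plus_unit A x = 0 <-> locally_zero x.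
Proof.
have -> : plus_unit A x = 0 <-> null (Subgroup (unit_coherent x)).
  rewrite -[X in null X]subr0 -plus_eqP plus_unitE.
  by rewrite (raddf0 (\pi_(plus P A))).
split=> [/asboolP [B [p [hp h]]]|hx].
  by have := h B (hid H B); rewrite /= hcomp1r; apply: locally_zero_local.
apply/asboolP; exists A, (hid H A); split; first exact/even_epi_iso/invertible_id.
by move=> C g /=; apply: locally_zero_pres.
Qed.

Lemma plus_unit_surj : locally_surjective plus_unit.
Proof.
move=> A c; have [x ->] := plus_surj c.
have /asboolP [B [p [hp hx]]] := sgvalP x.
exists B, p, (sgval x B p); split=> //.
rewrite [LHS]plus_resE plus_unitE; apply/plus_eqP/asboolP.
exists B, (hid H B); split; first exact/even_epi_iso/invertible_id.
by move=> C g; have := hx C g; rewrite /= hcomp1l.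
Qed.

Lemma plus_separated A B (p : hhom H B A) (c : plus P A) :
  even_epi p -> pres plus_presheaf p c = 0 -> c = 0.
Proof.
have [x ->] := plus_surj c => hp.
have z D : (0 : plus P D) = \pi_(plus P D) 0 by rewrite (raddf0 (\pi_(plus P D))).
have -> : pres plus_presheaf p (\pi_(plus P A) x) = \pi_(plus P B) (sect_res p x).
  exact: plus_resE.
move=> e; have {e} /plus_eqP : \pi_(plus P B) (sect_res p x) = \pi_(plus P B) 0 by rewrite -z.
rewrite subr0 => /asboolP [C [q [hq hx]]].
rewrite z; apply/plus_eqP; rewrite subr0; apply/asboolP.
exists C, (p ** q); split; first exact: even_epi_comp.
by move=> D g; have := hx D g; rewrite /= /family_res hcompA.
Qed.

(** The family restricts x along a chosen lift through r and is zero on maps without a lift. By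
    hypothesis another lift changes the value by a locally zero section only. *)
Lemma plus_glue A B (r : hhom H B A) (x : P B) : even_epi r ->
  (forall C (g h : hhom H C B), r ** g = r ** h ->
    locally_zero (pres P g x - pres P h x)) ->
  exists c : plus P A, pres plus_presheaf r c = plus_unit B x.
Proof.
move=> hr hx.
pose fx : family P A := fun C f =>
  match pselect (exists g : hhom H C B, f = r ** g) with
  | left e => pres P (sval (cid e)) x
  | right _ => 0
  end.
have fxE C (g : hhom H C B) : locally_zero (fx C (r ** g) - pres P g x).
  rewrite /fx; case: pselect => [e|[]]; last by exists g.
  by case: cid => g' /= e'; apply: hx.
have fc : fx \in @coherent R H W P A.
  apply/asboolP; exists B, r; split=> // C g.
  have h1 := fxE C g; have h2 := locally_zero_pres g (fxE B (hid H B)).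
  have := locally_zeroB h1 h2; rewrite raddfB /= hcomp1r -pres_comp hcomp1l.
  by rewrite opprB addrA subrK.
exists (\pi_(plus P A) (Subgroup fc)).
rewrite [LHS]plus_resE plus_unitE; apply/plus_eqP/asboolP.
exists B, (hid H B); split; first exact/even_epi_iso/invertible_id.
by move=> C g; have := fxE C g; rewrite /= hcomp1l.
Qed.

Lemma plus_sheaf : is_sheaf plus_presheaf.
Proof.
move=> B A p hp b hb.
have [C [q [x [hq ex]]]] := plus_unit_surj b.
have [|c ec] := @plus_glue A C (p ** q) x (even_epi_comp hp hq).
  move=> D g h e; apply/plus_unit_eq0; rewrite raddfB !pfun_nat -ex -!pres_comp.
  by rewrite (hb D (q ** g) (q ** h)) ?subrr // !hcompA.
have e : pres plus_presheaf p c = b.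
  apply/subr0_eq/(plus_separated hq).
  by rewrite raddfB -pres_comp ec ex subrr.
exists c; split=> // c' e'; apply/subr0_eq/(plus_separated hp).
by rewrite raddfB e e' subrr.
Qed.

Lemma plus_sheafification : is_sheafification plus_unit.
Proof.
apply: sheafification_local; first exact: plus_sheaf.
  by move=> A x /plus_unit_eq0.
exact: plus_unit_surj.
Qed.

Lemma plus_additive : is_additive P -> is_additive plus_presheaf.
Proof.
move=> hP A B f g c.
have [C [p [x [hp ex]]]] := plus_unit_surj c.
have [D [q [f' [hq ef]]]] := even_epi_pullback f hp.
have [D' [q' [g' [hq' eg]]]] := even_epi_pullback (g ** q) hp.
apply/subr0_eq/(plus_separated (even_epi_comp hq hq')).
rewrite raddfB raddfD -!pres_comp.
have ef' : f ** (q ** q') = p ** (f' ** q') by rewrite !hcompA ef.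
have eg' : g ** (q ** q') = p ** g' by rewrite hcompA eg.
rewrite hcompDl ef' eg' -hcompDr !pres_comp ex -!pfun_nat hP raddfD /=.
by rewrite pres_comp subrr.
Qed.

Section Any.
Variables (F : presheaf W) (u : pshmap P F).
Hypothesis hu : is_sheafification u.

(** Sheafifications are unique up to isomorphism, so the explicit one describes the kernel and the
    local image of the unit of an arbitrary one. *)
Lemma sheafification_plus : exists (a : pshmap F plus_presheaf) (b : pshmap plus_presheaf F),
  [/\ forall A x, a A (u A x) = plus_unit A x, forall A x, b A (plus_unit A x) = u A x,
      forall A y, b A (a A y) = y & forall A y, a A (b A y) = y].
Proof.
have [hF uF] := hu.
have [[a ha] _] := uF _ plus_unit plus_sheaf.
have [_ /(_ F u hF) [[b hb] _]] := plus_sheafification.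
pose idp (G : presheaf W) : pshmap G G :=
  PshMap (F := G) (G := G) (pfun := fun A => idfun) (fun A B f x => erefl).
have [ba hba] := @pshmap_exists R H W F F (fun A y => b A (a A y))
  (fun A x y => etrans (congr1 _ (raddfB _ x y)) (raddfB _ _ _))
  (fun A B f x => etrans (congr1 _ (pfun_nat _ _ _)) (pfun_nat _ _ _)).
have [ab hab] := @pshmap_exists R H W plus_presheaf plus_presheaf (fun A y => a A (b A y))
  (fun A x y => etrans (congr1 _ (raddfB _ x y)) (raddfB _ _ _))
  (fun A B f x => etrans (congr1 _ (pfun_nat _ _ _)) (pfun_nat _ _ _)).
exists a, b; split=> //.
- move=> A y; rewrite -hba; have [_ /(_ ba (idp F)) h] := uF _ u hF.
  by apply: h => B x; rewrite hba ha hb.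
- have [_ /(_ _ plus_unit plus_sheaf) [_ h]] := plus_sheafification.
  by move=> A y; rewrite -hab; apply: (h ab (idp _)) => B x; rewrite hab hb ha.
Qed.

Lemma sheafification_injective A (x : P A) : u A x = 0 <-> locally_zero x.
Proof.
have [a [b [ha hb ba ab]]] := sheafification_plus.
rewrite -plus_unit_eq0; split=> [e|e]; first by rewrite -ha e raddf0.
by rewrite -hb e raddf0.
Qed.

Lemma sheafification_surjective : locally_surjective u.
Proof.
have [a [b [ha hb ba ab]]] := sheafification_plus.
move=> A y; have [B [p [x [hp ex]]]] := plus_unit_surj (a A y).
by exists B, p, x; split=> //; rewrite -hb -ex pfun_nat ba.
Qed.

Lemma sheafification_additive : is_additive P -> is_additive F.
Proof.
move=> /plus_additive hP A B f g x.
have [a [b [ha hb ba ab]]] := sheafification_plus.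
by rewrite -[x]ba -!(pfun_nat b) hP raddfD.
Qed.

End Any.
End PlusSheaf.

(** * Injective sheaves *)

Section Injective.
Variables (R : E1ring) (H : hocat R) (W : loop_functor H).
Implicit Types (A B C K : perf W) (F I : presheaf W).
Local Notation "g ** f" := (hcomp g f) (at level 40, left associativity).
Local Notation Om := (lob W).
Local Notation Omf := (lmor W).
Local Notation ftri := (@tri R H W true _ _ _).

Lemma pi_presheaf_additive n M : is_additive (pi_presheaf W n M).
Proof.
case: n => n A B f g x; first exact: hcompDr.
by rewrite -hcompDr -(lmornD W n.+1).
Qed.

Lemma homologically_even_odd M m A (x : hhom H A (lobn W m M)) :
  homologically_even W M -> odd m ->
  exists B (p : hhom H B A), even_epi p /\ x ** p = 0.
Proof.
move=> hM om.
pose y : pi_presheaf W (Posz m) M A := x.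
suff : locally_zero y by [].
have e : Posz m = (Posz m./2 * 2 + 1)%R.
  by rewrite -PoszM -PoszD muln2 addn1 -[in LHS](odd_double_half m) om.
move: y; rewrite e => y; apply/plus_unit_eq0.
exact: (hM (Posz m./2) (EvenSheaf (plus_sheafification _))).
Qed.

Lemma additive_restrict_zero F A B (f : hhom H A B) x : is_additive F -> f = 0 -> pres F f x = 0.
Proof. by move=> hF ->; apply: (addrI (pres F 0 x)); rewrite -hF !addr0. Qed.

Lemma additive_restrictB F A B (f g : hhom H A B) x : is_additive F ->
  pres F (f - g) x = pres F f x - pres F g x.
Proof.
by move=> hF; apply/eqP; rewrite eq_sym subr_eq -hF subrK.
Qed.

Lemma pres_seq_zero F A B K (d : hhom H (Om A) K) (i : hhom H K B) (p : hhom H B A) x :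
  is_additive F -> ftri d i p -> pres F i (pres F p x) = 0.
Proof. by move=> hF h; rewrite -pres_comp; apply: additive_restrict_zero => //; apply: tri_pi h. Qed.

(** Two maps to B with the same composite to A differ by a map through K; for an additive sheaf the
    descent condition along p therefore reduces to vanishing on K. *)
Lemma sheaf_descent F A B K (d : hhom H (Om A) K) (i : hhom H K B) (p : hhom H B A) (t : F B) :
  additive_sheaf F -> ftri d i p -> pres F i t = 0 -> exists a, pres F p a = t.
Proof.
move=> [hF aF] h e; have [|a [ea _]] := hF B A p (tri_even_epi h) t; last by exists a.
move=> C g g' pg; apply/subr0_eq; rewrite -additive_restrictB //.
have [|psi ->] := tri_exact_mid h (phi := g - g'); first by rewrite hcompBr pg subrr.
by rewrite pres_comp e raddf0.
Qed.

(* The sheafified representable of K embeds in that of B: a map into K that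
   vanishes in B factors through the loops of A, so is locally zero. *)
Lemma injective_extend I A B K (d : hhom H (Om A) K) (i : hhom H K B) (p : hhom H B A) (t : I K) :
  injective_sheaf I -> ftri d i p -> exists s : I B, pres I i s = t.
Proof.
move=> [[sI aI] iI] h.
pose PK := pi_presheaf W (Posz 0) K; pose PB := pi_presheaf W (Posz 0) B.
have aK : is_additive PK := @pi_presheaf_additive _ _.
have aB : is_additive PB := @pi_presheaf_additive _ _.
have [u eu] : exists u : pshmap PK I, forall A (f : hhom H A K), u A f = pres I f t.
  apply: (@pshmap_exists R H W PK I (fun A (f : hhom H A K) => pres I f t)).
    by move=> C f g; apply: additive_restrictB.
  by move=> C C' f g; apply: pres_comp.
have [ip eip] : exists ip : pshmap PK PB, forall A (f : hhom H A K), ip A f = i ** f.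
  apply: (@pshmap_exists R H W PK PB (fun A (f : hhom H A K) => i ** f)).
    by move=> C f g; apply: hcompBr.
  by move=> C C' f g; apply: hcompA.
have [_ uK] := plus_sheafification PK.
have [[u' eu'] _] := uK I u sI.
pose cB : pshmap PB (plus_presheaf PB) := plus_unit PB.
have [c ec] : exists c : pshmap PK (plus_presheaf PB), forall A f, c A f = cB A (ip A f).
  apply: (@pshmap_exists R H W PK (plus_presheaf PB) (fun A f => cB A (ip A f))).
    by move=> C f g; rewrite !raddfB.
  by move=> C C' f g; rewrite !pfun_nat.
have [[j ej] _] := uK _ c (@plus_sheaf _ _ _ PB).
have j_inj C : injective (j C).
  move=> x y e; apply/subr0_eq; move: (x - y) (raddfB (j C) x y) => z.
  rewrite e subrr => jz.
  have [D [q [f [hq ef]]]] := plus_unit_surj z.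
  apply: (plus_separated hq); rewrite ef; apply/plus_unit_eq0.
  have : locally_zero (ip D f).
    by apply/plus_unit_eq0; rewrite -[LHS]ec -ej -ef pfun_nat jz raddf0.
  rewrite eip => -[E [r [hr er]]].
  have /(tri_exact_fib h) [psi epsi] : i ** (f ** r) = 0 by rewrite hcompA.
  have [E' [r' [hr' er']]] := loop_target_local psi (perfP A).
  exists E', (r ** r'); split; first exact: even_epi_comp.
  have -> : pres PK (r ** r') f = (f : hhom H D K) ** (r ** r') by [].
  by rewrite hcompA epsi -hcompA er' hcomp0r.
have [||v ev] := iI _ _ j u' _ _ j_inj.
- by split; [apply: plus_sheaf|apply: plus_additive].
- by split; [apply: plus_sheaf|apply: plus_additive].
exists (v B (cB B (hid H B))); rewrite -!pfun_nat.
have -> : pres PB i (hid H B) = ip K (hid H K).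
  by rewrite eip; rewrite /= hcomp1l hcomp1r.
by rewrite -ec -ej ev eu' eu pres_id.
Qed.

End Injective.

(** * Even sheaves and connecting maps *)

Section Terms.
Variables (R : E1ring) (H : hocat R) (W : loop_functor H).
Variables (F : presheaf W) (I : injective_resolution F).
Implicit Types (A B : perf W).

Lemma iterm_sheaf q : is_sheaf (I q).
Proof. by have [[]] := iterm_inj I q. Qed.

Lemma iterm_additive q : is_additive (I q).
Proof. by have [[]] := iterm_inj I q. Qed.

Lemma idiff_idiff q A (t : I q A) : idiff I q.+1 A (idiff I q A t) = 0.
Proof. by have [h _] := idiff_exact I q; apply: h. Qed.

Lemma idiff_local q A (z : I q.+1 A) : idiff I q.+1 A z = 0 ->
  exists B (p : hhom H B A) (t : I q B), even_epi p /\ pres (I q.+1) p z = idiff I q B t.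
Proof.
by move=> dz; have [_ /(_ A z dz) [B [p [hp [t et]]]]] := idiff_exact I q; exists B, p, t.
Qed.

Lemma idiff_iaug A (x : F A) : idiff I 0 A (iaug I A x) = 0.
Proof. by have [h _] := iaug_exact I; apply: h. Qed.

(** Exactness only provides a preimage on a cover; it descends because the augmentation is
    injective. *)
Lemma iaug_kernel A (t : I 0%N A) : is_sheaf F -> idiff I 0 A t = 0 -> exists s : F A, iaug I A s = t.
Proof.
move=> sF dt; have [_ /(_ A t dt) [B [p [hp [x ex]]]]] := iaug_exact I.
have [|s [es _]] := sF B A p hp x.
  move=> C g h pg; apply: (iaug_inj (i := I)).
  by rewrite !pfun_nat ex -!pres_comp pg.
by exists s; apply: (sheaf_separated (iterm_sheaf (q := 0)) hp); rewrite -pfun_nat es.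
Qed.

End Terms.

(** * Units over cells and the two connecting maps *)

Section Resolution.
Variables (R : E1ring) (H : hocat R) (W : loop_functor H).
Variables (hR : connective W (regular R)) (M : module R).
Hypotheses (hM : connective W M) (eM : homologically_even W M).
Implicit Types (A B C D K : perf W).
Local Notation "g ** f" := (hcomp g f) (at level 40, left associativity).
Local Notation Om := (lob W).
Local Notation Omf := (lmor W).
Local Notation ftri := (@tri R H W true _ _ _).

Section Unit.
Variables (n : nat) (F : even_sheaf W (Posz n) M).

Definition even_unit A (x : hhom H A (lobn W n M)) : F A := eunit F A x.

Lemma even_unit_pres A B (f : hhom H B A) x :
  pres F f (even_unit x) = even_unit (x ** f).
Proof. exact: (esym (pfun_nat (eunit F) f x)). Qed.

Lemma even_unitB A (x y : hhom H A (lobn W n M)) :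
  even_unit (x - y) = even_unit x - even_unit y.
Proof. exact: (raddfB (eunit F A)). Qed.

Lemma even_unit_eq0 A (x : hhom H A (lobn W n M)) :
  even_unit x = 0 <-> exists B (p : hhom H B A), even_epi p /\ x ** p = 0.
Proof. exact: (sheafification_injective (eunitP F)). Qed.

Lemma even_sheaf_sheaf : additive_sheaf F.
Proof.
split; first by case: (eunitP F).
exact/(sheafification_additive (eunitP F))/pi_presheaf_additive.
Qed.

(** If x vanishes on a refined cover, its loops extend along d to a map from the (j+1)-cell K to
    Loops^(n+1) M, which is zero once n + 1 < 2j + 2. *)
Lemma even_unit_inj j A (x : hhom H A (lobn W n M)) : cell W j A -> (n <= j.*2)%N ->
  even_unit x = 0 -> x = 0.
Proof.
move=> cA nj /even_unit_eq0 [B [p [hp xp]]].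
have [K [D [d [i [q [y [h cK cD epy]]]]]]] := cell_refine hR cA hp.
have [|k ek] := tri_desc_conn h (g := Omf x).
  by rewrite -lmor_comp -epy hcompA xp hcomp0l lmor0.
apply: (@lmor_inj R H W); rewrite lmor0 ek.
rewrite (@cell_vanish _ _ _ 0 _ _ _ cK _ k) ?hcomp0l // => l jl f.
apply: (connective_vanish hM (a := l.*2) (b := n.+1)).
by rewrite -addnn in nj *; lia.
Qed.

(** A section is given on a refined cover D by a map b. Its restriction to K has zero image in the
    sheaf, so it is zero by injectivity over the (j+1)-cell K, which holds up to n = 2j + 2; hence b
    descends to A. *)
Lemma even_unit_surj j A (s : F A) : cell W j A -> (n <= j.*2.+2)%N ->
  exists x, even_unit x = s.
Proof.
move=> cA nj; have [sF aF] := even_sheaf_sheaf.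
have [B [p [x [hp ex]]]] := sheafification_surjective (eunitP F) s.
have [K [D [d [i [q [y [h cK cD epy]]]]]]] := cell_refine hR cA hp.
pose b : hhom H D (lobn W n M) := (x : hhom H B (lobn W n M)) ** y.
have eb : pres F q s = even_unit b.
  by rewrite -epy pres_comp ex; apply: even_unit_pres.
have [|a ea] := tri_desc_mid h (g := b).
  apply: (even_unit_inj cK) => //.
  by rewrite -even_unit_pres -eb; apply: (pres_seq_zero _ aF h).
exists a; apply: (sheaf_separated sF (tri_even_epi h)).
by rewrite even_unit_pres -ea eb.
Qed.

End Unit.

Section Degree1.
Variables (m : nat) (F : even_sheaf W (Posz m.+1) M) (I : injective_resolution F).

(* The connecting map H^0(K, F) -> H^1(A, F) of the even fibre sequence
   K -> B -> A takes the class of k to that of z; and k is chosen over the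
   loops of y. *)
Definition delta1_on A K B (d : hhom H (Om A) K) (i : hhom H K B) (p : hhom H B A)
    (y : hhom H A (lobn W m M)) (z : I 1%N A) (k : hhom H K (lobn W m.+1 M)) (t : I 0%N B) : Prop :=
  [/\ k ** d = Omf y, pres (I 0%N) i t = iaug I K (even_unit F k) &
      pres (I 1%N) p z = idiff I 0 B t].

Definition delta1 A (y : hhom H A (lobn W m M)) (z : I 1%N A) : Prop :=
  exists K B (d : hhom H (Om A) K) (i : hhom H K B) (p : hhom H B A) k t,
    ftri d i p /\ delta1_on d i p y z k t.

Lemma delta1_on_pres A K B (d : hhom H (Om A) K) (i : hhom H K B) (p : hhom H B A)
    A' K' B' (d' : hhom H (Om A') K') (i' : hhom H K' B') (p' : hhom H B' A')
    (f : hhom H A' A) (g : hhom H B' B) y z k t :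
  ftri d i p -> ftri d' i' p' -> f ** p' = p ** g -> delta1_on d i p y z k t ->
  exists x, delta1_on d' i' p' (y ** f) (pres (I 1%N) f z) (k ** x) (pres (I 0%N) g t).
Proof.
move=> h h' sq [kd it pz].
have [x [x1 x2]] := tri_map_fib h' h sq.
exists x; split.
- by rewrite -hcompA x2 hcompA kd lmor_comp.
- by rewrite -pres_comp -x1 pres_comp it -pfun_nat even_unit_pres.
- by rewrite -pres_comp sq pres_comp pz pfun_nat.
Qed.

Lemma delta1_pres A B (f : hhom H B A) y z :
  delta1 y z -> delta1 (y ** f) (pres (I 1%N) f z).
Proof.
move=> [K [C [d [i [p [k [t [h e]]]]]]]].
have [D [q [g [/even_epi_tri [K' [i' [d' h']]] sq]]]] := even_epi_pullback f (tri_even_epi h).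
have [x e'] := delta1_on_pres h h' (esym sq) e.
by exists K', D, d', i', q, (k ** x), (pres (I 0%N) g t).
Qed.

Lemma delta1_refine A B (q : hhom H B A) K K' D (d : hhom H (Om A) K) (i : hhom H K B)
    (d' : hhom H (Om A) K') (i' : hhom H K' D) (g : hhom H D B) y z k t :
  ftri d i q -> ftri d' i' (q ** g) -> delta1_on d i q y z k t ->
  exists x, delta1_on d' i' (q ** g) y z (k ** x) (pres (I 0%N) g t).
Proof.
move=> h h' e; have [|x e'] := delta1_on_pres (f := hid H A) (g := g) h h' _ e.
  by rewrite hcomp1l.
by exists x; rewrite hcomp1r pres_id in e'.
Qed.

Lemma delta1B A y z y' z' : @delta1 A y z -> @delta1 A y' z' -> delta1 (y - y') (z - z').
Proof.
move=> [K [B [d [i [p [k [t [h e]]]]]]]] [K' [B' [d' [i' [p' [k' [t' [h' e']]]]]]]].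
have [D [g [g' [hg eg]]]] := even_epi_refine (tri_even_epi h) (tri_even_epi h').
have [L [j [c hc]]] := even_epi_tri hg.
have [x [kd it pz]] := delta1_refine h hc e.
rewrite eg in hc; have [x' [kd' it' pz']] := delta1_refine h' hc e'.
rewrite -eg in hc pz'.
exists L, D, c, j, (p ** g), (k ** x - k' ** x'), (pres (I 0%N) g t - pres (I 0%N) g' t').
split=> //; split.
- by rewrite hcompBl kd kd' lmorB.
- by rewrite raddfB it it' even_unitB raddfB.
- by rewrite !raddfB pz pz'.
Qed.

(** As m is odd, y dies on an even epimorphism, so its loops extend to a map k on K. Injectivity of
    I 0 extends the section of k to t over B, and the differential of t vanishes on K and descends
    to A. *)
Lemma delta1_total A (y : hhom H A (lobn W m M)) : odd m -> exists z, delta1 y z.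
Proof.
move=> om; have [B [p [hp yp]]] := homologically_even_odd y eM om.
have [K [i [d h]]] := even_epi_tri hp.
have [|k ek] := tri_desc_conn h (g := Omf y); first by rewrite -lmor_comp yp lmor0.
have [t et] := injective_extend (iaug I K (even_unit F k)) (iterm_inj I 0) h.
have [|z ez] := sheaf_descent (F := I 1%N) (t := idiff I 0 B t) (proj1 (iterm_inj I 1)) h.
  rewrite -pfun_nat et; exact: idiff_iaug.
by exists z, K, B, d, i, p, k, t.
Qed.

(** With y = 0 the map k extends along i to k' on B; the difference of t and the section of k'
    vanishes on K and descends to a primitive of z. *)
Lemma delta1_zero A (z : I 1%N A) : delta1 0 z -> exists a, idiff I 0 A a = z.
Proof.
move=> [K [B [d [i [p [k [t [h [kd it pz]]]]]]]]].
have [k' ek] : exists k', k = k' ** i by apply: (tri_desc_fib h); rewrite kd lmor0.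
have [|a ea] := sheaf_descent (F := I 0%N) (t := t - iaug I B (even_unit F k'))
  (proj1 (iterm_inj I 0)) h.
  by rewrite raddfB it -pfun_nat even_unit_pres -ek subrr.
exists a; apply: (sheaf_separated (iterm_sheaf (q := 1)) (tri_even_epi h)).
by rewrite -pfun_nat ea raddfB pz idiff_iaug subr0.
Qed.

Lemma delta1_cocycle A y (z : I 1%N A) : delta1 y z -> idiff I 1 A z = 0.
Proof.
move=> [K [B [d [i [p [k [t [h [kd it pz]]]]]]]]].
apply: (sheaf_separated (iterm_sheaf (q := 2)) (tri_even_epi h)).
by rewrite -pfun_nat pz idiff_idiff raddf0.
Qed.

(** Subtracting a makes t a section of F over B, which is a map b because B is a j-cell with m + 1
    <= 2j + 2. Units are injective in the same range on the (j+1)-cell K, so k = b i and the loops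
    of y are b i d = 0. *)
Lemma delta1_inj j A y (a : I 0%N A) : cell W j A -> (m.+1 <= j.*2.+2)%N ->
  delta1 y (idiff I 0 A a) -> y = 0.
Proof.
move=> cA mj [K0 [B0 [d0 [i0 [p0 [k0 [t0 [h0 e0]]]]]]]].
have [K [B [d [i [p [g [h cK cB eg]]]]]]] := cell_refine hR cA (tri_even_epi h0).
rewrite -eg in h; have [x [kd it pz]] := delta1_refine h0 h e0.
move: (k0 ** x) (pres _ g t0) kd it pz => k t kd it pz; rewrite eg in h pz.
have [|s es] := iaug_kernel (I := I) (t := t - pres (I 0%N) p a) (proj1 (even_sheaf_sheaf F)).
  by rewrite raddfB -pz pfun_nat subrr.
have [b eb] := even_unit_surj s cB mj.
have ek : k = b ** i.
  apply/subr0_eq/(even_unit_inj (F := F) cK) => //.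
  apply: (iaug_inj (i := I)); rewrite raddf0 even_unitB raddfB -it.
  rewrite -even_unit_pres eb pfun_nat es raddfB.
  by rewrite (pres_seq_zero a (iterm_additive (I := I) (q := 0)) h) subr0 subrr.
by apply: (@lmor_inj R H W); rewrite lmor0 -kd ek -hcompA (tri_id h) hcomp0r.
Qed.

(** A local primitive of z restricts to a section of F over the (j+1)-cell K, where sections are
    maps up to degree 2(j + 1) + 2. Such a map k determines y by k d. *)
Lemma delta1_surj j A (z : I 1%N A) : cell W j A -> (m.+1 <= j.*2.+4)%N ->
  idiff I 1 A z = 0 -> exists y, delta1 y z.
Proof.
move=> cA mj /idiff_local [B0 [p0 [t0 [hp0 pz0]]]].
have [K [B [d [i [p [g [h cK cB eg]]]]]]] := cell_refine hR cA hp0.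
pose t := pres (I 0%N) g t0.
have pz : pres (I 1%N) p z = idiff I 0 B t by rewrite -eg pres_comp pz0 pfun_nat.
have [|s es] := iaug_kernel (I := I) (t := pres (I 0%N) i t) (proj1 (even_sheaf_sheaf F)).
  by rewrite pfun_nat -pz (pres_seq_zero z (iterm_additive (I := I) (q := 1)) h).
have [k ek] := even_unit_surj s cK mj.
have [y ey] := lmor_full (k ** d).
by exists y, K, B, d, i, p, k, t; split=> //; split=> //; rewrite ek es.
Qed.

End Degree1.

Section Degree2.
Variables (m : nat) (F : even_sheaf W (Posz m.+2) M) (I : injective_resolution F).

(** The connecting map H^1(K, F) -> H^2(A, F), applied to the class that [delta1] attaches to k. *)
Definition delta2 A (y : hhom H A (lobn W m M)) (z : I 2%N A) : Prop :=
  exists K B (d : hhom H (Om A) K) (i : hhom H K B) (p : hhom H B A)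
      (k : hhom H K (lobn W m.+1 M)) (t : I 1%N B),
  [/\ ftri d i p, k ** d = Omf y, delta1 k (pres (I 1%N) i t) &
      pres (I 2%N) p z = idiff I 1 B t].

Lemma delta2_refine A B (q : hhom H B A) K K' D (d : hhom H (Om A) K) (i : hhom H K B)
    (d' : hhom H (Om A) K') (i' : hhom H K' D) (g : hhom H D B)
    (y : hhom H A (lobn W m M)) (z : I 2%N A) (k : hhom H K (lobn W m.+1 M)) (t : I 1%N B) :
  ftri d i q -> ftri d' i' (q ** g) -> k ** d = Omf y -> delta1 k (pres (I 1%N) i t) ->
  pres (I 2%N) q z = idiff I 1 B t ->
  exists k' : hhom H K' (lobn W m.+1 M), [/\ k' ** d' = Omf y, delta1 k' (pres (I 1%N) i' (pres (I 1%N) g t)) &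
    pres (I 2%N) (q ** g) z = idiff I 1 D (pres (I 1%N) g t)].
Proof.
move=> h h' kd e pz.
have [|x [x1 x2]] := tri_map_fib (y := g) (z := hid H A) h' h; first by rewrite hcomp1l.
exists (k ** x); split.
- by rewrite -hcompA x2 lmor_id hcomp1r.
- by rewrite -pres_comp -x1 pres_comp; apply: delta1_pres.
- by rewrite pres_comp pz pfun_nat.
Qed.

Lemma delta2B A y z y' z' : @delta2 A y z -> @delta2 A y' z' -> delta2 (y - y') (z - z').
Proof.
move=> [K [B [d [i [p [k [t [h kd e pz]]]]]]]] [K' [B' [d' [i' [p' [k' [t' [h' kd' e' pz']]]]]]]].
have [D [g [g' [hg eg]]]] := even_epi_refine (tri_even_epi h) (tri_even_epi h').
have [L [j [c hc]]] := even_epi_tri hg.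
have [l [l1 l2 l3]] := delta2_refine h hc kd e pz.
rewrite eg in hc; have [l' [l1' l2' l3']] := delta2_refine h' hc kd' e' pz'.
rewrite -eg in hc l3'.
exists L, D, c, j, (p ** g), (l - l'), (pres (I 1%N) g t - pres (I 1%N) g' t').
split=> //.
- by rewrite hcompBl l1 l1' lmorB.
- by rewrite raddfB; apply: delta1B.
- by rewrite !raddfB l3 l3'.
Qed.

(** Here m is even, so y is assumed to be locally zero; homological evenness applies to k, which
    maps to an odd loop object. *)
Lemma delta2_total A (y : hhom H A (lobn W m M)) B (p : hhom H B A) : odd m.+1 ->
  even_epi p -> y ** p = 0 -> exists z, delta2 y z.
Proof.
move=> om /even_epi_tri [K [i [d h]]] yp.
have [|k ek] := tri_desc_conn h (g := Omf y); first by rewrite -lmor_comp yp lmor0.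
have [c hc] := delta1_total I k om.
have [t et] := injective_extend c (iterm_inj I 1) h.
have [|z ez] := sheaf_descent (F := I 2%N) (t := idiff I 1 B t) (proj1 (iterm_inj I 2)) h.
  by rewrite -pfun_nat et; apply: delta1_cocycle hc.
by exists z, K, B, d, i, p, k, t; rewrite et.
Qed.

(** The map k extends to k' on B, and a cocycle c for k' corrects t so that its restriction to K
    becomes a coboundary. Its primitive extends to B by injectivity and corrects t once more; the
    result descends to A. *)
Lemma delta2_zero A (z : I 2%N A) : odd m.+1 -> delta2 0 z -> exists a, idiff I 1 A a = z.
Proof.
move=> om [K [B [d [i [p [k [t [h kd e pz]]]]]]]].
have [k' ek] : exists k', k = k' ** i by apply: (tri_desc_fib h); rewrite kd lmor0.
have [c hc] := delta1_total I k' om.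
have := delta1B e (delta1_pres i hc); rewrite -ek subrr => /delta1_zero [a ea].
have [b eb] := injective_extend a (iterm_inj I 0) h.
have [|s es] := sheaf_descent (F := I 1%N) (t := t - c - idiff I 0 B b)
  (proj1 (iterm_inj I 1)) h.
  by rewrite !raddfB -pfun_nat eb ea subrr.
exists s; apply: (sheaf_separated (iterm_sheaf (q := 2)) (tri_even_epi h)).
by rewrite -pfun_nat es !raddfB idiff_idiff (delta1_cocycle hc) !subr0 pz.
Qed.

Lemma delta2_cocycle A y (z : I 2%N A) : delta2 y z -> idiff I 2 A z = 0.
Proof.
move=> [K [B [d [i [p [k [t [h kd e pz]]]]]]]].
apply: (sheaf_separated (iterm_sheaf (q := 3)) (tri_even_epi h)).
by rewrite -pfun_nat pz idiff_idiff raddf0.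
Qed.

(** The argument of [delta1_inj] one degree higher. The bound m + 2 <= 2j + 4 is at once that of
    [delta1_surj] on the j-cell B and that of [delta1_inj] on the (j+1)-cell K. *)
Lemma delta2_inj j A y (a : I 1%N A) : cell W j A -> (m.+2 <= j.*2.+4)%N ->
  delta2 y (idiff I 1 A a) -> y = 0.
Proof.
move=> cA mj [K0 [B0 [d0 [i0 [p0 [k0 [t0 [h0 kd0 e0 pz0]]]]]]]].
have [K [B [d [i [p [g [h cK cB eg]]]]]]] := cell_refine hR cA (tri_even_epi h0).
rewrite -eg in h; have [k [kd e pz]] := delta2_refine h0 h kd0 e0 pz0.
move: (pres _ g t0) e pz => t e pz; rewrite eg in h pz.
have [|b hb] := delta1_surj (I := I) (z := t - pres (I 1%N) p a) cB mj.
  by rewrite raddfB -pz pfun_nat subrr.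
have := delta1B e (delta1_pres i hb).
rewrite raddfB (pres_seq_zero a (iterm_additive (I := I) (q := 1)) h) subr0 subrr.
rewrite -[X in delta1 _ X](raddf0 (idiff I 0 K)) => /(delta1_inj cK mj) /subr0_eq ek.
by apply: (@lmor_inj R H W); rewrite lmor0 -kd ek -hcompA (tri_id h) hcomp0r.
Qed.

Lemma delta2_surj j A (z : I 2%N A) : cell W j A -> (m.+2 <= j.*2.+4)%N ->
  idiff I 2 A z = 0 -> exists y, delta2 y z.
Proof.
move=> cA mj /idiff_local [B0 [p0 [t0 [hp0 pz0]]]].
have [K [B [d [i [p [g [h cK cB eg]]]]]]] := cell_refine hR cA hp0.
pose t := pres (I 1%N) g t0.
have pz : pres (I 2%N) p z = idiff I 1 B t by rewrite -eg pres_comp pz0 pfun_nat.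
have [|k hk] := delta1_surj (I := I) (z := pres (I 1%N) i t) cK (leqW (leqW mj)).
  by rewrite pfun_nat -pz (pres_seq_zero z (iterm_additive (I := I) (q := 2)) h).
have [y ey] := lmor_full (k ** d).
by exists y, K, B, d, i, p, k, t.
Qed.

Lemma delta2_local A y (z : I 2%N A) : delta2 y z ->
  exists B (p : hhom H B A), even_epi p /\ y ** p = 0.
Proof.
move=> [K [B [d [i [p [k [t [h kd e pz]]]]]]]].
exists B, p; split; first exact: tri_even_epi h.
by apply: (@lmor_inj R H W); rewrite lmor0 lmor_comp -kd -hcompA (tri_dp h) hcomp0r.
Qed.

End Degree2.

End Resolution.

(** * Products *)

Section Products.
Variables (R : E1ring) (H : hocat R) (W : loop_functor H).
Variables (hR : connective W (regular R)) (M : module R) (hM : connective W M).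
Implicit Types (A B C D K : perf W).
Local Notation "g ** f" := (hcomp g f) (at level 40, left associativity).
Local Notation Om := (lob W).
Local Notation Omf := (lmor W).
Local Notation Rm := (regular R).

Lemma hcomp_suml (J : Type) (s : seq J) X Y Z (g : J -> hhom H Y Z) (f : hhom H X Y) :
  (\sum_(j <- s) g j) ** f = \sum_(j <- s) (g j ** f).
Proof.
elim: s => [|j s IH]; first by rewrite !big_nil hcomp0l.
by rewrite !big_cons hcompDl IH.
Qed.

(** For k = 1 the map is itself a single summand, and Loops^(2k) R with k >= 2 has no maps to
    Loops^3 M. In an extension, the factors X -> Loops^2 R extend to Y because the loops of Z are
    built from Loops^(2k+1) R with k >= 1; the remainder descends to Z. *)
Lemma cell1_products X (f : hhom H X (lobn W 3 M)) : cell W 1 X ->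
  exists s : seq (hhom H X (lobn W 2 Rm) * hhom H (lobn W 2 Rm) (lobn W 3 M)),
    f = \sum_(t <- s) t.2 ** t.1.
Proof.
move=> cX; elim: cX f => {X} [X e|k X k1 [u [v [vu uv]]]|X Y Z d i p h _ IHX cZ IHZ] f.
- by exists [::]; rewrite big_nil -[f]hcomp1r e hcomp0r.
- case: k k1 u v vu uv => [//|[|k]] _ u v vu uv.
    by exists [:: (u, f ** v)]; rewrite big_seq1 /= -hcompA vu hcomp1r.
  exists [::]; rewrite big_nil -[f]hcomp1r -vu hcompA.
  by rewrite (connective_vanish hM (b := 3) _ (f ** v)) ?hcomp0l.
- have ext (s : seq (hhom H X (lobn W 2 Rm) * hhom H (lobn W 2 Rm) (lobn W 3 M))) :
      exists s' : seq (hhom H Y (lobn W 2 Rm) * hhom H (lobn W 2 Rm) (lobn W 3 M)),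
      \sum_(t <- s) t.2 ** t.1 = (\sum_(t <- s') t.2 ** t.1) ** i.
    elim: s => [|[e g] s [s' es]]; first by exists [::]; rewrite !big_nil hcomp0l.
    have [|e' ee] := tri_desc_fib h (g := e).
      apply: (cell_vanish (m := 1) cZ) => k k1 f'.
      by apply: (connective_vanish hR (b := 2)); rewrite -addnn; lia.
    by exists ((e', g) :: s'); rewrite !big_cons hcompDl es /= -hcompA -ee.
  have [s es] := IHX (f ** i); have [s' es'] := ext s.
  have [|k ek] := tri_desc_mid h (g := f - \sum_(t <- s') t.2 ** t.1).
    by rewrite hcompBl es es' subrr.
  have [s'' es''] := IHZ k.
  exists (s' ++ [seq (t.1 ** p, t.2) | t <- s'']).
  rewrite big_cat big_map /= -(subrK (\sum_(t <- s') t.2 ** t.1) f) addrC ek es''.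
  congr (_ + _); rewrite hcomp_suml; apply: eq_bigr => t _.
  by rewrite hcompA.
Qed.

(** The loops of a locally zero x are k d with k a map on a 1-cell. Once k is split through Loops^2
    R, both factors of each summand are loops or double loops of elements of degree one, and undoing
    the loops leaves products. *)
Lemma locally_zero_mul_im (x : hhom H Rm (lobn W 2 M)) :
  (exists B (p : hhom H B (Rperf W)), even_epi p /\ x ** p = 0) <-> @in_mul_im R H W M x.
Proof.
have cR : cell W 0 (Rperf W).
  by apply: (@cell_loop _ _ _ _ 0); last by exists (hid H _); apply: invertible_id.
split.
- move=> [B [p [hp xp]]]; apply/asboolP.
  have [K [D [d [i [q [y [h cK cD epy]]]]]]] := cell_refine hR cR hp.
  have [|k ek] := tri_desc_conn h (g := Omf x).
    by rewrite -lmor_comp -epy hcompA xp hcomp0l lmor0.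
  have [s es] := cell1_products (k : hhom H K (lobn W 3 M)) cK.
  have factor (t : hhom H K (lobn W 2 Rm) * hhom H (lobn W 2 Rm) (lobn W 3 M)) :
      exists st : hhom H Rm (Om Rm) * hhom H Rm (Om M),
      t.2 ** t.1 ** d = Omf (Omf st.2 ** st.1).
    have [a ea] := lmor_full (t.1 ** d).
    have [b eb] := @lmorn_full _ _ W 2 Rm (Om M) t.2.
    by exists (a, b); rewrite lmor_comp -ea -hcompA eb.
  have [c hc] := choice factor.
  exists [seq c t | t <- s]; apply: (@lmor_inj R H W).
  rewrite ek es hcomp_suml big_map /pi1_mul.
  rewrite -(big_map (fun t => Omf (c t).2 ** (c t).1) predT id) lmor_sum big_map.
  by apply: eq_bigr => t _; rewrite hc.
- move=> /asboolP [s ->]; elim: s => [|[a b] s [B [p [hp ep]]]].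
    exists (Rperf W), (hid H _); split; first exact/even_epi_iso/invertible_id.
    by rewrite big_nil hcomp0l.
  have [D [q [hq eq]]] := loop_target_local (C := Rperf W) (X := Rm) a (perfP (Rperf W)).
  have [E [g [g' [hg eg]]]] := even_epi_refine hp hq.
  exists E, (p ** g); split=> //.
  rewrite big_cons hcompDl [X in _ + X]hcompA ep hcomp0l addr0 /pi1_mul /= eg.
  by rewrite -hcompA (hcompA a) eq hcomp0l hcomp0r.
Qed.

End Products.

(** * Cohomology *)

Section CohomologyIso.
Variables (R : E1ring) (H : hocat R) (W : loop_functor H).
Variables (F : presheaf W) (I : injective_resolution F) (q : nat).
Implicit Types (z : I q (Rperf W)) (c : cohomology I q).

Lemma coboundary_cocycle z : coboundary_of z -> idiff I q (Rperf W) z = 0.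
Proof.
by case: q z => [|r] z => [->|[y <-]]; rewrite ?raddf0 // idiff_idiff.
Qed.

Lemma represents_cocycle z c : represents z c -> idiff I q (Rperf W) z = 0.
Proof. by move=> [w [<- _]]; apply/eqP; apply: (sgvalP w). Qed.

Lemma cocycle_represents z : idiff I q (Rperf W) z = 0 -> exists c, represents z c.
Proof.
move=> /eqP dz; exists (\pi_(cohomology I q) (Subgroup (dz : z \in @cocycle R H W F I q))).
by exists (Subgroup (dz : z \in @cocycle R H W F I q)).
Qed.

Lemma representsB z z' c c' : represents z c -> represents z' c' ->
  represents (z - z') (c - c').
Proof.
move=> [w [<- <-]] [w' [<- <-]]; exists (w - w'); split; first exact: raddfB.
exact: (raddfB (\pi_(cohomology I q))).
Qed.

Lemma represents0 z : represents z (0 : cohomology I q) <-> coboundary_of z.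
Proof.
have e (w : subgroup (@cocycle R H W F I q)) :
    (\pi_(cohomology I q) w = 0) <-> coboundary_of (val w).
  have -> : 0 = \pi_(cohomology I q) 0 by rewrite (raddf0 (\pi_(cohomology I q))).
  have -> : (\pi_(cohomology I q) w = \pi_(cohomology I q) 0) <-> (w \in @coboundary R H W F I q).
    by rewrite -[in X in _ <-> X](subr0 w) Quotient.idealrBE; split=> [->|/eqP].
  by split=> [/asboolP|h]; last exact/asboolP.
split=> [[w [<- /e]] //|hz].
have dz : z \in @cocycle R H W F I q by apply/eqP/coboundary_cocycle.
by exists (Subgroup dz); split=> //; apply/e.
Qed.

Lemma represents_coboundary z z' c : represents z c -> coboundary_of (z' - z) ->
  represents z' c.
Proof.
move=> hz /represents0 h.
have := representsB hz (representsB (proj2 (represents0 0) (coboundary_of0 I q)) h).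
by rewrite !sub0r !opprK addrC subrK addr0.
Qed.

Lemma cohomology_surj c : exists z, represents z c.
Proof. by exists (val (repr c)), (repr c); rewrite reprK. Qed.

Variables (V : zmodType) (Rl : V -> I q (Rperf W) -> Prop).
Hypotheses (tot : forall v, exists z, Rl v z)
  (sub : forall v z v' z', Rl v z -> Rl v' z' -> Rl (v - v') (z - z'))
  (zero : forall z, Rl 0 z -> coboundary_of z)
  (cocyc : forall v z, Rl v z -> idiff I q (Rperf W) z = 0)
  (inj : forall v z, Rl v z -> coboundary_of z -> v = 0)
  (surj : forall z, idiff I q (Rperf W) z = 0 -> exists v, Rl v z).

Lemma cohomology_iso : exists f : {additive V -> cohomology I q},
  [/\ bijective f, forall v z, Rl v z -> represents z (f v) &
      forall v z, represents z (f v) -> exists z', Rl v z' /\ coboundary_of (z - z')].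
Proof.
have [|||f hf] := @additive_rel V (cohomology I q)
    (fun v c => exists z, Rl v z /\ represents z c).
- by move=> v; have [z hz] := tot v; have [c hc] := cocycle_represents (cocyc hz); exists c, z.
- move=> c [z [/zero /represents0 hz hc]].
  have [w [ew <-]] := hc; have [w' [ew' e']] := hz.
  by rewrite -e'; congr (\pi _); apply: val_inj; rewrite /= ew ew'.
- move=> v c v' c' [z [hz hc]] [z' [hz' hc']]; exists (z - z').
  by split; [apply: sub|apply: representsB].
have fR v z : Rl v z -> represents z (f v).
  move=> hz; have [c hc] := cocycle_represents (cocyc hz).
  by have <- : c = f v by symmetry; apply/hf; exists z.
have finj : injective f.
  move=> v v' e; apply/subr0_eq.
  have : f (v - v') = 0 by rewrite raddfB e subrr.
  move=> /hf [z [hz /represents0 hb]]; exact: inj hz hb.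
have fsurj c : exists v, f v = c.
  have [z hz] := cohomology_surj c; have [v hv] := surj (represents_cocycle hz).
  by exists v; apply/hf; exists z.
exists f; split=> //.
  have [g hg] := choice fsurj.
  by exists g => // v; apply: finj; rewrite hg.
move=> v z hz; have [z' hz'] := tot v; exists z'; split=> //.
by apply/represents0; rewrite -(subrr (f v)); apply: representsB => //; apply: fR.
Qed.

End CohomologyIso.

(** * The four isomorphisms *)

Section Isomorphisms.
Variables (R : E1ring) (H : hocat R) (W : loop_functor H).
Hypothesis hR : connective W (regular R).
Variable M : connective_heven W.
Local Notation Rp := (Rperf W).
Local Notation unit0 F x := (@even_unit R H W M _ F Rp x).

Lemma cell0_regular : cell W 0 Rp.
Proof. by apply: (@cell_loop _ _ _ _ 0); last by exists (hid H _); apply: invertible_id. Qed.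

Lemma iso00 (F : even_sheaf W (Posz 0) M) (I : injective_resolution F) :
  exists f : {additive hgroup W (Posz 0) M -> even_cohomology 0 I}, bijective f /\
  forall x, represents (iaug I Rp (eunit F Rp x)) (f x).
Proof.
have [||||||f [hb hr _]] := @cohomology_iso R H W F I 0 (hgroup W (Posz 0) M)
  (fun x z => z = iaug I Rp (unit0 F x)).
- by move=> x; exists (iaug I Rp (unit0 F x)).
- by move=> x z x' z' -> ->; rewrite even_unitB raddfB.
- by move=> z -> /=; rewrite [unit0 F 0](raddf0 (eunit F Rp)) (raddf0 (iaug I Rp)).
- by move=> x z ->; apply: idiff_iaug.
- move=> x z -> e; apply: (@even_unit_inj R H W hR M (@cmodP R H W M) 0 F 0 Rp x cell0_regular isT).
  by apply: (iaug_inj (i := I)); rewrite (raddf0 (iaug I Rp)); apply: e.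
- move=> z /(iaug_kernel (proj1 (even_sheaf_sheaf F))) [s <-].
  by have [x <-] := even_unit_surj hR (@cmodP R H W M) s cell0_regular isT; exists x.
by exists f; split=> // x; apply: hr.
Qed.

Lemma iso01 (F : even_sheaf W (Posz 2) M) (I : injective_resolution F) :
  exists f : {additive mul_coker W M -> even_cohomology 0 I}, bijective f /\
  forall x, represents (iaug I Rp (eunit F Rp x)) (f (\pi_(mul_coker W M) x)).
Proof.
have pi0 x : (\pi_(mul_coker W M) x = 0) <-> unit0 F x = 0.
  rewrite even_unit_eq0 (locally_zero_mul_im hR (@cmodP R H W M)).
  have -> : 0 = \pi_(mul_coker W M) 0 by rewrite (raddf0 (\pi_(mul_coker W M))).
  have -> : @in_mul_im R H W M x = (x \in @in_mul_im R H W M) by [].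
  by rewrite -[in X in _ <-> X](subr0 x) Quotient.idealrBE; split=> [->|/eqP].
have [||||||f [hb hr _]] := @cohomology_iso R H W F I 0 (mul_coker W M)
  (fun v z => exists x, v = \pi_(mul_coker W M) x /\ z = iaug I Rp (unit0 F x)).
- by move=> v; exists (iaug I Rp (unit0 F (repr v))), (repr v); rewrite reprK.
- move=> _ _ _ _ [x [-> ->]] [x' [-> ->]]; exists (x - x').
  split; first exact: (esym (raddfB (\pi_(mul_coker W M)) x x')).
  by rewrite [unit0 F (x - x')](raddfB (eunit F Rp)) (raddfB (iaug I Rp)).
- by move=> _ [x [/esym /pi0 e ->]] /=; rewrite e (raddf0 (iaug I Rp)).
- by move=> _ _ [x [_ ->]]; apply: idiff_iaug.
- move=> _ _ [x [-> ->]] e; apply/pi0.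
  by apply: (iaug_inj (i := I)); rewrite (raddf0 (iaug I Rp)); apply: e.
- move=> z /(iaug_kernel (proj1 (even_sheaf_sheaf F))) [s <-].
  have [x <-] := even_unit_surj hR (@cmodP R H W M) s cell0_regular isT.
  by exists (\pi_(mul_coker W M) x), x.
by exists f; split=> // x; apply: hr; exists x.
Qed.

(** As R is a 0-cell, m = 1 is the largest value that [delta1_inj] admits. *)
Lemma iso11 (F : even_sheaf W (Posz 2) M) (I : injective_resolution F) :
  exists f : {additive hgroup W (Posz 1) M -> even_cohomology 1 I},
  [/\ bijective f, forall x z, delta1 (m := 1) (A := Rp) x z -> represents z (f x) &
      forall x z, represents z (f x) ->
        exists z', delta1 (m := 1) (A := Rp) x z' /\ coboundary_of (z - z')].
Proof.
apply: (@cohomology_iso R H W F I 1 (hgroup W (Posz 1) M) (@delta1 R H W M 1 F I Rp)).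
- by move=> x; apply: (@delta1_total R H W M (@cmod_heven R H W M) 1 F I Rp x isT).
- by move=> x z x' z'; apply: (@delta1B R H W M 1 F I Rp x z x' z').
- by move=> z; apply: (@delta1_zero R H W M 1 F I Rp z).
- by move=> x z; apply: (@delta1_cocycle R H W M 1 F I Rp x z).
- move=> x z h [a ea]; rewrite -ea in h.
  exact: (@delta1_inj R H W hR M (@cmodP R H W M) 1 F I 0 Rp x a cell0_regular isT h).
- by move=> z; apply: (@delta1_surj R H W hR M (@cmodP R H W M) 1 F I 0 Rp z cell0_regular isT).
Qed.

(** On a 0-cell [delta2_inj] requires m <= 2, so m = 2 is extremal. By [locally_zero_mul_im] the
    domain consists of the elements of pi_2 M that are locally zero, which are those on which
    [delta2] is defined. *)
Lemma iso22 (F : even_sheaf W (Posz 4) M) (I : injective_resolution F) :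
  exists f : {additive mul_im W M -> even_cohomology 2 I},
  [/\ bijective f, forall x z, delta2 (m := 2) (A := Rp) (val x) z -> represents z (f x) &
      forall x z, represents z (f x) ->
        exists z', delta2 (m := 2) (A := Rp) (val x) z' /\ coboundary_of (z - z')].
Proof.
apply: (@cohomology_iso R H W F I 2 (mul_im W M)
  (fun x z => @delta2 R H W M 2 F I Rp (val x) z)).
- move=> x; have [B [p [hp e]]] := (locally_zero_mul_im hR (@cmodP R H W M) (val x)).2 (sgvalP x).
  exact: (delta2_total (@cmod_heven R H W M) I isT hp e).
- by move=> x z x' z' h h'; rewrite raddfB; apply: (delta2B (m := 2)).
- by move=> z; rewrite raddf0; apply: (delta2_zero (@cmod_heven R H W M) (m := 2)).
- by move=> x z; apply: (delta2_cocycle (m := 2)).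
- move=> x z h [a ea]; rewrite -ea in h; apply: val_inj; rewrite raddf0.
  exact: (delta2_inj hR (@cmodP R H W M) (m := 2) cell0_regular isT h).
- move=> z /(delta2_surj hR (@cmodP R H W M) (m := 2) cell0_regular isT) [y hy].
  have y_in : y \in @in_mul_im R H W M.
    exact: (locally_zero_mul_im hR (@cmodP R H W M) y).1 (delta2_local hy).
  by exists (Subgroup y_in).
Qed.

End Isomorphisms.

(** * Naturality of the connecting maps *)

Section Naturality.
Variables (R : E1ring) (H : hocat R) (W : loop_functor H) (M N : module R) (f : hhom H M N).
Local Notation "g ** f" := (hcomp g f) (at level 40, left associativity).

Lemma delta1_map m (F : even_sheaf W (Posz m.+1) M) (G : even_sheaf W (Posz m.+1) N)
    (I : injective_resolution F) (J : injective_resolution G) (c : resolution_map f I J)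
    (A : perf W) (y : hhom H A (lobn W m M)) (z : I 1%N A) :
  delta1 y z -> delta1 (lmorn W m f ** y) (c 1%N A z).
Proof.
move=> [K [B [d [i [p [k [t [h [kd it pz]]]]]]]]].
exists K, B, d, i, p, (lmorn W m.+1 f ** k), (c 0%N B t); split=> //; split.
- by rewrite -hcompA kd lmor_comp.
- by rewrite -pfun_nat it; apply: (rmap_aug c).
- by rewrite -pfun_nat pz rmap_diff.
Qed.

Lemma delta2_map m (F : even_sheaf W (Posz m.+2) M) (G : even_sheaf W (Posz m.+2) N)
    (I : injective_resolution F) (J : injective_resolution G) (c : resolution_map f I J)
    (A : perf W) (y : hhom H A (lobn W m M)) (z : I 2%N A) :
  delta2 y z -> delta2 (lmorn W m f ** y) (c 2%N A z).
Proof.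
move=> [K [B [d [i [p [k [t [h kd e pz]]]]]]]].
exists K, B, d, i, p, (lmorn W m.+1 f ** k), (c 1%N B t); split=> //.
- by rewrite -hcompA kd lmor_comp.
- by rewrite -pfun_nat; apply: (delta1_map (m := m.+1)).
- by rewrite -pfun_nat pz rmap_diff.
Qed.

Lemma represents_map n (F : even_sheaf W n M) (G : even_sheaf W n N)
    (I : injective_resolution F) (J : injective_resolution G) (c : resolution_map f I J)
    q (z z' : I q (Rperf W)) (x : cohomology J q) :
  represents (c q (Rperf W) z') x -> coboundary_of (z - z') -> represents (c q (Rperf W) z) x.
Proof.
move=> hx hz; apply: (represents_coboundary hx); rewrite -raddfB.
case: q z z' x hx hz => [|q] z z' x hx /=; first by move=> ->; rewrite raddf0.
by move=> [y <-]; exists (c q (Rperf W) y); rewrite rmap_diff.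
Qed.

End Naturality.

(* [H] is the homotopy category of Mod_R and [W] its loop functor.  The
   isomorphisms are canonical: they do not depend on the choice of even sheaf
   and injective resolution and are natural in M (take f the identity for the
   former); the first two are moreover induced by the unit of sheafification. *)
Theorem theorem1p9 (R : E1ring) (H : hocat R) (W : loop_functor H)
    (hR : connective W (regular R)) :
  exists
    (i00 : forall (M : connective_heven W) (F : even_sheaf W (Posz 0) M)
       (I : injective_resolution F),
       {additive hgroup W (Posz 0) M -> even_cohomology 0 I})
    (i01 : forall (M : connective_heven W) (F : even_sheaf W (Posz 2) M)
       (I : injective_resolution F),
       {additive mul_coker W M -> even_cohomology 0 I})
    (i11 : forall (M : connective_heven W) (F : even_sheaf W (Posz 2) M)
       (I : injective_resolution F),
       {additive hgroup W (Posz 1) M -> even_cohomology 1 I})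
    (i22 : forall (M : connective_heven W) (F : even_sheaf W (Posz 4) M)
       (I : injective_resolution F),
       {additive mul_im W M -> even_cohomology 2 I}),
  [/\ (* isomorphisms *)
      [/\ forall (M : connective_heven W) F I, bijective (i00 M F I),
          forall (M : connective_heven W) F I, bijective (i01 M F I),
          forall (M : connective_heven W) F I, bijective (i11 M F I) &
          forall (M : connective_heven W) F I, bijective (i22 M F I)],
      (* compatibility with the units *)
      forall (M : connective_heven W) F I (x : hgroup W (Posz 0) M),
        represents (iaug I (Rperf W) (eunit F (Rperf W) x)) (i00 M F I x),
      forall (M : connective_heven W) F I (x : hgroup W (Posz 2) M),
        represents (iaug I (Rperf W) (eunit F (Rperf W) x))
          (i01 M F I (\pi_(mul_coker W M) x)) &
      (* naturality *)
      (forall (M N : connective_heven W) (f : hhom H M N)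
         (F : even_sheaf W (Posz 2) M) (G : even_sheaf W (Posz 2) N)
         (I : injective_resolution F) (J : injective_resolution G)
         (c : resolution_map f I J) (x : hgroup W (Posz 1) M) (z : I 1%N (Rperf W)),
         represents z (i11 M F I x) ->
         represents (c 1%N (Rperf W) z) (i11 N G J (pi_map_post f x))) /\
      (forall (M N : connective_heven W) (f : hhom H M N)
         (F : even_sheaf W (Posz 4) M) (G : even_sheaf W (Posz 4) N)
         (I : injective_resolution F) (J : injective_resolution G)
         (c : resolution_map f I J) (x : mul_im W M) (y : mul_im W N)
         (z : I 2%N (Rperf W)),
         val y = pi_map_post f (val x) ->
         represents z (i22 M F I x) ->
         represents (c 2%N (Rperf W) z) (i22 N G J y))].
Proof.
exists (fun M F I => sval (cid (@iso00 R H W hR M F I))),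
  (fun M F I => sval (cid (@iso01 R H W hR M F I))),
  (fun M F I => sval (cid (@iso11 R H W hR M F I))),
  (fun M F I => sval (cid (@iso22 R H W hR M F I))).
split.
- by split=> M F I; case: cid => f /= [].
- by move=> M F I x; case: cid => f /= [].
- by move=> M F I x; case: cid => f /= [].
split=> M N f F G I J c x.
- move=> z; case: cid => a /= [_ _ ha]; case: cid => b /= [_ hb _].
  (* An arbitrary representative of the class differs by a coboundary from one produced by the
     connecting map, and for the latter naturality is [delta1_map]. *)
  move=> /ha [z' [hz' e]]; apply: (@represents_map R H W M N f _ F G I J c 1 z z' _ _ e); apply: hb.
  exact: (delta1_map (m := 1) c hz').
- move=> y z exy; case: cid => a /= [_ _ ha]; case: cid => b /= [_ hb _].
  move=> /ha [z' [hz' e]]; apply: (@represents_map R H W M N f _ F G I J c 2 z z' _ _ e); apply: hb.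
  by rewrite exy; apply: (delta2_map (m := 2) c hz').
Qed.
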